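(* Let $(u_0,u_1)\in\mathcal{N}$ with $u_1>0$. For $\gamma\ge 0$, let $u$ denote the maximal forward solution of the damped focusing Duffing equation $\ddot u+\gamma\dot u+u=u^3$, $(u(0),\dot u(0))=(u_0,u_1)$. (i) If $(u_0,u_1)\in\mathcal{N}_1$, then for every $\gamma\ge0$ the solution $u$ blows up in finite time. In addition, if $\gamma>0$, then the solution enters $\mathcal{K}^-\cap\{u_0>1\}$. (ii) Assume $(u_0,u_1)\in\mathcal{N}_2$. Then there exists $\gamma_0\ge0$ such that: if $0\le\gamma<\gamma_0$, the solution enters $\mathcal{N}_1$ and thus blows up in finite time; if $\gamma=\gamma_0$, then $(u(t),\dot u(t))\to(1,0)$ as $t\to+\infty$ at an exponential rate; if $\gamma>\gamma_0$, then $(u(t),\dot u(t))\to(0,0)$ as $t\to+\infty$ at an exponential rate. If in addition $E(u_0,u_1)=\frac14$, then $\gamma_0=0$. (iii) Assume $(u_0,u_1)\in\mathcal{N}_3$ with $E(u_0,u_1)>\frac14$. Then there exist $\gamma_1>\gamma_0\ge0$ such that: if $0\le\gamma<\gamma_0$, the solution enters $\mathcal{N}_1$ and thus blows up in finite time; if $\gamma=\gamma_0$, then $(u(t),\dot u(t))\to(1,0)$ as $t\to+\infty$ at an exponential rate; if $\gamma_0<\gamma<\gamma_1$, then $(u(t),\dot u(t))\to(0,0)$ as $t\to+\infty$ at an exponential rate; if $\gamma=\gamma_1$, then $(u(t),\dot u(t))\to(-1,0)$ as $t\to+\infty$ at an exponential rate; and if $\gamma>\gamma_1$, the solution enters $\mathcal{K}^-\cap\{u_0<-1\}$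 and therefore blows up in finite time. (iv) Assume $(u_0,u_1)\in\mathcal{N}_3$ with $E(u_0,u_1)=\frac14$. If $\gamma=0$, then $(u(t),\dot u(t))\to(-1,0)$ as $t\to+\infty$ at an exponential rate; if $\gamma>0$, then the solution enters $\mathcal{K}^-\cap\{u_0<-1\}$ and therefore blows up in finite time.
   Context: All functions are real-valued. For $(u_0,u_1)\in\mathbb{R}^2$ set $E(u_0,u_1)=\frac{u_0^2}{2}-\frac{u_0^4}{4}+\frac{u_1^2}{2}$. Define $\mathcal{K}^-=\{(u_0,u_1)\in\mathbb{R}^2: E(u_0,u_1)<\frac14,\ |u_0|>1\}$, $\mathcal{N}=\{(u_0,u_1)\in\mathbb{R}^2: E(u_0,u_1)\ge\frac14\}$, $\mathcal{N}_1=\{(u_0,u_1)\in\mathcal{N}: u_1>0,\ u_0\ge1\}$, $\mathcal{N}_2=\{(u_0,u_1)\in\mathcal{N}: u_1>0,\ -1\le u_0<1\}$, $\mathcal{N}_3=\{(u_0,u_1)\in\mathcal{N}: u_1>0,\ u_0<-1\}$. $\mathcal{K}^-\cap\{u_0>1\}$ and $\mathcal{K}^-\cap\{u_0<-1\}$ denote the subsets of $\mathcal{K}^-$ of points whose first coordinate is $>1$, respectively $<-1$. Let $T^+\in(0,+\infty]$ be the maximal (forward) time of existence of $u$. The solution blows up in finite time if $T^+<+\infty$; it enters a set $S\subset\mathbb{R}^2$ if $(u(t),\dot u(t))\in S$ for some $t\in[0,T^+)$; convergence as $t\to+\infty$ includes the assertion that $T^+=+\infty$. ''At an exponential rate'' means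 that there exist constants $C,c>0$ (possibly depending on the solution) such that the distance to the limit at time $t$ is at most $Ce^{-ct}$ for all $t\ge0$. *)

(* Defs.v *)
From Stdlib Require Import Reals.
From Coquelicot Require Import Coquelicot.
Open Scope R_scope.

Definition energy (x y : R) : R := x ^ 2 / 2 - x ^ 4 / 4 + y ^ 2 / 2.

Definition Kminus (x y : R) : Prop := energy x y < 1 / 4 /\ Rabs x > 1.
Definition Kminus_right (x y : R) : Prop := Kminus x y /\ x > 1.
Definition Kminus_left (x y : R) : Prop := Kminus x y /\ x < -1.

Definition Nset (x y : R) : Prop := energy x y >= 1 / 4.
Definition N1 (x y : R) : Prop := Nset x y /\ y > 0 /\ x >= 1.
Definition N2 (x y : R) : Prop := Nset x y /\ y > 0 /\ -1 <= x < 1.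
Definition N3 (x y : R) : Prop := Nset x y /\ y > 0 /\ x < -1.

Definition forward_interval (T : Rbar) (t : R) : Prop := 0 <= t /\ Rbar_lt t T.

(* [v] is the derivative of [u].  [D_in] is differentiability relative to the
   interval, hence two-sided at interior times and one-sided at time 0; values
   of [u] and [v] outside [0, T) are irrelevant. *)
Definition duffing_solution (gamma u0 u1 : R) (T : Rbar) (u v : R -> R) : Prop :=
  Rbar_lt 0 T /\
  u 0 = u0 /\ v 0 = u1 /\
  forall t, forward_interval T t ->
    D_in u v (forward_interval T) t /\
    exists a : R -> R,
      D_in v a (forward_interval T) t /\
      a t + gamma * v t + u t = u t ^ 3.

Definition maximal_duffing_solution
    (gamma u0 u1 : R) (T : Rbar) (u v : R -> R) : Prop :=
  duffing_solution gamma u0 u1 T u v /\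
  forall (T' : Rbar) (u' v' : R -> R),
    duffing_solution gamma u0 u1 T' u' v' ->
    (forall t, forward_interval T t -> forward_interval T' t /\ u' t = u t) ->
    Rbar_le T' T.

Definition blows_up (T : Rbar) : Prop := Rbar_lt T p_infty.

Definition enters (S : R -> R -> Prop) (T : Rbar) (u v : R -> R) : Prop :=
  exists t, forward_interval T t /\ S (u t) (v t).

Definition converges_exponentially
    (a b : R) (T : Rbar) (u v : R -> R) : Prop :=
  T = p_infty /\
  is_lim u p_infty a /\ is_lim v p_infty b /\
  exists C c : R, C > 0 /\ c > 0 /\
    forall t, t >= 0 ->
      sqrt ((u t - a) ^ 2 + (v t - b) ^ 2) <= C * exp (- c * t).

(* Main.v *)
Require Import Defs.
From Stdlib Require Import Reals Lra Psatz Lia Classical ClassicalEpsilon.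
From Coquelicot Require Import Coquelicot.
Open Scope R_scope.

(** While [v > 0] a trajectory is a graph over the [u]-axis, and its velocity at a given position
    decreases strictly with the damping.  Starting from [u0 < 1], the rightward motion either
    crosses [u = 1], after which it blows up, or stalls at some abscissa [x <= 1]: a point [x < -1]
    leads into [Kminus_left] and blow-up, [|x| < 1] leads into the potential well, where [E + eps u v]
    is a Lyapunov function, and [x = 1], [x = -1] mean convergence to a saddle.  The crossing
    behaviour and the stalls at [x < -1] or [|x| < 1] are open conditions on the damping, and the
    stalls at a saddle happen for one damping only, so [gamma0] is the supremum of the dampings
    that cross [u = 1] and [gamma1] the infimum of those that stall at [x < -1].  At a saddle,
    [E >= 1/4] forces [v >= |a - u| / 2], hence exponential convergence. *)

(** * Calculus on intervals *)

(** A point at rest has energy at most 1/4, with equality only at the two saddles. Below this level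
    the lines u = 1 and u = -1 cannot be crossed, while a motion that stalls at a saddle keeps E >=
    1/4 all along. Stalling at a saddle does not survive a change of damping, so no continuity
    argument finds it directly: it is obtained by elimination, as the only behaviour left at the end
    point of a set of dampings. Two facts carry the elimination. The velocity gap between two
    dampings at a common position does not shrink where u - u^3 >= 0, in particular just left of
    either saddle, so the two motions cannot both lose their velocity there. And going from -1 to
    beyond 1 dissipates at least 2 g / 3, because E >= 1/4 gives v >= (1 - u^2) / 2; hence dampings
    just below gamma0 do not come to -1 almost at rest, the motion at gamma0 stalls at 1 and not at
    -1, and gamma0 < gamma1. The theorem speaks of given solutions, but a supremum over dampings
    needs a solution for every damping and continuous dependence on it, which is why existence
    theory comes first. *)

Lemma continuous_eps (f : R -> R) (t eps : R) :
  continuous f t -> 0 < eps ->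
  exists d, 0 < d /\ forall s, Rabs (s - t) < d -> Rabs (f s - f t) < eps.
Proof.
  intros Hf He.
  destruct (proj1 (filterlim_locally f (f t)) Hf (mkposreal eps He)) as [d Hd].
  exists d; split; [apply cond_pos|].
  intros s Hs. apply (Hd s Hs).
Qed.

Lemma is_derive_continuous (f : R -> R) (t l : R) : is_derive f t l -> continuous f t.
Proof. intros H. apply (ex_derive_continuous f). now exists l. Qed.

Lemma first_exit (f : R -> R) (a b c : R) :
  a <= b -> (forall t, a <= t <= b -> continuous f t) -> f a < c -> c <= f b ->
  exists t, a < t <= b /\ f t = c /\ forall s, a <= s < t -> f s < c.
Proof.
  intros Hab Hc Ha Hb.
  set (S := fun x => a <= x <= b /\ forall s, a <= s <= x -> f s < c).
  assert (HS : S a).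
  { split; [lra|]. intros s Hs. replace s with a by lra. exact Ha. }
  destruct (completeness S) as [t [Hub Hlub]].
  { exists b. intros x [Hx _]. lra. }
  { now exists a. }
  assert (Hat : a <= t) by (now apply Hub).
  assert (Htb : t <= b) by (apply Hlub; intros x [Hx _]; lra).
  assert (Hbelow : forall s, a <= s < t -> f s < c).
  { intros s Hs. destruct (Rlt_dec (f s) c) as [H|H]; [exact H|exfalso].
    assert (t <= s); [|lra]. apply Hlub. intros x [Hx Hx'].
    destruct (Rle_dec x s) as [|Hn]; [assumption|].
    exfalso; apply H, Hx'; lra. }
  assert (Hft : f t = c).
  { destruct (Rtotal_order (f t) c) as [H|[H|H]]; [exfalso|exact H|exfalso].
    - destruct (continuous_eps f t (c - f t)) as [d [Hd Hd']]; [apply Hc; lra|lra|].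
      assert (t < b).
      { destruct (Rlt_dec t b); [assumption|]. assert (t = b) by lra. subst t. lra. }
      set (x := Rmin b (t + d / 2)).
      assert (t < x) by (apply Rmin_glb_lt; lra).
      assert (Hxb : x <= b) by apply Rmin_l.
      assert (Hxd : x <= t + d / 2) by apply Rmin_r.
      assert (x <= t); [|lra]. apply Hub. split; [lra|].
      intros s Hs. destruct (Rlt_dec s t); [apply Hbelow; lra|].
      specialize (Hd' s ltac:(apply Rabs_def1; lra)).
      apply Rabs_def2 in Hd'. lra.
    - destruct (continuous_eps f t (f t - c)) as [d [Hd Hd']]; [apply Hc; lra|lra|].
      assert (a < t).
      { destruct (Rlt_dec a t); [assumption|]. assert (t = a) by lra. subst t. lra. }
      set (x := Rmax a (t - d / 2)).
      assert (x < t) by (apply Rmax_lub_lt; lra).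
      assert (Hxb : a <= x) by apply Rmax_l.
      assert (Hxd : t - d / 2 <= x) by apply Rmax_r.
      specialize (Hd' x ltac:(apply Rabs_def1; lra)).
      apply Rabs_def2 in Hd'. specialize (Hbelow x ltac:(lra)). lra. }
  exists t. repeat split; try lra; try assumption.
  destruct (Rlt_dec a t); [assumption|]. assert (t = a) by lra. subst t. lra.
Qed.

Lemma first_zero (f : R -> R) (a b : R) :
  a <= b -> (forall t, a <= t <= b -> continuous f t) -> 0 < f a -> f b <= 0 ->
  exists t, a < t <= b /\ f t = 0 /\ forall s, a <= s < t -> 0 < f s.
Proof.
  intros Hab Hc Ha Hb.
  destruct (first_exit (fun t => - f t) a b 0) as [t [Ht [Hft Hs]]]; try lra.
  { intros t Ht. apply (continuous_opp f t). now apply Hc. }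
  exists t. repeat split; try lra. intros s Hs'. specialize (Hs s Hs'). lra.
Qed.

Lemma ivt_le (f : R -> R) (a b c : R) :
  a <= b -> (forall t, a <= t <= b -> continuous f t) -> f a <= c <= f b ->
  exists t, a <= t <= b /\ f t = c.
Proof.
  intros Hab Hc [Ha Hb].
  destruct (Req_dec (f a) c) as [H|H]; [exists a; split; [lra|assumption]|].
  destruct (first_exit f a b c) as [t [Ht [Hft _]]]; try lra; try assumption.
  exists t; split; [lra|assumption].
Qed.

(** Derivatives are asked only inside the interval: the functions that [velocity_comparison] builds
    from the inverse of [u] are continuous up to the ends, but their derivative is computed only in
    between. *)
Lemma mvt_open (f df : R -> R) (a b : R) :
  a < b -> (forall t, a < t < b -> is_derive f t (df t)) ->
  (forall t, a <= t <= b -> continuous f t) ->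
  exists c, a < c < b /\ f b - f a = df c * (b - a).
Proof.
  intros Hab Hd Hc.
  assert (pr : forall c, a < c < b -> derivable_pt f c).
  { intros c Hc'. exists (df c). now apply is_derive_Reals, Hd. }
  destruct (MVT f id a b pr (fun c _ => derivable_pt_id c) Hab) as [c [P HP]].
  { intros c Hc'. apply continuity_pt_filterlim, Hc; assumption. }
  { intros c Hc'. apply derivable_continuous, derivable_id. }
  exists c; split; [exact P|].
  rewrite (derive_pt_eq_0 id c 1 _ (derivable_pt_lim_id c)) in HP.
  rewrite (derive_pt_eq_0 f c (df c) (pr c P)) in HP.
  - unfold id in HP. lra.
  - now apply is_derive_Reals, Hd.
Qed.

Lemma derive_nonneg_le (f df : R -> R) (a b : R) :
  a <= b -> (forall t, a < t < b -> is_derive f t (df t)) ->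
  (forall t, a <= t <= b -> continuous f t) ->
  (forall t, a < t < b -> 0 <= df t) -> f a <= f b.
Proof.
  intros Hab Hd Hc Hp.
  destruct (Req_dec a b) as [->|Hn]; [lra|].
  destruct (mvt_open f df a b) as [c [Hc' E]]; try assumption; [lra|].
  specialize (Hp c Hc'). nra.
Qed.

Lemma derive_pos_lt (f df : R -> R) (a b : R) :
  a < b -> (forall t, a < t < b -> is_derive f t (df t)) ->
  (forall t, a <= t <= b -> continuous f t) ->
  (forall t, a < t < b -> 0 < df t) -> f a < f b.
Proof.
  intros Hab Hd Hc Hp.
  destruct (mvt_open f df a b) as [c [Hc' E]]; try assumption.
  specialize (Hp c Hc'). nra.
Qed.

(** If [w b] were negative, run time backwards from [b] to the nearest zero of [w]. In between [w]
    is negative, hence nondecreasing in forward time, so [w b] is at least the value at that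
    zero. *)
Lemma barrier (w dw : R -> R) (a b : R) :
  a <= b -> (forall t, a < t < b -> is_derive w t (dw t)) ->
  (forall t, a <= t <= b -> continuous w t) ->
  0 <= w a -> (forall t, a < t < b -> w t < 0 -> 0 <= dw t) -> 0 <= w b.
Proof.
  intros Hab Hd Hc Ha Hw.
  destruct (Rle_dec 0 (w b)) as [H|H]; [exact H|exfalso].
  destruct (first_exit (fun t => w (a + b - t)) a b 0) as [t [Ht [Hft Hs]]].
  - exact Hab.
  - intros t Ht. apply (continuous_comp (fun t => a + b - t) w).
    + apply (continuous_minus (fun _ => a + b) (fun t => t)).
      * apply continuous_const.
      * apply continuous_id.
    + apply Hc. lra.
  - replace (a + b - a) with b by ring. lra.
  - replace (a + b - b) with a by ring. exact Ha.
  - assert (w (a + b - t) <= w b); [|lra].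
    apply (derive_nonneg_le w dw); try lra.
    + intros s Hs'. apply Hd. lra.
    + intros s Hs'. apply Hc. lra.
    + intros s Hs'. apply Hw; [lra|].
      specialize (Hs (a + b - s) ltac:(lra)).
      now replace (a + b - (a + b - s)) with s in Hs by ring.
Qed.

Lemma continuous_bounded (f : R -> R) (a b : R) :
  a <= b -> (forall t, a <= t <= b -> continuous f t) ->
  exists M, 0 < M /\ forall t, a <= t <= b -> Rabs (f t) <= M.
Proof.
  intros Hab Hc.
  destruct (continuity_ab_maj (fun t => Rabs (f t)) a b Hab) as [m [Hm _]].
  { intros c Hc'. apply continuity_pt_filterlim.
    apply (continuous_comp f Rabs); [now apply Hc|apply continuous_Rabs]. }
  exists (Rabs (f m) + 1). split; [pose proof (Rabs_pos (f m)); lra|].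
  intros t Ht. specialize (Hm t Ht). simpl in Hm. lra.
Qed.

Lemma continuous_pos_min (f : R -> R) (a b : R) :
  a <= b -> (forall t, a <= t <= b -> continuous f t) ->
  (forall t, a <= t <= b -> 0 < f t) ->
  exists m, 0 < m /\ forall t, a <= t <= b -> m <= f t.
Proof.
  intros Hab Hc Hp.
  destruct (continuity_ab_min f a b Hab) as [m [Hm Hm']].
  { intros c Hc'. now apply continuity_pt_filterlim, Hc. }
  exists (f m). split; [now apply Hp|exact Hm].
Qed.

(** For expressions in abstract functions such as [u] and [v], [auto_derive] answers with [Derive];
    the values are then read off the [is_derive] hypotheses in the context. *)
Ltac derive_atoms :=
  auto_derive;
  [ repeat split; try exact I; try (eexists; eassumption)
  | repeat match goal with
    | H : is_derive ?f ?t ?l |- context [Derive ?k ?t] =>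
        rewrite (is_derive_unique k t l H)
    end ].

Lemma abs_le_sum_sq (x y e : R) : 0 <= e -> x ^ 2 + y ^ 2 <= e ^ 2 -> Rabs x <= e.
Proof.
  intros He H. rewrite <- (pow2_abs x) in H. pose proof (pow2_ge_0 y).
  destruct (Rle_dec (Rabs x) e); [assumption|]. nra.
Qed.

Lemma abs_lt_sum_sq (x y e : R) : 0 <= e -> x ^ 2 + y ^ 2 < e ^ 2 -> Rabs x < e.
Proof.
  intros He H. rewrite <- (pow2_abs x) in H. pose proof (pow2_ge_0 y).
  destruct (Rlt_dec (Rabs x) e); [assumption|]. nra.
Qed.

(** * The Picard-Lindelof theorem for bounded Lipschitz fields *)

Definition lipschitz (k : R) (h : R -> R) : Prop :=
  forall s t, Rabs (h s - h t) <= k * Rabs (s - t).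

Lemma lipschitz_continuous (k : R) (h : R -> R) (t : R) : lipschitz k h -> continuous h t.
Proof.
  intros Hh. apply filterlim_locally. intros eps.
  assert (Hk : 0 < Rabs k + 1) by (pose proof (Rabs_pos k); lra).
  assert (Hd : 0 < eps / (Rabs k + 1)) by (apply Rdiv_lt_0_compat; [apply cond_pos|lra]).
  exists (mkposreal _ Hd). intros s Hs.
  change (Rabs (s - t) < eps / (Rabs k + 1)) in Hs. change (Rabs (h s - h t) < eps).
  apply (Rmult_lt_compat_r _ _ _ Hk) in Hs.
  replace (eps / (Rabs k + 1) * (Rabs k + 1)) with (pos eps) in Hs by (field; lra).
  specialize (Hh s t). pose proof (Rle_abs k). pose proof (Rabs_pos (s - t)). nra.
Qed.

Lemma lipschitz_derive (k : R) (h dh : R -> R) :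
  (forall t, is_derive h t (dh t)) -> (forall t, Rabs (dh t) <= k) -> lipschitz k h.
Proof.
  intros Hd Hk.
  assert (H : forall s t, s < t -> Rabs (h s - h t) <= k * Rabs (s - t)).
  { intros s t Hst. destruct (mvt_open h dh s t Hst) as [c [_ E]].
    - intros; apply Hd.
    - intros; eapply is_derive_continuous, Hd.
    - rewrite (Rabs_minus_sym (h s)), (Rabs_minus_sym s), E, Rabs_mult.
      apply Rmult_le_compat_r; [apply Rabs_pos|apply Hk]. }
  intros s t. destruct (Rtotal_order s t) as [Hst|[->|Hst]].
  - now apply H.
  - rewrite !Rminus_diag, Rabs_R0. lra.
  - rewrite (Rabs_minus_sym (h s)), (Rabs_minus_sym s). now apply H.
Qed.

Lemma Rmax_0_lipschitz (s t : R) : Rabs (Rmax 0 s - Rmax 0 t) <= Rabs (s - t).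
Proof. unfold Rmax, Rabs. repeat destruct Rle_dec; repeat destruct Rcase_abs; lra. Qed.

Lemma primitive_derive (h : R -> R) :
  (forall t, continuous h t) -> forall t, is_derive (fun b => RInt h 0 b) t (h t).
Proof.
  intros Hh t. apply (is_derive_RInt h _ 0); [|apply Hh].
  apply filter_forall. intros b. apply (RInt_correct h), (ex_RInt_continuous h).
  intros; apply Hh.
Qed.

(** In the supremum norm weighted by exp(-K t), integration gains a factor 1 / K. This weight lets
    the Picard iteration contract on the whole half-line at once. *)
Lemma primitive_diff_bound (h1 h2 : R -> R) (A K t : R) :
  (forall s, continuous h1 s) -> (forall s, continuous h2 s) -> 0 <= A -> 0 <= t ->
  (forall s, 0 <= s -> Rabs (h1 s - h2 s) <= A * K * exp (K * s)) ->
  Rabs (RInt h1 0 t - RInt h2 0 t) <= A * exp (K * t).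
Proof.
  intros C1 C2 HA Ht Hh.
  pose proof (primitive_derive h1 C1) as D1. pose proof (primitive_derive h2 C2) as D2.
  assert (Z1 : RInt h1 0 0 = 0) by apply (RInt_point (V := R_CompleteNormedModule)).
  assert (Z2 : RInt h2 0 0 = 0) by apply (RInt_point (V := R_CompleteNormedModule)).
  assert (He : forall s, is_derive (fun s => A * exp (K * s)) s (A * K * exp (K * s))).
  { intros s. auto_derive; [exact I|ring]. }
  assert (Dd : forall s, is_derive (fun s => RInt h1 0 s - RInt h2 0 s) s (h1 s - h2 s)).
  { intros s. apply (is_derive_minus (fun s => RInt h1 0 s) (fun s => RInt h2 0 s)); auto. }
  apply Rabs_le. split.
  - assert (H : A * exp (K * 0) + (RInt h1 0 0 - RInt h2 0 0)
      <= A * exp (K * t) + (RInt h1 0 t - RInt h2 0 t)).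
    { assert (D : forall s, is_derive
        (fun s => A * exp (K * s) + (RInt h1 0 s - RInt h2 0 s)) s
        (A * K * exp (K * s) + (h1 s - h2 s))).
      { intros s. apply (is_derive_plus (fun s => A * exp (K * s))); auto. }
      apply (derive_nonneg_le _ _ 0 t Ht (fun s _ => D s)).
      - intros s _. eapply is_derive_continuous, D.
      - intros s Hs. specialize (Hh s ltac:(lra)). simpl.
        apply Rabs_le_between in Hh. lra. }
    rewrite Z1, Z2, Rmult_0_r, exp_0 in H. lra.
  - assert (H : A * exp (K * 0) - (RInt h1 0 0 - RInt h2 0 0)
      <= A * exp (K * t) - (RInt h1 0 t - RInt h2 0 t)).
    { assert (D : forall s, is_derive
        (fun s => A * exp (K * s) - (RInt h1 0 s - RInt h2 0 s)) s
        (A * K * exp (K * s) - (h1 s - h2 s))).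
      { intros s. apply (is_derive_minus (fun s => A * exp (K * s))); auto. }
      apply (derive_nonneg_le _ _ 0 t Ht (fun s _ => D s)).
      - intros s _. eapply is_derive_continuous, D.
      - intros s Hs. specialize (Hh s ltac:(lra)). simpl.
        apply Rabs_le_between in Hh. lra. }
    rewrite Z1, Z2, Rmult_0_r, exp_0 in H. lra.
Qed.

Lemma half_pow_pos (n : nat) : 0 < (1 / 2) ^ n.
Proof. apply pow_lt; lra. Qed.

Lemma geometric_eq (x y C : R) : (forall n, Rabs (x - y) <= C * (1 / 2) ^ n) -> x = y.
Proof.
  intros H.
  assert (L : is_lim_seq (fun n => C * (1 / 2) ^ n) (C * 0)).
  { apply (is_lim_seq_scal_l _ C 0), is_lim_seq_geom. rewrite Rabs_pos_eq; lra. }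
  assert (L' := is_lim_seq_le _ _ _ _ H (is_lim_seq_const _) L).
  simpl in L'. rewrite Rmult_0_r in L'.
  pose proof (Rabs_pos (x - y)). apply Rminus_diag_uniq.
  destruct (Req_dec (x - y) 0) as [E|E]; [exact E|].
  apply Rabs_pos_lt in E. lra.
Qed.

Lemma geometric_lim (a : nat -> R) (C : R) :
  (forall n, Rabs (a (S n) - a n) <= C * (1 / 2) ^ n) ->
  forall n, Rabs (a n - real (Lim_seq a)) <= 2 * C * (1 / 2) ^ n.
Proof.
  intros H.
  assert (HC : 0 <= C).
  { specialize (H O). pose proof (Rabs_pos (a 1%nat - a O)). simpl in H. lra. }
  assert (T : forall n k, Rabs (a (n + k)%nat - a n) <= 2 * C * ((1 / 2) ^ n - (1 / 2) ^ (n + k))).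
  { intros n. induction k as [|k IH].
    - rewrite Nat.add_0_r, !Rminus_diag, Rabs_R0. lra.
    - rewrite Nat.add_succ_r. specialize (H (n + k)%nat).
      replace (a (S (n + k)) - a n) with ((a (S (n + k)) - a (n + k)%nat) + (a (n + k)%nat - a n)) by ring.
      pose proof (Rabs_triang (a (S (n + k)) - a (n + k)%nat) (a (n + k)%nat - a n)).
      simpl. lra. }
  assert (T' : forall n m, (n <= m)%nat -> Rabs (a m - a n) <= 2 * C * (1 / 2) ^ n).
  { intros n m Hnm. replace m with (n + (m - n))%nat by lia.
    specialize (T n (m - n)%nat). pose proof (half_pow_pos (n + (m - n))). nra. }
  assert (F : ex_finite_lim_seq a).
  { apply ex_lim_seq_cauchy_corr. intros eps.
    assert (L : is_lim_seq (fun n => 2 * C * (1 / 2) ^ n) (2 * C * 0)).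
    { apply (is_lim_seq_scal_l _ (2 * C) 0), is_lim_seq_geom. rewrite Rabs_pos_eq; lra. }
    rewrite Rmult_0_r in L. apply is_lim_seq_spec in L.
    destruct (L (mkposreal (eps / 2) (is_pos_div_2 eps))) as [N HN].
    exists N. intros n m Hn Hm. specialize (HN N (Nat.le_refl N)). simpl in HN.
    apply Rabs_def2 in HN.
    pose proof (T' N n Hn). pose proof (T' N m Hm).
    replace (a n - a m) with ((a n - a N) + - (a m - a N)) by ring.
    eapply Rle_lt_trans; [apply Rabs_triang|]. rewrite Rabs_Ropp. lra. }
  intros n. apply Lim_seq_correct' in F.
  assert (L : is_lim_seq (fun m => Rabs (a n - a (m + n)%nat)) (Rabs (a n - real (Lim_seq a)))).
  { apply (is_lim_seq_abs _ (a n - real (Lim_seq a))).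
    apply (is_lim_seq_minus' (fun _ => a n)); [apply is_lim_seq_const|].
    now apply (is_lim_seq_incr_n a n). }
  apply (is_lim_seq_le _ _ _ (2 * C * (1 / 2) ^ n)) with (2 := L) (3 := is_lim_seq_const _).
  intros m. rewrite Rabs_minus_sym. apply T'. lia.
Qed.

(* [Rmax 0 s] freezes the field at negative times, so that only [t >= 0] needs estimates. *)
Definition picard_map (f : R -> R -> R) (x0 : R) (x y : R -> R) (t : R) : R :=
  x0 + RInt (fun s => f (x (Rmax 0 s)) (y (Rmax 0 s))) 0 t.

Fixpoint picard_seq (f g : R -> R -> R) (x0 y0 : R) (n : nat) : (R -> R) * (R -> R) :=
  match n with
  | O => (fun _ => x0, fun _ => y0)
  | S m => let z := picard_seq f g x0 y0 m in
           (picard_map f x0 (fst z) (snd z), picard_map g y0 (fst z) (snd z))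
  end.

Definition field_lipschitz (L : R) (f : R -> R -> R) : Prop :=
  forall x y x' y', Rabs (f x y - f x' y') <= L * (Rabs (x - x') + Rabs (y - y')).

Lemma field_comp_continuous (f : R -> R -> R) (L B : R) (x y : R -> R) (t : R) :
  0 <= L -> field_lipschitz L f -> lipschitz B x -> lipschitz B y ->
  continuous (fun s => f (x (Rmax 0 s)) (y (Rmax 0 s))) t.
Proof.
  intros HL Hf Hx Hy.
  apply (lipschitz_continuous (L * (Rabs B + Rabs B))). intros r s.
  eapply Rle_trans; [apply Hf|]. rewrite Rmult_assoc. apply Rmult_le_compat_l; [exact HL|].
  specialize (Hx (Rmax 0 r) (Rmax 0 s)). specialize (Hy (Rmax 0 r) (Rmax 0 s)).
  pose proof (Rmax_0_lipschitz r s). pose proof (Rabs_pos (Rmax 0 r - Rmax 0 s)).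
  pose proof (Rle_abs B). pose proof (Rabs_pos B). nra.
Qed.

Lemma picard_map_derive (f : R -> R -> R) (L B x0 : R) (x y : R -> R) (t : R) :
  0 <= L -> field_lipschitz L f -> lipschitz B x -> lipschitz B y ->
  is_derive (picard_map f x0 x y) t (f (x (Rmax 0 t)) (y (Rmax 0 t))).
Proof.
  intros HL Hf Hx Hy. unfold picard_map.
  replace (f (x (Rmax 0 t)) (y (Rmax 0 t))) with (0 + f (x (Rmax 0 t)) (y (Rmax 0 t))) by ring.
  apply (is_derive_plus (fun _ => x0)); [apply (is_derive_const x0)|].
  apply (primitive_derive (fun s => f (x (Rmax 0 s)) (y (Rmax 0 s)))).
  intros s. now apply (field_comp_continuous f L B).
Qed.

Lemma picard_map_lipschitz (f : R -> R -> R) (L B x0 : R) (x y : R -> R) :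
  0 <= L -> field_lipschitz L f -> (forall a b, Rabs (f a b) <= B) ->
  lipschitz B x -> lipschitz B y -> lipschitz B (picard_map f x0 x y).
Proof.
  intros HL Hf HB Hx Hy. eapply lipschitz_derive.
  - intros t. now apply (picard_map_derive f L B).
  - intros t. apply HB.
Qed.

(** The integrands differ by at most 2 L A exp(4 L t), one L A for each component, and the weight
    exp(4 L t) divides by 4 L: the map contracts by 1/2. *)
Lemma picard_map_diff (f : R -> R -> R) (L B x0 A : R) (x y x' y' : R -> R) :
  0 <= L -> field_lipschitz L f -> lipschitz B x -> lipschitz B y ->
  lipschitz B x' -> lipschitz B y' -> 0 <= A ->
  (forall t, 0 <= t -> Rabs (x t - x' t) <= A * exp (4 * L * t)) ->
  (forall t, 0 <= t -> Rabs (y t - y' t) <= A * exp (4 * L * t)) ->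
  forall t, 0 <= t ->
    Rabs (picard_map f x0 x y t - picard_map f x0 x' y' t) <= A * (1 / 2) * exp (4 * L * t).
Proof.
  intros HL Hf Hx Hy Hx' Hy' HA Dx Dy t Ht. unfold picard_map.
  match goal with |- Rabs (_ + ?a - (_ + ?b)) <= _ =>
    replace (x0 + a - (x0 + b)) with (a - b) by ring end.
  apply primitive_diff_bound; try lra.
  - intros s. now apply (field_comp_continuous f L B).
  - intros s. now apply (field_comp_continuous f L B).
  - intros s Hs. rewrite Rmax_right by exact Hs.
    eapply Rle_trans; [apply Hf|]. specialize (Dx s Hs). specialize (Dy s Hs). nra.
Qed.

Lemma picard_lindelof (f g : R -> R -> R) (L B x0 y0 : R) :
  0 < L -> field_lipschitz L f -> field_lipschitz L g ->
  (forall a b, Rabs (f a b) <= B) -> (forall a b, Rabs (g a b) <= B) ->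
  exists x y : R -> R, x 0 = x0 /\ y 0 = y0 /\
    forall t, 0 <= t -> is_derive x t (f (x t) (y t)) /\ is_derive y t (g (x t) (y t)).
Proof.
  intros HL Hf Hg Bf Bg.
  assert (HB : 0 <= B) by (eapply Rle_trans; [apply Rabs_pos|apply (Bf 0 0)]).
  set (z := picard_seq f g x0 y0).
  assert (Lz : forall n, lipschitz B (fst (z n)) /\ lipschitz B (snd (z n))).
  { induction n as [|n [IHx IHy]]; simpl.
    - split; intros s t; rewrite Rminus_diag, Rabs_R0; pose proof (Rabs_pos (s - t)); nra.
    - split; apply (picard_map_lipschitz _ L); try assumption; lra. }
  (* With this value the bound [B] on the field is A (4 L), so the first increment is at most A
     exp(4 L t) by [primitive_diff_bound]. *)
  set (A := B / (4 * L)).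
  assert (HA : 0 <= A) by (apply Rdiv_le_0_compat; lra).
  assert (HAB : A * (4 * L) = B) by (unfold A; field; lra).
  assert (Dz : forall n t, 0 <= t ->
    Rabs (fst (z (S n)) t - fst (z n) t) <= A * (1 / 2) ^ n * exp (4 * L * t) /\
    Rabs (snd (z (S n)) t - snd (z n) t) <= A * (1 / 2) ^ n * exp (4 * L * t)).
  { induction n as [|n IH]; intros t Ht.
    - assert (F : forall h w0, field_lipschitz L h -> (forall a b, Rabs (h a b) <= B) ->
        Rabs (picard_map h w0 (fun _ => x0) (fun _ => y0) t - w0) <= A * exp (4 * L * t)).
      { intros h w0 Hh Bh. unfold picard_map.
        assert (E : RInt (fun _ => 0) 0 t = 0) by (rewrite RInt_const; apply Rmult_0_r).
        match goal with |- Rabs (_ + ?a - _) <= _ => replace (w0 + a - w0)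
          with (a - RInt (fun _ => 0) 0 t) by (rewrite E; ring) end.
        apply primitive_diff_bound; try assumption.
        - intros s. apply continuous_const.
        - intros s. apply continuous_const.
        - intros s Hs. rewrite Rminus_0_r, HAB. eapply Rle_trans; [apply Bh|].
          pose proof (exp_ineq1_le (4 * L * s)). assert (0 <= 4 * L * s) by nra.
          rewrite <- (Rmult_1_r B) at 1. apply Rmult_le_compat_l; lra. }
      rewrite Rmult_1_r. split; simpl; apply F; assumption.
    - assert (HA' : 0 <= A * (1 / 2) ^ n) by (pose proof (half_pow_pos n); nra).
      destruct (Lz n) as [Lx Ly]. destruct (Lz (S n)) as [Lx' Ly'].
      replace (A * (1 / 2) ^ S n) with (A * (1 / 2) ^ n * (1 / 2)) by (simpl; ring).
      split.
      + apply (picard_map_diff f L B x0); try assumption; try lra; intros; now apply IH.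
      + apply (picard_map_diff g L B y0); try assumption; try lra; intros; now apply IH. }
  set (X := fun t => real (Lim_seq (fun n => fst (z n) (Rmax 0 t)))).
  set (Y := fun t => real (Lim_seq (fun n => snd (z n) (Rmax 0 t)))).
  assert (CX : forall n t, 0 <= t ->
    Rabs (fst (z n) t - X t) <= 2 * A * (1 / 2) ^ n * exp (4 * L * t)).
  { intros n t Ht. unfold X. rewrite Rmax_right by exact Ht.
    replace (2 * A * (1 / 2) ^ n * exp (4 * L * t))
      with (2 * (A * exp (4 * L * t)) * (1 / 2) ^ n) by ring.
    apply (geometric_lim (fun n => fst (z n) t)). intros m.
    destruct (Dz m t Ht) as [H _]. lra. }
  assert (CY : forall n t, 0 <= t ->
    Rabs (snd (z n) t - Y t) <= 2 * A * (1 / 2) ^ n * exp (4 * L * t)).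
  { intros n t Ht. unfold Y. rewrite Rmax_right by exact Ht.
    replace (2 * A * (1 / 2) ^ n * exp (4 * L * t))
      with (2 * (A * exp (4 * L * t)) * (1 / 2) ^ n) by ring.
    apply (geometric_lim (fun n => snd (z n) t)). intros m.
    destruct (Dz m t Ht) as [_ H]. lra. }
  (* The limits inherit the Lipschitz constant of the iterates; this keeps the integrand of
     [picard_map] continuous at the limit, so that it can be differentiated. *)
  assert (lip_lim : forall (a : nat -> R -> R) (W : R -> R),
    (forall n, lipschitz B (a n)) -> (forall t, W t = W (Rmax 0 t)) ->
    (forall n t, 0 <= t -> Rabs (a n t - W t) <= 2 * A * (1 / 2) ^ n * exp (4 * L * t)) ->
    lipschitz B W).
  { intros a W Ha HW CW r s. rewrite (HW r), (HW s).
    apply Rle_trans with (B * Rabs (Rmax 0 r - Rmax 0 s));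
      [|apply Rmult_le_compat_l; [exact HB|apply Rmax_0_lipschitz]].
    assert (P : 0 <= Rmax 0 r /\ 0 <= Rmax 0 s) by (split; apply Rmax_l).
    set (p := Rmax 0 r) in *. set (q := Rmax 0 s) in *. destruct P as [Pp Pq].
    set (c := 2 * A * exp (4 * L * p) + 2 * A * exp (4 * L * q)).
    assert (H : forall n, Rabs (W p - W q) - B * Rabs (p - q) <= c * (1 / 2) ^ n).
    { intros n. pose proof (CW n p Pp). pose proof (CW n q Pq). pose proof (Ha n p q).
      replace (W p - W q) with (- (a n p - W p) + ((a n p - a n q) + (a n q - W q))) by ring.
      pose proof (Rabs_triang (- (a n p - W p)) ((a n p - a n q) + (a n q - W q))).
      pose proof (Rabs_triang (a n p - a n q) (a n q - W q)).
      rewrite Rabs_Ropp in *. unfold c. lra. }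
    assert (Lm : is_lim_seq (fun n => c * (1 / 2) ^ n) (c * 0)).
    { apply (is_lim_seq_scal_l _ c 0), is_lim_seq_geom. rewrite Rabs_pos_eq; lra. }
    assert (L' := is_lim_seq_le _ _ _ _ H (is_lim_seq_const _) Lm). simpl in L'. lra. }
  assert (RR : forall t, Rmax 0 (Rmax 0 t) = Rmax 0 t) by (intros; apply Rmax_right, Rmax_l).
  assert (LX : lipschitz B X).
  { apply (lip_lim (fun n => fst (z n))); try assumption.
    - intros n; apply Lz.
    - intros t. unfold X. now rewrite RR. }
  assert (LY : lipschitz B Y).
  { apply (lip_lim (fun n => snd (z n))); try assumption.
    - intros n; apply Lz.
    - intros t. unfold Y. now rewrite RR. }
  assert (fixp : forall h w0 (a : nat -> R -> R) (W : R -> R), field_lipschitz L h ->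
    (forall n t, 0 <= t -> Rabs (a n t - W t) <= 2 * A * (1 / 2) ^ n * exp (4 * L * t)) ->
    (forall n, a (S n) = picard_map h w0 (fst (z n)) (snd (z n))) ->
    forall t, 0 <= t -> picard_map h w0 X Y t = W t).
  { intros h w0 a W Hh CW Ha t Ht.
    apply geometric_eq with (2 * A * exp (4 * L * t)). intros n.
    pose proof (CW (S n) t Ht) as H1.
    destruct (Lz n) as [Lx Ly].
    assert (H2 : Rabs (a (S n) t - picard_map h w0 X Y t)
      <= 2 * A * (1 / 2) ^ n * (1 / 2) * exp (4 * L * t)).
    { rewrite Ha. apply (picard_map_diff h L B); try assumption; try lra.
      - pose proof (half_pow_pos n). nra.
      - intros; now apply CX.
      - intros; now apply CY. }
    replace (picard_map h w0 X Y t - W t)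
      with (- (a (S n) t - picard_map h w0 X Y t) + (a (S n) t - W t)) by ring.
    eapply Rle_trans; [apply Rabs_triang|]. rewrite Rabs_Ropp. simpl in H1. lra. }
  assert (FX := fixp f x0 (fun n => fst (z n)) X Hf CX (fun _ => eq_refl)).
  assert (FY := fixp g y0 (fun n => snd (z n)) Y Hg CY (fun _ => eq_refl)).
  (* [X] and [Y] are constant at negative times and may have a corner at 0. Their images under the
     Picard map agree with them for t >= 0 and have a two-sided derivative at 0 too. *)
  exists (picard_map f x0 X Y), (picard_map g y0 X Y).
  assert (Z : forall h w0, picard_map h w0 X Y 0 = w0).
  { intros h w0. unfold picard_map. rewrite RInt_point. apply Rplus_0_r. }
  split; [apply Z|split; [apply Z|]]. intros t H. split.
  - rewrite (FX t H), (FY t H).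
    assert (D := picard_map_derive f L B x0 X Y t ltac:(lra) Hf LX LY).
    rewrite (Rmax_right 0 t H) in D. exact D.
  - rewrite (FX t H), (FY t H).
    assert (D := picard_map_derive g L B y0 X Y t ltac:(lra) Hg LX LY).
    rewrite (Rmax_right 0 t H) in D. exact D.
Qed.

(** * Existence, uniqueness and dependence on the damping *)

(* The derivatives are two-sided even at time 0: solutions on [0, T) are continued linearly to
   negative times. *)
Definition duffing_flow (gamma : R) (T : Rbar) (u v : R -> R) : Prop :=
  forall t, 0 <= t -> Rbar_lt t T ->
    is_derive u t (v t) /\ is_derive v t (u t ^ 3 - u t - gamma * v t).

(** Maximality is replaced by the continuation criterion, the form in which it is used afterwards: a
    solution that stays bounded is global. *)
Definition complete_flow (gamma u0 u1 : R) (T : Rbar) (u v : R -> R) : Prop :=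
  Rbar_lt 0 T /\ u 0 = u0 /\ v 0 = u1 /\ duffing_flow gamma T u v /\
  forall M, (forall t, 0 <= t -> Rbar_lt t T -> Rabs (u t) <= M /\ Rabs (v t) <= M) ->
    T = p_infty.

Lemma Rbar_lt_le_trans_R (s t : R) (T : Rbar) : s <= t -> Rbar_lt t T -> Rbar_lt s T.
Proof. intros H1 H2. now apply (Rbar_le_lt_trans s t T). Qed.

Lemma Rbar_lt_open (t : R) (T : Rbar) :
  Rbar_lt t T -> exists r, 0 < r /\ forall s, s < t + r -> Rbar_lt s T.
Proof.
  destruct T as [T| |]; simpl; intros H.
  - exists (T - t). split; [lra|]. intros; simpl; lra.
  - exists 1. split; [lra|]. now intros.
  - contradiction.
Qed.

Lemma duffing_flow_continuous (gamma : R) (T : Rbar) (u v : R -> R) (s : R) :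
  duffing_flow gamma T u v -> Rbar_lt s T ->
  forall t, 0 <= t <= s -> continuous u t /\ continuous v t.
Proof.
  intros F Hs t Ht. destruct (F t) as [Du Dv]; try lra.
  - now apply Rbar_lt_le_trans_R with s.
  - split; eapply is_derive_continuous; eassumption.
Qed.

Lemma duffing_flow_bounded (gamma : R) (T : Rbar) (u v : R -> R) (s : R) :
  duffing_flow gamma T u v -> 0 <= s -> Rbar_lt s T ->
  exists M, 0 < M /\ forall t, 0 <= t <= s -> Rabs (u t) <= M /\ Rabs (v t) <= M.
Proof.
  intros F H0 Hs. pose proof (duffing_flow_continuous _ _ _ _ s F Hs) as C.
  destruct (continuous_bounded u 0 s H0) as [M1 [HM1 B1]]; [intros; now apply C|].
  destruct (continuous_bounded v 0 s H0) as [M2 [HM2 B2]]; [intros; now apply C|].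
  exists (M1 + M2). split; [lra|]. intros t Ht. specialize (B1 t Ht). specialize (B2 t Ht). lra.
Qed.

Lemma duffing_flow_restrict (gamma : R) (T T' : Rbar) (u v : R -> R) :
  Rbar_le T' T -> duffing_flow gamma T u v -> duffing_flow gamma T' u v.
Proof. intros H F t H0 Ht. apply F; [exact H0|]. now apply Rbar_lt_le_trans with T'. Qed.

(** Gronwall's inequality for the squared distance N, in the form N' <= K (N + c), where the source
    c = (g - g')^2 M^2 comes from the difference of dampings. Equal dampings give uniqueness, nearby
    ones continuous dependence. *)
Lemma duffing_flow_distance (g g' s M : R) (T T' : Rbar) (u v u' v' : R -> R) :
  duffing_flow g T u v -> duffing_flow g' T' u' v' ->
  0 <= s -> Rbar_lt s T -> Rbar_lt s T' -> u 0 = u' 0 -> v 0 = v' 0 ->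
  (forall t, 0 <= t <= s -> Rabs (u t) <= M /\ Rabs (v t) <= M) ->
  (forall t, 0 <= t <= s -> Rabs (u' t) <= M /\ Rabs (v' t) <= M) ->
  (u s - u' s) ^ 2 + (v s - v' s) ^ 2
    <= (g - g') ^ 2 * M ^ 2 * exp ((3 * M ^ 2 + 2 * Rabs g + 1) * s).
Proof.
  intros F F' H0 Hs Hs' Eu Ev B B'.
  set (K := 3 * M ^ 2 + 2 * Rabs g + 1). set (c := (g - g') ^ 2 * M ^ 2).
  set (N := fun t => (u t - u' t) ^ 2 + (v t - v' t) ^ 2).
  set (dN := fun t => 2 * (u t - u' t) * (v t - v' t) + 2 * (v t - v' t)
    * ((u t ^ 3 - u t - g * v t) - (u' t ^ 3 - u' t - g' * v' t))).
  assert (DN : forall t, 0 <= t <= s -> is_derive N t (dN t)).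
  { intros t Ht.
    destruct (F t) as [Du Dv]; [lra|now apply Rbar_lt_le_trans_R with s|].
    destruct (F' t) as [Du' Dv']; [lra|now apply Rbar_lt_le_trans_R with s|].
    unfold N, dN. derive_atoms. ring. }
  assert (HN : forall t, 0 <= t <= s -> dN t <= K * (N t + c)).
  { intros t Ht. destruct (B t Ht) as [B1 B2]. destruct (B' t Ht) as [B1' B2'].
    apply Rabs_le_between in B1. apply Rabs_le_between in B2.
    apply Rabs_le_between in B1'. apply Rabs_le_between in B2'.
    unfold dN, N, K, c.
    set (x := u t - u' t). set (y := v t - v' t).
    (* [q] is the quotient of u^3 - u'^3 by u - u'. The term 2 x y from the position cancels against
       the linear force, and the damping difference splits as g y + (g - g') v'. *)
    set (q := u t ^ 2 + u t * u' t + u' t ^ 2).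
    replace (2 * x * y + _) with (2 * x * y * q - 2 * g * y ^ 2 - 2 * ((g - g') * v' t) * y)
      by (unfold x, y, q; ring).
    assert (Hq : 0 <= q <= 3 * M ^ 2).
    { pose proof (pow2_ge_0 (u t + u' t)). pose proof (pow2_ge_0 (u t)).
      pose proof (pow2_ge_0 (u' t)). unfold q. split; [nra|].
      assert (u t ^ 2 <= M ^ 2) by nra. assert (u' t ^ 2 <= M ^ 2) by nra.
      pose proof (pow2_ge_0 (u t - u' t)). nra. }
    assert (H1 : 2 * x * y * q <= 3 * M ^ 2 * (x ^ 2 + y ^ 2)).
    { apply Rle_trans with ((x ^ 2 + y ^ 2) * q).
      - apply Rmult_le_compat_r; [lra|]. pose proof (pow2_ge_0 (x - y)). nra.
      - rewrite (Rmult_comm (3 * M ^ 2)). apply Rmult_le_compat_l; [nra|lra]. }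
    assert (H2 : - 2 * g * y ^ 2 <= 2 * Rabs g * (x ^ 2 + y ^ 2)).
    { pose proof (Rle_abs (- g)) as Hg. rewrite Rabs_Ropp in Hg. pose proof (Rabs_pos g).
      assert (- g * y ^ 2 <= Rabs g * y ^ 2) by (apply Rmult_le_compat_r; [nra|exact Hg]).
      assert (0 <= Rabs g * x ^ 2) by (apply Rmult_le_pos; [lra|nra]). lra. }
    assert (H3 : - 2 * ((g - g') * v' t) * y <= (g - g') ^ 2 * M ^ 2 + y ^ 2).
    { assert ((g - g') ^ 2 * v' t ^ 2 <= (g - g') ^ 2 * M ^ 2).
      { apply Rmult_le_compat_l; [apply pow2_ge_0|nra]. }
      pose proof (pow2_ge_0 ((g - g') * v' t + y)). nra. }
    assert (0 <= (3 * M ^ 2 + 2 * Rabs g) * ((g - g') ^ 2 * M ^ 2)).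
    { pose proof (Rabs_pos g). pose proof (pow2_ge_0 M). pose proof (pow2_ge_0 (g - g')).
      apply Rmult_le_pos; [lra|]. now apply Rmult_le_pos. }
    pose proof (pow2_ge_0 x). lra. }
  assert (H : - ((N 0 + c) * exp (- K * 0)) <= - ((N s + c) * exp (- K * s))).
  { assert (D : forall t, 0 <= t <= s -> is_derive (fun t => - ((N t + c) * exp (- K * t))) t
      ((K * (N t + c) - dN t) * exp (- K * t))).
    { intros t Ht. pose proof (DN t Ht) as Dt. derive_atoms. ring. }
    apply (derive_nonneg_le (fun t => - ((N t + c) * exp (- K * t)))
      (fun t => (K * (N t + c) - dN t) * exp (- K * t)) 0 s H0).
    - intros t Ht. apply D. lra.
    - intros t Ht. eapply is_derive_continuous, D, Ht.
    - intros t Ht. specialize (HN t ltac:(lra)). pose proof (exp_pos (- K * t)).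
      apply Rmult_le_pos; lra. }
  assert (N0 : N 0 = 0) by (unfold N; rewrite Eu, Ev; ring).
  rewrite N0, Rmult_0_r, exp_0 in H.
  assert (E : exp (- K * s) * exp (K * s) = 1).
  { rewrite <- exp_plus. replace (- K * s + K * s) with 0 by ring. apply exp_0. }
  pose proof (exp_pos (K * s)).
  assert (Hc : (N s + c) * (exp (- K * s) * exp (K * s)) <= c * exp (K * s)) by nra.
  rewrite E in Hc. change (N s <= c * exp (K * s)).
  assert (0 <= c) by (unfold c; apply Rmult_le_pos; apply pow2_ge_0). lra.
Qed.

Lemma duffing_flow_unique (g s : R) (T T' : Rbar) (u v u' v' : R -> R) :
  duffing_flow g T u v -> duffing_flow g T' u' v' ->
  0 <= s -> Rbar_lt s T -> Rbar_lt s T' -> u 0 = u' 0 -> v 0 = v' 0 ->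
  u s = u' s /\ v s = v' s.
Proof.
  intros F F' H0 Hs Hs' Eu Ev.
  destruct (duffing_flow_bounded _ _ _ _ s F H0 Hs) as [M1 [P1 B1]].
  destruct (duffing_flow_bounded _ _ _ _ s F' H0 Hs') as [M2 [P2 B2]].
  assert (H := duffing_flow_distance g g s (M1 + M2) T T' u v u' v' F F' H0 Hs Hs' Eu Ev).
  rewrite Rminus_diag, pow_ne_zero, !Rmult_0_l in H by discriminate.
  cut ((u s - u' s) ^ 2 + (v s - v' s) ^ 2 <= 0).
  { intros H'. pose proof (pow2_ge_0 (u s - u' s)). pose proof (pow2_ge_0 (v s - v' s)).
    split; apply Rminus_diag_uniq, Rsqr_0_uniq; rewrite Rsqr_pow2; lra. }
  apply H; intros t Ht; [specialize (B1 t Ht)|specialize (B2 t Ht)]; lra.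
Qed.

(** * Truncation of the field and continuation of bounded solutions *)

Definition clamp (m x : R) : R := Rmax (- m) (Rmin m x).

Lemma clamp_bound (m x : R) : 0 < m -> - m <= clamp m x <= m.
Proof. intros. unfold clamp, Rmax, Rmin. repeat destruct Rle_dec; lra. Qed.

Lemma clamp_lipschitz (m x y : R) : Rabs (clamp m x - clamp m y) <= Rabs (x - y).
Proof.
  unfold clamp, Rmax, Rmin, Rabs. repeat destruct Rle_dec; repeat destruct Rcase_abs; lra.
Qed.

Lemma clamp_id (m x : R) : - m <= x <= m -> clamp m x = x.
Proof. intros. unfold clamp, Rmax, Rmin. repeat destruct Rle_dec; lra. Qed.

(** Clamping both arguments to [-m, m] makes the cubic field bounded and globally Lipschitz, as
    [picard_lindelof] requires, and leaves it unchanged on the disc of radius [m]. *)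
Lemma truncated_flow (g m u0 u1 : R) :
  0 < m -> exists x y : R -> R, x 0 = u0 /\ y 0 = u1 /\
    (forall t, 0 <= t -> continuous x t /\ continuous y t) /\
    (forall t, 0 <= t -> x t ^ 2 + y t ^ 2 <= m ^ 2 ->
       is_derive x t (y t) /\ is_derive y t (x t ^ 3 - x t - g * y t)).
Proof.
  intros Hm.
  pose proof (Rabs_pos g) as Hg.
  destruct (picard_lindelof (fun _ y => clamp m y)
    (fun x y => clamp m x ^ 3 - clamp m x - g * clamp m y)
    (3 * m ^ 2 + 1 + Rabs g) (m ^ 3 + 2 * m + Rabs g * m) u0 u1) as [x [y [Hx [Hy D]]]].
  - nra.
  - intros a b a' b'. pose proof (clamp_lipschitz m b b').
    pose proof (Rabs_pos (a - a')). pose proof (Rabs_pos (b - b')).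
    assert (0 <= 3 * m ^ 2) by nra. nra.
  - intros a b a' b'.
    pose proof (clamp_lipschitz m b b') as Lb. pose proof (clamp_lipschitz m a a') as La.
    pose proof (clamp_bound m a Hm) as Ba. pose proof (clamp_bound m a' Hm) as Ba'.
    set (p := clamp m a) in *. set (p' := clamp m a') in *.
    set (q := clamp m b) in *. set (q' := clamp m b') in *.
    replace (p ^ 3 - p - g * q - (p' ^ 3 - p' - g * q'))
      with ((p - p') * (p ^ 2 + p * p' + p' ^ 2 - 1) + - (g * (q - q'))) by ring.
    eapply Rle_trans; [apply Rabs_triang|]. rewrite Rabs_Ropp, !Rabs_mult.
    assert (Hc : Rabs (p ^ 2 + p * p' + p' ^ 2 - 1) <= 3 * m ^ 2 + 1).
    { assert (p ^ 2 <= m ^ 2) by nra. assert (p' ^ 2 <= m ^ 2) by nra.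
      apply Rabs_le. split; nra. }
    pose proof (Rabs_pos (p - p')). pose proof (Rabs_pos (q - q')).
    pose proof (Rabs_pos (a - a')). pose proof (Rabs_pos (b - b')).
    pose proof (Rabs_pos (p ^ 2 + p * p' + p' ^ 2 - 1)).
    assert (Rabs (p - p') * Rabs (p ^ 2 + p * p' + p' ^ 2 - 1)
      <= Rabs (a - a') * (3 * m ^ 2 + 1)) by (apply Rmult_le_compat; lra).
    assert (Rabs g * Rabs (q - q') <= Rabs g * Rabs (b - b'))
      by (apply Rmult_le_compat_l; lra).
    assert (0 <= Rabs g * Rabs (a - a')) by (apply Rmult_le_pos; lra).
    assert (0 <= (3 * m ^ 2 + 1) * Rabs (b - b')) by (apply Rmult_le_pos; nra). lra.
  - intros _ b. pose proof (clamp_bound m b Hm).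
    assert (0 <= Rabs g * m) by (apply Rmult_le_pos; lra). assert (0 < m ^ 3) by (apply pow_lt, Hm).
    apply Rabs_le. lra.
  - intros a b. pose proof (clamp_bound m a Hm) as Ba. pose proof (clamp_bound m b Hm) as Bb.
    set (p := clamp m a) in *. set (q := clamp m b) in *.
    replace (p ^ 3 - p - g * q) with (p ^ 3 + - (p + g * q)) by ring.
    assert (Hp : Rabs p <= m) by (apply Rabs_le; lra).
    assert (Hq : Rabs q <= m) by (apply Rabs_le; lra).
    eapply Rle_trans; [apply Rabs_triang|]. rewrite Rabs_Ropp, <- RPow_abs.
    pose proof (Rabs_triang p (g * q)) as Ht. rewrite Rabs_mult in Ht.
    assert (Rabs p ^ 3 <= m ^ 3) by (apply pow_incr; split; [apply Rabs_pos|exact Hp]).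
    assert (Rabs g * Rabs q <= Rabs g * m) by (apply Rmult_le_compat_l; lra). lra.
  - exists x, y. split; [exact Hx|split; [exact Hy|split]].
    + intros t Ht. destruct (D t Ht) as [D1 D2].
      split; eapply is_derive_continuous; eassumption.
    + intros t Ht Hb. destruct (D t Ht) as [D1 D2].
      rewrite !clamp_id in D2 by nra. rewrite clamp_id in D1 by nra. now split.
Qed.

Lemma truncated_flow_interval (g m tau : R) (x y : R -> R) :
  0 <= tau ->
  (forall t, 0 <= t -> continuous x t /\ continuous y t) ->
  (forall t, 0 <= t -> x t ^ 2 + y t ^ 2 <= m ^ 2 ->
     is_derive x t (y t) /\ is_derive y t (x t ^ 3 - x t - g * y t)) ->
  (forall t, 0 <= t <= tau -> x t ^ 2 + y t ^ 2 < m ^ 2) ->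
  exists tau' : R, tau < tau' /\ duffing_flow g tau' x y.
Proof.
  intros Ht C D H.
  assert (CN : continuous (fun t => x t ^ 2 + y t ^ 2) tau).
  { destruct (C tau Ht) as [C1 C2].
    apply (continuous_plus (fun t => x t ^ 2) (fun t => y t ^ 2)).
    - apply (continuous_comp x (fun z => z ^ 2)); [exact C1|].
      eapply is_derive_continuous. auto_derive; [exact I|reflexivity].
    - apply (continuous_comp y (fun z => z ^ 2)); [exact C2|].
      eapply is_derive_continuous. auto_derive; [exact I|reflexivity]. }
  pose proof (H tau ltac:(lra)) as H1.
  destruct (continuous_eps _ _ (m ^ 2 - (x tau ^ 2 + y tau ^ 2)) CN) as [d [Hd Hd']]; [lra|].
  exists (tau + d). split; [lra|]. intros t H0 Hlt. simpl in Hlt. apply D; [exact H0|].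
  destruct (Rle_dec t tau) as [L|L]; [apply Rlt_le, H; lra|].
  specialize (Hd' t ltac:(apply Rabs_def1; lra)). apply Rabs_def2 in Hd'. lra.
Qed.

Lemma duffing_flow_local (g u0 u1 : R) :
  exists (tau : R) (u v : R -> R), 0 < tau /\ duffing_flow g tau u v /\ u 0 = u0 /\ v 0 = u1.
Proof.
  assert (Hm : 0 < Rabs u0 + Rabs u1 + 1) by (pose proof (Rabs_pos u0); pose proof (Rabs_pos u1); lra).
  destruct (truncated_flow g _ u0 u1 Hm) as [x [y [Hx [Hy [C D]]]]].
  destruct (truncated_flow_interval g (Rabs u0 + Rabs u1 + 1) 0 x y) as [tau [Ht F]];
    try assumption; [lra| |now exists tau, x, y].
  intros t Ht. replace t with 0 by lra. rewrite Hx, Hy, <- (pow2_abs u0), <- (pow2_abs u1).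
  pose proof (Rabs_pos u0). pose proof (Rabs_pos u1). nra.
Qed.

(** The flow truncated at a radius m with m^2 > 2 M^2 cannot leave its disc up to [tau]: until a
    first exit it coincides with the given solution, whose squared norm is at most 2 M^2. It
    therefore solves the equation a little beyond [tau]. *)
Lemma duffing_flow_extend (g tau M : R) (u v : R -> R) :
  0 < tau -> duffing_flow g tau u v ->
  (forall t, 0 <= t < tau -> Rabs (u t) <= M /\ Rabs (v t) <= M) ->
  exists (tau' : R) (x y : R -> R),
    tau < tau' /\ duffing_flow g tau' x y /\ x 0 = u 0 /\ y 0 = v 0.
Proof.
  intros Ht F B.
  assert (HM : 0 <= M).
  { destruct (B 0 ltac:(lra)) as [B0 _]. pose proof (Rabs_pos (u 0)). lra. }
  assert (Bsq : forall t, 0 <= t < tau -> u t ^ 2 + v t ^ 2 <= 2 * M ^ 2).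
  { intros t Ht'. destruct (B t Ht') as [B1 B2].
    rewrite <- (pow2_abs (u t)), <- (pow2_abs (v t)).
    pose proof (Rabs_pos (u t)). pose proof (Rabs_pos (v t)). nra. }
  set (m := 2 * M + 1).
  assert (Hm : 0 < m) by (unfold m; lra).
  destruct (truncated_flow g m (u 0) (v 0) Hm) as [x [y [Hx [Hy [C D]]]]].
  assert (CN : forall t, 0 <= t -> continuous (fun t => x t ^ 2 + y t ^ 2) t).
  { intros t Ht'. destruct (C t Ht') as [C1 C2].
    apply (continuous_plus (fun t => x t ^ 2) (fun t => y t ^ 2)).
    - apply (continuous_comp x (fun z => z ^ 2)); [exact C1|].
      eapply is_derive_continuous. auto_derive; [exact I|reflexivity].
    - apply (continuous_comp y (fun z => z ^ 2)); [exact C2|].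
      eapply is_derive_continuous. auto_derive; [exact I|reflexivity]. }
  destruct (truncated_flow_interval g m tau x y) as [tau' [Ht' F']];
    try assumption; [lra| |now exists tau', x, y].
  intros s Hs. destruct (Rlt_dec (x s ^ 2 + y s ^ 2) (m ^ 2)) as [L|L]; [exact L|exfalso].
  assert (M2 : 2 * M ^ 2 < m ^ 2) by (unfold m; nra).
  destruct (first_exit (fun t => x t ^ 2 + y t ^ 2) 0 s (m ^ 2)) as [t1 [Ht1 [E1 H1]]]; try lra.
  { intros t Ht'. apply CN. lra. }
  { rewrite Hx, Hy. specialize (Bsq 0 ltac:(lra)). lra. }
  simpl in E1.
  assert (F1 : duffing_flow g t1 x y).
  { intros t H0 Hlt. simpl in Hlt. apply D; [exact H0|].
    apply Rlt_le, H1. lra. }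
  destruct (continuous_eps _ t1 (m ^ 2 - 2 * M ^ 2) (CN t1 ltac:(lra))) as [d [Hd Hd']]; [lra|].
  (* Uniqueness is available only before [t1], which may equal [tau]; slightly earlier the squared
     norm is still above 2 M^2 by continuity. *)
  set (t := Rmax 0 (t1 - d / 2)).
  assert (T0 : 0 <= t) by apply Rmax_l.
  assert (T1 : t1 - d / 2 <= t) by apply Rmax_r.
  assert (T2 : t < t1) by (apply Rmax_lub_lt; lra).
  destruct (duffing_flow_unique g t tau t1 u v x y) as [Eu Ev]; try assumption; simpl; try lra;
    try (symmetry; assumption).
  specialize (Hd' t ltac:(apply Rabs_def1; lra)). apply Rabs_def2 in Hd'.
  specialize (Bsq t ltac:(lra)). rewrite Eu, Ev in Bsq. lra.
Qed.

(** * Passage between relative and two-sided derivatives; maximal solutions *)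

Lemma derive_D_in (f d : R -> R) (D : R -> Prop) (t : R) :
  is_derive f t (d t) -> D_in f d D t.
Proof.
  intros H. apply is_derive_Reals, derivable_pt_lim_D_in in H.
  intros eps Heps. destruct (H eps Heps) as [a [Ha Hb]]. exists a. split; [exact Ha|].
  intros x [[_ Hx] Hd]. apply Hb. split; [split; [exact I|exact Hx]|exact Hd].
Qed.

Lemma duffing_flow_solution (g : R) (T : Rbar) (u v : R -> R) :
  Rbar_lt 0 T -> duffing_flow g T u v -> duffing_solution g (u 0) (v 0) T u v.
Proof.
  intros HT F. split; [exact HT|]. split; [reflexivity|]. split; [reflexivity|].
  intros t [H0 Ht]. destruct (F t H0 Ht) as [Du Dv]. split; [now apply derive_D_in|].
  exists (fun t => u t ^ 3 - u t - g * v t). split; [now apply derive_D_in|ring].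
Qed.

Definition linear_extension (w : R -> R) (c t : R) : R :=
  if Rle_dec 0 t then w t else w 0 + c * t.

Lemma linear_extension_nonneg (w : R -> R) (c t : R) : 0 <= t -> linear_extension w c t = w t.
Proof. intros. unfold linear_extension. destruct Rle_dec; [reflexivity|contradiction]. Qed.

Lemma linear_extension_derive (w d : R -> R) (c t : R) (T : Rbar) :
  forward_interval T t -> D_in w d (forward_interval T) t -> (t = 0 -> c = d t) ->
  is_derive (linear_extension w c) t (d t).
Proof.
  intros [H0 HT] HD Hc. apply is_derive_Reals.
  destruct (Rbar_lt_open t T HT) as [r [Hr HrT]].
  intros eps Heps. destruct (HD eps Heps) as [a [Ha Hb]].
  (* For t > 0 increments below t keep t + h positive. At t = 0 negative increments fall on the
     linear branch, whose slope [c] is the derivative. *)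
  assert (Hp : 0 < Rmin (Rmin a r) (if Req_EM_T t 0 then 1 else t)).
  { repeat apply Rmin_glb_lt; try lra. destruct Req_EM_T; lra. }
  exists (mkposreal _ Hp). intros h Hh Hlt. simpl in Hlt.
  assert (L1 : Rabs h < a) by (eapply Rlt_le_trans; [exact Hlt|eapply Rle_trans; [apply Rmin_l|apply Rmin_l]]).
  assert (L2 : Rabs h < r) by (eapply Rlt_le_trans; [exact Hlt|eapply Rle_trans; [apply Rmin_l|apply Rmin_r]]).
  assert (L3 : Rabs h < if Req_EM_T t 0 then 1 else t) by (eapply Rlt_le_trans; [exact Hlt|apply Rmin_r]).
  rewrite (linear_extension_nonneg w c t H0).
  destruct (Rle_dec 0 (t + h)) as [P|P].
  - rewrite linear_extension_nonneg by exact P.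
    specialize (Hb (t + h)). simpl in Hb. unfold Rdist in Hb.
    replace (t + h - t) with h in Hb by ring. apply Hb.
    split; [|exact L1]. split; [|lra].
    split; [exact P|]. apply HrT. apply Rabs_def2 in L2. lra.
  - destruct (Req_EM_T t 0) as [E|E].
    + unfold linear_extension. destruct Rle_dec; [contradiction|].
      rewrite <- (Hc E), E. replace ((w 0 + c * (0 + h) - w 0) / h - c) with 0 by (field; exact Hh).
      rewrite Rabs_R0. exact Heps.
    + apply Rabs_def2 in L3. lra.
Qed.

Lemma duffing_solution_flow (g u0 u1 : R) (T : Rbar) (u v : R -> R) :
  duffing_solution g u0 u1 T u v ->
  exists u' v', duffing_flow g T u' v' /\ forall t, 0 <= t -> u' t = u t /\ v' t = v t.
Proof.
  intros [HT [E0 [E1 HS]]].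
  exists (linear_extension u u1), (linear_extension v (u0 ^ 3 - u0 - g * u1)).
  assert (E : forall t, 0 <= t -> linear_extension u u1 t = u t /\
    linear_extension v (u0 ^ 3 - u0 - g * u1) t = v t).
  { intros t Ht. split; now apply linear_extension_nonneg. }
  split; [|exact E]. intros t H0 Ht. destruct (E t H0) as [-> ->].
  destruct (HS t (conj H0 Ht)) as [Du [a [Dv Ha]]]. split.
  - apply (linear_extension_derive u v u1 t T); [now split|exact Du|].
    intros ->. now symmetry.
  - replace (u t ^ 3 - u t - g * v t) with (a t) by lra.
    apply (linear_extension_derive v a _ t T); [now split|exact Dv|].
    intros ->. rewrite <- E0, <- E1. lra.
Qed.

(** A bounded solution with finite [T] could be prolonged by [duffing_flow_extend], and by
    uniqueness the prolongation agrees with it, against maximality. *)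
Lemma maximal_complete_flow (g u0 u1 : R) (T : Rbar) (u v : R -> R) :
  maximal_duffing_solution g u0 u1 T u v ->
  exists u' v', complete_flow g u0 u1 T u' v' /\ forall t, 0 <= t -> u' t = u t /\ v' t = v t.
Proof.
  intros [HS HM]. destruct (duffing_solution_flow _ _ _ _ _ _ HS) as [u' [v' [F E]]].
  exists u', v'. split; [|exact E].
  destruct HS as [HT [E0 [E1 _]]].
  destruct (E 0 (Rle_refl 0)) as [E0' E1'].
  split; [exact HT|]. split; [now rewrite E0'|]. split; [now rewrite E1'|].
  split; [exact F|]. intros M B.
  destruct T as [tau| |]; [exfalso|reflexivity|contradiction HT].
  simpl in HT.
  destruct (duffing_flow_extend g tau M u' v' HT F) as [tau' [x [y [Ht [F' [Hx Hy]]]]]].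
  { intros t Ht. apply B; [lra|simpl; lra]. }
  assert (H : Rbar_le tau' tau).
  { apply (HM tau' x y).
    - rewrite <- E0, <- E1, <- E0', <- E1', <- Hx, <- Hy.
      apply duffing_flow_solution; [simpl; lra|exact F'].
    - intros t [H0 Hlt]. simpl in Hlt. split; [split; [exact H0|simpl; lra]|].
      destruct (duffing_flow_unique g t tau tau' u' v' x y) as [Eu _];
        try assumption; simpl; try lra; try (symmetry; assumption).
      rewrite <- Eu. now apply E. }
  simpl in H. lra.
Qed.

(** Uniqueness lets solutions be glued: [T] is the supremum of the times that some solution goes
    beyond, and the value at time t is read off a solution chosen by [epsilon] that lives beyond
    t. *)
Lemma maximal_solution_exists (g u0 u1 : R) :
  exists T u v, maximal_duffing_solution g u0 u1 T u v.
Proof.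
  set (sol := fun (t : R) (w : (R -> R) * (R -> R)) => exists tau : R,
    t < tau /\ duffing_flow g tau (fst w) (snd w) /\ fst w 0 = u0 /\ snd w 0 = u1).
  set (S := fun t : R => 0 <= t /\ exists w, sol t w).
  set (W := fun t => epsilon (inhabits (fun _ : R => 0, fun _ : R => 0)) (sol t)).
  set (U := fun t => fst (W t) t). set (V := fun t => snd (W t) t).
  assert (UV : forall t w, 0 <= t -> sol t w -> U t = fst w t /\ V t = snd w t).
  { intros t w H0 Hw. assert (HW : sol t (W t)) by (apply epsilon_spec; now exists w).
    destruct Hw as [tau [Ht [F [I0 I1]]]]. destruct HW as [tau' [Ht' [F' [I0' I1']]]].
    apply (duffing_flow_unique g t tau' tau (fst (W t)) (snd (W t))); try assumption;
      [now rewrite I0, I0'|now rewrite I1, I1']. }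
  assert (S0 : S 0).
  { split; [lra|]. destruct (duffing_flow_local g u0 u1) as [tau [u [v H]]].
    now exists (u, v), tau. }
  assert (Sdown : forall s t, 0 <= s <= t -> S t -> S s).
  { intros s t Hst [_ [w [tau [Ht Hw]]]]. split; [lra|]. exists w, tau. split; [lra|exact Hw]. }
  set (T := Lub_Rbar S). destruct (Lub_Rbar_correct S) as [Hub Hlub]. fold T in Hub, Hlub.
  assert (Sopen : forall t, S t -> Rbar_lt t T).
  { intros t [H0 [w [tau [Ht Hw]]]]. apply Rbar_lt_le_trans with ((t + tau) / 2); [simpl; lra|].
    apply Hub. split; [lra|]. exists w, tau. split; [lra|exact Hw]. }
  assert (SI : forall t, forward_interval T t -> S t).
  { intros t [H0 Ht]. destruct (classic (S t)) as [|Hn]; [assumption|exfalso].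
    apply (Rbar_lt_not_le _ _ Ht). apply Hlub. intros s Hs. simpl.
    destruct (Rle_dec s t); [assumption|]. contradiction Hn. apply (Sdown t s); [lra|exact Hs]. }
  exists T, U, V. split.
  - split; [now apply Sopen|].
    assert (H0 : sol 0 (W 0)) by (apply epsilon_spec; apply S0).
    destruct H0 as [tau0 [_ [_ [I0 I1]]]].
    split; [exact I0|]. split; [exact I1|].
    intros t Ht. destruct (SI t Ht) as [H0 [w Hw]].
    assert (Hw' := Hw). destruct Hw' as [tau [Htau [F [J0 J1]]]].
    assert (local : forall s, 0 <= s < tau -> U s = fst w s /\ V s = snd w s).
    { intros s Hs. apply UV; [lra|]. exists tau. split; [lra|now split]. }
    destruct (F t H0 Htau) as [Du Dv].
    (* The chosen solution changes with the time, but near [t] all of them coincide with the single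
       solution [w], whose derivatives are transferred. *)
    assert (tr : forall h k dh dk, (forall s, 0 <= s < tau -> h s = k s) -> dh t = dk t ->
      is_derive k t (dk t) -> D_in h dh (forward_interval T) t).
    { intros h k dh dk Hhk Hd Dk.
      pose proof (derive_D_in k dk (forward_interval T) t Dk) as Dk'.
      intros eps Heps. destruct (Dk' eps Heps) as [a [Ha Hb]].
      exists (Rmin a (tau - t)). split; [apply Rmin_glb_lt; lra|].
      intros s [[Hs1 Hs2] Hs3]. simpl in Hs3. unfold Rdist in Hs3.
      assert (Rabs (s - t) < a) by (eapply Rlt_le_trans; [exact Hs3|apply Rmin_l]).
      assert (Hst : Rabs (s - t) < tau - t) by (eapply Rlt_le_trans; [exact Hs3|apply Rmin_r]).
      apply Rabs_def2 in Hst. destruct Hs1 as [Hs1 Hs1'].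
      rewrite (Hhk s), (Hhk t), Hd by lra.
      apply Hb. split; [split; [now split|exact Hs2]|]. assumption. }
    destruct (local t ltac:(lra)) as [Et Et'].
    split.
    + apply (tr U (fst w) V (snd w)); [intros; now apply local|exact Et'|exact Du].
    + exists (fun s => U s ^ 3 - U s - g * V s). split; [|ring].
      apply (tr V (snd w) _ (fun s => fst w s ^ 3 - fst w s - g * snd w s));
        [intros; now apply local|now rewrite Et, Et'|exact Dv].
  (* A solution on a longer interval would put the number [T] itself into [S], whose elements are
     all strictly below [T]. *)
  - intros T' u' v' HS _. destruct (Rbar_lt_le_dec T T') as [L|L]; [exfalso|exact L].
    assert (HT0 : Rbar_lt 0 T) by now apply Sopen.
    assert (exists t : R, T = t /\ Rbar_lt t T') as [t [Et Ht]].
    { destruct T as [t| |]; [now exists t|destruct T'; contradiction|contradiction]. }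
    rewrite Et in HT0. simpl in HT0.
    destruct (duffing_solution_flow _ _ _ _ _ _ HS) as [x [y [F E]]].
    destruct HS as [_ [E0 [E1 _]]].
    assert (St : S t).
    { split; [lra|]. destruct (Rbar_lt_open t T' Ht) as [r [Hr HrT]].
      exists (x, y), (t + r / 2). split; [lra|]. split.
      - apply duffing_flow_restrict with T'; [|exact F].
        apply Rbar_lt_le, HrT. lra.
      - simpl. destruct (E 0 (Rle_refl 0)) as [-> ->]. now split. }
    apply Sopen in St. rewrite Et in St. simpl in St. lra.
Qed.

Lemma complete_flow_exists (g u0 u1 : R) : exists T u v, complete_flow g u0 u1 T u v.
Proof.
  destruct (maximal_solution_exists g u0 u1) as [T [u [v H]]].
  destruct (maximal_complete_flow _ _ _ _ _ _ H) as [u' [v' [H' _]]]. now exists T, u', v'.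
Qed.

(** The distance estimate needs a bound on the perturbed solution, which is obtained by bootstrap:
    until the distance first reaches [e] <= 1 the bound M + 1 holds, and the estimate then keeps the
    distance below [e]. The same bound rules out T' <= s by the continuation criterion. *)
Lemma complete_flow_near (g u0 u1 : R) (T : Rbar) (u v : R -> R) (s eps : R) :
  complete_flow g u0 u1 T u v -> 0 <= s -> Rbar_lt s T -> 0 < eps ->
  exists d, 0 < d /\ forall g' T' u' v', Rabs (g' - g) < d -> complete_flow g' u0 u1 T' u' v' ->
    Rbar_lt s T' /\ forall t, 0 <= t <= s -> Rabs (u' t - u t) < eps /\ Rabs (v' t - v t) < eps.
Proof.
  intros [HT [I0 [I1 [F _]]]] H0 Hs Heps.
  destruct (duffing_flow_bounded _ _ _ _ s F H0 Hs) as [M [HM B]].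
  set (M1 := M + 1). set (K := 3 * M1 ^ 2 + 2 * Rabs g + 1).
  set (e := Rmin eps 1). assert (He : 0 < e) by (apply Rmin_glb_lt; lra).
  assert (Hee : e <= eps) by apply Rmin_l. assert (He1 : e <= 1) by apply Rmin_r.
  (* Since exp(K s) >= 1, the Gronwall bound is at most ((g - g') c)^2, which is below e^2 once |g -
     g'| < e / c. *)
  set (c := M1 * exp (K * s)).
  assert (HK : 1 <= K).
  { unfold K, M1. pose proof (Rabs_pos g). assert (0 <= (M + 1) ^ 2) by nra. lra. }
  assert (HE : 1 <= exp (K * s)).
  { pose proof (exp_ineq1_le (K * s)). assert (0 <= K * s) by nra. lra. }
  assert (Hc : 0 < c) by (unfold c, M1; nra).
  exists (e / c). split; [now apply Rdiv_lt_0_compat|].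
  intros g' T' u' v' Hg [HT' [I0' [I1' [F' Ext]]]].
  assert (Hgc : (g - g') ^ 2 * M1 ^ 2 * exp (K * s) < e ^ 2).
  { rewrite Rabs_minus_sym in Hg.
    apply (Rmult_lt_compat_r c) in Hg; [|exact Hc].
    replace (e / c * c) with e in Hg by (field; lra).
    rewrite <- (pow2_abs (g - g')). pose proof (Rabs_pos (g - g')) as P.
    apply Rle_lt_trans with ((Rabs (g - g') * c) ^ 2).
    - unfold c. rewrite Rpow_mult_distr, Rpow_mult_distr, Rmult_assoc.
      apply Rmult_le_compat_l; [apply pow2_ge_0|].
      apply Rmult_le_compat_l; [apply pow2_ge_0|]. nra.
    - assert (0 <= Rabs (g - g') * c) by (apply Rmult_le_pos; lra). nra. }
  set (N := fun t => (u t - u' t) ^ 2 + (v t - v' t) ^ 2).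
  assert (CN : forall r : R, Rbar_lt r T' -> r <= s -> forall t, 0 <= t <= r -> continuous N t).
  { intros r Hr Hrs t Ht.
    destruct (F t) as [Du Dv]; [lra|apply Rbar_lt_le_trans_R with s; [lra|exact Hs]|].
    destruct (F' t) as [Du' Dv']; [lra|apply Rbar_lt_le_trans_R with r; [lra|exact Hr]|].
    unfold N. apply (ex_derive_continuous N). unfold N. auto_derive.
    repeat split; eexists; eassumption. }
  assert (Small : forall t : R, 0 <= t <= s -> Rbar_lt t T' -> N t < e ^ 2).
  { intros t Ht HtT. destruct (Rlt_dec (N t) (e ^ 2)) as [L|L]; [exact L|exfalso].
    destruct (first_exit N 0 t (e ^ 2)) as [t1 [Ht1 [E1 H1]]]; try lra.
    { apply CN; [exact HtT|lra]. }
    { unfold N. rewrite I0, I1, I0', I1', !Rminus_diag. nra. }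
    assert (Q : forall r, 0 <= r <= t1 -> Rabs (u' r) <= M1 /\ Rabs (v' r) <= M1).
    { intros r Hr. assert (Hn : N r <= e ^ 2).
      { destruct (Req_dec r t1) as [->|]; [lra|]. apply Rlt_le, H1. lra. }
      unfold N in Hn. destruct (B r ltac:(lra)) as [B1 B2]. unfold M1.
      apply Rabs_le_between in B1. apply Rabs_le_between in B2.
      assert (A1 := abs_le_sum_sq _ _ _ (Rlt_le _ _ He) Hn).
      rewrite Rplus_comm in Hn. assert (A2 := abs_le_sum_sq _ _ _ (Rlt_le _ _ He) Hn).
      apply Rabs_le_between in A1. apply Rabs_le_between in A2.
      split; apply Rabs_le; lra. }
    assert (Dist := duffing_flow_distance g g' t1 M1 T T' u v u' v' F F').
    assert (Hle : N t1 <= (g - g') ^ 2 * M1 ^ 2 * exp (K * t1)).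
    { apply Dist; try lra; try assumption.
      - apply Rbar_lt_le_trans_R with s; [lra|exact Hs].
      - apply Rbar_lt_le_trans_R with t; [lra|exact HtT].
      - intros r Hr. destruct (B r ltac:(lra)). unfold M1. lra. }
    assert (exp (K * t1) <= exp (K * s)).
    { destruct (Req_dec t1 s) as [->|]; [lra|]. apply Rlt_le, exp_increasing. nra. }
    assert (0 <= (g - g') ^ 2 * M1 ^ 2) by (apply Rmult_le_pos; apply pow2_ge_0).
    assert ((g - g') ^ 2 * M1 ^ 2 * exp (K * t1) <= (g - g') ^ 2 * M1 ^ 2 * exp (K * s))
      by (apply Rmult_le_compat_l; assumption).
    lra. }
  assert (Close : forall t : R, 0 <= t <= s -> Rbar_lt t T' ->
    Rabs (u' t - u t) < e /\ Rabs (v' t - v t) < e).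
  { intros t Ht HtT. specialize (Small t Ht HtT). unfold N in Small.
    rewrite (Rabs_minus_sym (u' t)), (Rabs_minus_sym (v' t)). split.
    - apply (abs_lt_sum_sq _ (v t - v' t)); lra.
    - apply (abs_lt_sum_sq _ (u t - u' t)); lra. }
  assert (HsT : Rbar_lt s T').
  { destruct (Rbar_lt_le_dec s T') as [L|L]; [exact L|exfalso].
    assert (E : T' = p_infty).
    { apply (Ext M1). intros t Ht0 HtT.
      assert (Ht : 0 <= t <= s).
      { split; [exact Ht0|]. assert (Hlt := Rbar_lt_le_trans _ _ _ HtT L). simpl in Hlt. lra. }
      destruct (Close t Ht HtT) as [C1 C2]. destruct (B t Ht) as [B1 B2].
      apply Rabs_def2 in C1. apply Rabs_def2 in C2.
      apply Rabs_le_between in B1. apply Rabs_le_between in B2. unfold M1.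
      split; apply Rabs_le; lra. }
    rewrite E in L. exact L. }
  split; [exact HsT|]. intros t Ht.
  destruct (Close t Ht) as [C1 C2]; [apply Rbar_lt_le_trans_R with s; [lra|exact HsT]|]. lra.
Qed.

(** * Energy, blow-up and convergence *)

Lemma energy_derive (g : R) (T : Rbar) (u v : R -> R) (t : R) :
  duffing_flow g T u v -> 0 <= t -> Rbar_lt t T ->
  is_derive (fun t => energy (u t) (v t)) t (- g * v t ^ 2).
Proof.
  intros F H0 Ht. destruct (F t H0 Ht) as [Du Dv]. unfold energy. derive_atoms. field.
Qed.

Lemma energy_continuous (g : R) (T : Rbar) (u v : R -> R) (s : R) :
  duffing_flow g T u v -> Rbar_lt s T -> forall t, 0 <= t <= s ->
  continuous (fun t => energy (u t) (v t)) t.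
Proof.
  intros F Hs t Ht. eapply is_derive_continuous, (energy_derive g T); [exact F|lra|].
  apply Rbar_lt_le_trans_R with s; [lra|exact Hs].
Qed.

Lemma energy_nonincreasing (g : R) (T : Rbar) (u v : R -> R) (s t : R) :
  duffing_flow g T u v -> 0 <= g -> 0 <= s <= t -> Rbar_lt t T ->
  energy (u t) (v t) <= energy (u s) (v s).
Proof.
  intros F Hg Hst Ht. apply Ropp_le_cancel.
  apply (derive_nonneg_le (fun t => - energy (u t) (v t)) (fun t => g * v t ^ 2)); [lra| | |].
  - intros r Hr. replace (g * v r ^ 2) with (- (- g * v r ^ 2)) by ring.
    apply (is_derive_opp (fun t => energy (u t) (v t))), (energy_derive g T); [exact F|lra|].
    apply Rbar_lt_le_trans_R with t; [lra|exact Ht].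
  - intros r Hr. apply (continuous_opp (fun t => energy (u t) (v t))).
    apply (energy_continuous g T u v t F Ht). lra.
  - intros r Hr. apply Rmult_le_pos; [exact Hg|apply pow2_ge_0].
Qed.

Lemma energy_decreasing (g : R) (T : Rbar) (u v : R -> R) (s t : R) :
  duffing_flow g T u v -> 0 < g -> 0 <= s < t -> Rbar_lt t T ->
  (forall r, s < r < t -> 0 < v r) -> energy (u t) (v t) < energy (u s) (v s).
Proof.
  intros F Hg Hst Ht Hv. apply Ropp_lt_cancel.
  apply (derive_pos_lt (fun t => - energy (u t) (v t)) (fun t => g * v t ^ 2)); [lra| | |].
  - intros r Hr. replace (g * v r ^ 2) with (- (- g * v r ^ 2)) by ring.
    apply (is_derive_opp (fun t => energy (u t) (v t))), (energy_derive g T); [exact F|lra|].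
    apply Rbar_lt_le_trans_R with t; [lra|exact Ht].
  - intros r Hr. apply (continuous_opp (fun t => energy (u t) (v t))).
    apply (energy_continuous g T u v t F Ht). lra.
  - intros r Hr. apply Rmult_lt_0_compat; [exact Hg|]. apply pow_lt, Hv, Hr.
Qed.

Lemma energy_conserved (T : Rbar) (u v : R -> R) (t : R) :
  duffing_flow 0 T u v -> 0 <= t -> Rbar_lt t T -> energy (u t) (v t) = energy (u 0) (v 0).
Proof.
  intros F H0 Ht. apply Rle_antisym.
  - apply (energy_nonincreasing 0 T); try assumption; lra.
  - apply (derive_nonneg_le (fun t => energy (u t) (v t)) (fun t => - 0 * v t ^ 2)); [lra| | |].
    + intros r Hr. apply (energy_derive 0 T); [exact F|lra|].
      apply Rbar_lt_le_trans_R with t; [lra|exact Ht].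
    + intros r Hr. apply (energy_continuous 0 T u v t F Ht). lra.
    + intros r Hr. lra.
Qed.

(** In this form 1/4 is visibly the level of the saddles, and E >= 1/4 reads y^2 >= (1 - x^2)^2 /
    2. *)
Lemma energy_square (x y : R) : energy x y = 1 / 4 - (1 - x ^ 2) ^ 2 / 4 + y ^ 2 / 2.
Proof. unfold energy. field. Qed.

Lemma energy_equilibrium (a y : R) : a ^ 2 = 1 -> energy a y = 1 / 4 + y ^ 2 / 2.
Proof. intros Ha. rewrite energy_square, Ha. field. Qed.

Lemma energy_zero_le (x : R) : energy x 0 <= 1 / 4.
Proof. rewrite energy_square. pose proof (pow2_ge_0 (1 - x ^ 2)). lra. Qed.

Lemma energy_zero_lt (x : R) : x <> 1 -> x <> -1 -> energy x 0 < 1 / 4.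
Proof.
  intros H1 H2. rewrite energy_square.
  assert (0 < (1 - x ^ 2) ^ 2); [|lra].
  rewrite <- Rsqr_pow2. apply Rsqr_pos_lt. intros H.
  assert ((1 - x) * (1 + x) = 0) as P by (rewrite <- H; ring).
  apply Rmult_integral in P. lra.
Qed.

(** The sharp constant is 1 / sqrt 2; the rational 1/2 is enough for the dissipation and for the
    decay rate at the saddles. *)
Lemma energy_ge_velocity (x y : R) :
  1 / 4 <= energy x y -> 0 <= y -> (1 - x ^ 2) / 2 <= y /\ - (1 - x ^ 2) / 2 <= y.
Proof.
  rewrite energy_square. intros H Hy. set (z := 1 - x ^ 2) in *.
  split; apply Rnot_lt_le; intros L; nra.
Qed.

Lemma energy_velocity_bound (x y e r : R) :
  energy x y <= e -> Rabs x <= r -> Rabs y <= 2 * Rabs e + r ^ 4 + 1.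
Proof.
  intros H Hx. pose proof (Rle_abs e).
  assert (Hx4 : x ^ 4 <= r ^ 4).
  { replace (x ^ 4) with (Rabs x ^ 4).
    - apply pow_incr. split; [apply Rabs_pos|exact Hx].
    - rewrite RPow_abs. apply Rabs_pos_eq.
      replace (x ^ 4) with ((x ^ 2) ^ 2) by ring. apply pow2_ge_0. }
  assert (0 <= x ^ 4) by (replace (x ^ 4) with ((x ^ 2) ^ 2) by ring; apply pow2_ge_0).
  unfold energy in H. pose proof (pow2_ge_0 x). pose proof (Rabs_pos e).
  rewrite <- (pow2_abs y) in H. pose proof (Rabs_pos y).
  assert (Rabs y ^ 2 <= 2 * Rabs e + r ^ 4) by lra. nra.
Qed.

(* Along a rightward arc [dE = - g v du], and [E >= 1/4] gives [v >= |1 - u^2| / 2]. *)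
Lemma energy_dissipation (g e : R) (T : Rbar) (u v : R -> R) (r s : R) :
  duffing_flow g T u v -> 0 <= g -> e = 1 \/ e = -1 -> 0 <= r <= s -> Rbar_lt s T ->
  (forall t, r <= t <= s -> 0 <= v t) -> 1 / 4 <= energy (u s) (v s) ->
  energy (u s) (v s) + g * e * (u s - u s ^ 3 / 3) / 2
    <= energy (u r) (v r) + g * e * (u r - u r ^ 3 / 3) / 2.
Proof.
  intros F Hg He Hrs Hs Hv HE. apply Ropp_le_cancel.
  (* (u - u^3 / 3) / 2 is a primitive of (1 - u^2) / 2, and [e] selects which of the two lower
     bounds for v is integrated. *)
  assert (D : forall t, r <= t <= s -> is_derive
    (fun t => - (energy (u t) (v t) + g * e * (u t - u t ^ 3 / 3) / 2)) t
    (g * (v t * (v t - e * (1 - u t ^ 2) / 2)))).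
  { intros t Ht. destruct (F t) as [Du Dv];
      [lra|apply Rbar_lt_le_trans_R with s; [lra|exact Hs]|].
    unfold energy. derive_atoms. field. }
  apply (derive_nonneg_le (fun t => - (energy (u t) (v t) + g * e * (u t - u t ^ 3 / 3) / 2))
    (fun t => g * (v t * (v t - e * (1 - u t ^ 2) / 2)))); [lra| | |].
  - intros t Ht. apply D. lra.
  - intros t Ht. eapply is_derive_continuous, D, Ht.
  - intros t Ht. apply Rmult_le_pos; [exact Hg|].
    specialize (Hv t ltac:(lra)). apply Rmult_le_pos; [exact Hv|].
    destruct (energy_ge_velocity (u t) (v t)); [|exact Hv|destruct He; subst e; lra].
    eapply Rle_trans; [exact HE|].
    apply (energy_nonincreasing g T); try assumption; lra.
Qed.

(** Backward Gronwall: the squared distance N to the saddle satisfies N' >= - K N, so N exp(K t)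
    does not decrease, and N s = 0 forces N 0 = 0. The hypothesis a^2 = 1 provides the factor u - a
    of u^3 - u. This excludes arrival at a saddle in finite time. *)
Lemma equilibrium_backward (g a : R) (T : Rbar) (u v : R -> R) (s : R) :
  duffing_flow g T u v -> a ^ 2 = 1 -> 0 <= s -> Rbar_lt s T -> u s = a -> v s = 0 ->
  u 0 = a /\ v 0 = 0.
Proof.
  intros F Ha H0 Hs Eu Ev.
  destruct (duffing_flow_bounded _ _ _ _ s F H0 Hs) as [M [HM B]].
  set (K := 1 + M + M ^ 2 + 2 * Rabs g).
  set (N := fun t => (u t - a) ^ 2 + v t ^ 2).
  set (dN := fun t => 2 * (u t - a) * v t + 2 * v t * (u t ^ 3 - u t - g * v t)).
  assert (D : forall t, 0 <= t <= s ->
    is_derive (fun t => N t * exp (K * t)) t ((dN t + K * N t) * exp (K * t))).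
  { intros t Ht. destruct (F t) as [Du Dv];
      [lra|apply Rbar_lt_le_trans_R with s; [lra|exact Hs]|].
    unfold N, dN. derive_atoms. ring. }
  assert (H : N 0 * exp (K * 0) <= N s * exp (K * s)).
  { apply (derive_nonneg_le (fun t => N t * exp (K * t))
      (fun t => (dN t + K * N t) * exp (K * t))); [lra| | |].
    - intros t Ht. apply D. lra.
    - intros t Ht. eapply is_derive_continuous, D, Ht.
    - intros t Ht. apply Rmult_le_pos; [|apply Rlt_le, exp_pos].
      destruct (B t ltac:(lra)) as [Bu _]. apply Rabs_le_between in Bu.
      unfold dN, N, K. set (x := u t - a). set (y := v t).
      set (q := 1 + u t * (u t + a)).
      assert (Hcub : u t ^ 3 - u t = x * (u t * (u t + a))).
      { unfold x. replace (u t ^ 3 - u t) with (u t ^ 3 - a ^ 2 * u t) by (rewrite Ha; ring). ring. }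
      rewrite Hcub.
      replace (2 * x * y + 2 * y * (x * (u t * (u t + a)) - g * y))
        with (2 * x * y * q - 2 * g * y ^ 2) by (unfold q; ring).
      assert (Ha1 : -1 <= a <= 1) by nra.
      assert (Hq : - (1 + M + M ^ 2) <= q <= 1 + M + M ^ 2).
      { unfold q. assert (u t ^ 2 <= M ^ 2) by nra. assert (- M <= u t * a <= M) by nra.
        assert (0 <= u t ^ 2) by apply pow2_ge_0. split; nra. }
      assert (H1 : - (2 * x * y * q) <= (1 + M + M ^ 2) * (x ^ 2 + y ^ 2)).
      { pose proof (pow2_ge_0 (x - y)). pose proof (pow2_ge_0 (x + y)).
        assert (- (x ^ 2 + y ^ 2) <= 2 * x * y <= x ^ 2 + y ^ 2) by lra.
        pose proof (pow2_ge_0 x). pose proof (pow2_ge_0 y). nra. }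
      assert (H2 : g * y ^ 2 <= Rabs g * (x ^ 2 + y ^ 2)).
      { pose proof (Rle_abs g). pose proof (Rabs_pos g). pose proof (pow2_ge_0 x).
        pose proof (pow2_ge_0 y). nra. }
      lra. }
  unfold N in H. rewrite Eu, Ev, Rminus_diag, Rmult_0_r, exp_0 in H.
  assert ((u 0 - a) ^ 2 + v 0 ^ 2 <= 0) by (ring_simplify in H; lra).
  pose proof (pow2_ge_0 (u 0 - a)). pose proof (pow2_ge_0 (v 0)). split.
  - apply Rminus_diag_uniq, Rsqr_0_uniq. rewrite Rsqr_pow2. lra.
  - apply Rsqr_0_uniq. rewrite Rsqr_pow2. lra.
Qed.

(** * Blow-up outside the strip |u| <= 1 *)

Lemma duffing_flow_increasing (g : R) (T : Rbar) (u v : R -> R) (s t : R) :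
  duffing_flow g T u v -> 0 <= s < t -> Rbar_lt t T ->
  (forall r, s < r < t -> 0 < v r) -> u s < u t.
Proof.
  intros F Hst Ht Hv. apply (derive_pos_lt u v); try lra; [| |exact Hv].
  - intros r Hr. apply F; [lra|]. apply Rbar_lt_le_trans_R with t; [lra|exact Ht].
  - intros r Hr. apply (duffing_flow_continuous g T u v t F Ht). lra.
Qed.

(** The factor exp(g t) absorbs the damping: v exp(g t) has derivative (u^3 - u) exp(g t), which is
    nonnegative as long as u >= 1, and u grows while v > 0. *)
Lemma outward_invariant (g : R) (T : Rbar) (u v : R -> R) (s t : R) :
  duffing_flow g T u v -> 0 <= s <= t -> Rbar_lt t T -> 1 <= u s -> 0 < v s -> 0 < v t.
Proof.
  intros F Hst Ht Hu Hv. destruct (Rlt_dec 0 (v t)) as [L|L]; [exact L|exfalso].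
  destruct (first_zero v s t) as [t1 [Ht1 [E1 H1]]]; try lra.
  { intros r Hr. apply (duffing_flow_continuous g T u v t F Ht). lra. }
  assert (Hlt : forall r, s <= r <= t -> Rbar_lt r T).
  { intros r Hr. apply Rbar_lt_le_trans_R with t; [lra|exact Ht]. }
  assert (D : forall r, s <= r <= t1 ->
    is_derive (fun r => v r * exp (g * r)) r ((u r ^ 3 - u r) * exp (g * r))).
  { intros r Hr. destruct (F r) as [Du Dv]; [lra|apply Hlt; lra|]. derive_atoms. ring. }
  assert (H : v s * exp (g * s) <= v t1 * exp (g * t1)).
  { apply (derive_nonneg_le (fun r => v r * exp (g * r)) (fun r => (u r ^ 3 - u r) * exp (g * r)));
      [lra| | |].
    - intros r Hr. apply D. lra.
    - intros r Hr. eapply is_derive_continuous, D, Hr.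
    - intros r Hr. assert (u s < u r).
      { apply (duffing_flow_increasing g T u v); [exact F|lra|apply Hlt; lra|].
        intros q Hq. apply H1. lra. }
      apply Rmult_le_pos; [|apply Rlt_le, exp_pos]. assert (1 < u r ^ 2) by nra. nra. }
  rewrite E1, Rmult_0_l in H. pose proof (exp_pos (g * s)). nra.
Qed.

(** From u' >= c u^2 the function - 1 / u - c t is nondecreasing. At t = s + 1 / (c u(s)), the
    blow-up time of the Riccati equation, this would force 1 / u <= 0. *)
Lemma riccati_blowup (c : R) (u v : R -> R) (s : R) :
  0 < c -> 0 < u s -> (forall t, s <= t -> is_derive u t (v t)) ->
  (forall t, s <= t -> c * u t ^ 2 <= v t) -> False.
Proof.
  intros Hc Hs D H.
  assert (Hpos : forall t, s <= t -> u s <= u t).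
  { intros t Ht. apply (derive_nonneg_le u v); try assumption.
    - intros r Hr. apply D. lra.
    - intros r Hr. eapply is_derive_continuous, D. lra.
    - intros r Hr. specialize (H r ltac:(lra)). pose proof (pow2_ge_0 (u r)). nra. }
  set (t := s + 1 / (c * u s)).
  assert (Ht : s < t) by (unfold t; assert (0 < 1 / (c * u s)) by (apply Rdiv_lt_0_compat; nra); lra).
  assert (H1 : - / u s - c * s <= - / u t - c * t).
  { apply (derive_nonneg_le (fun t => - / u t - c * t) (fun t => (v t - c * u t ^ 2) / u t ^ 2));
      [lra| | |].
    - intros r Hr. pose proof (D r ltac:(lra)). pose proof (Hpos r ltac:(lra)).
      derive_atoms; [lra|field; lra].
    - intros r Hr. pose proof (D r ltac:(lra)). pose proof (Hpos r ltac:(lra)).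
      apply (ex_derive_continuous (fun t => - / u t - c * t)). auto_derive.
      repeat split; [eexists; eassumption|lra].
    - intros r Hr. pose proof (H r ltac:(lra)). pose proof (Hpos r ltac:(lra)).
      apply Rdiv_le_0_compat; [lra|]. apply pow_lt. lra. }
  assert (Et : c * t = c * s + / u s) by (unfold t; field; lra).
  pose proof (Hpos t ltac:(lra)). assert (0 < / u t) by (apply Rinv_0_lt_compat; lra). lra.
Qed.

(** Past some b > 1 the force is bounded below, so v stays above a positive m and u grows at least
    linearly; once u >= g + 2 the cubic force beats the damping and v >= c u^2 persists, which is a
    Riccati inequality. *)
Lemma outward_blowup (g : R) (u v : R -> R) (s : R) :
  duffing_flow g p_infty u v -> 0 <= g -> 0 <= s -> 1 <= u s -> 0 < v s -> False.
Proof.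
  intros F Hg Hs Hu Hv.
  assert (Du : forall t, 0 <= t -> is_derive u t (v t)) by (intros; now apply F).
  assert (Dv : forall t, 0 <= t -> is_derive v t (u t ^ 3 - u t - g * v t)) by (intros; now apply F).
  assert (C : forall t, 0 <= t -> continuous u t /\ continuous v t).
  { intros t Ht. apply (duffing_flow_continuous g p_infty u v t F I). lra. }
  assert (Vpos : forall t, s <= t -> 0 < v t).
  { intros t Ht. now apply (outward_invariant g p_infty u v s t); try lra. }
  assert (Uinc : forall r t, s <= r < t -> u r < u t).
  { intros r t Hrt. apply (duffing_flow_increasing g p_infty u v); [exact F|lra|exact I|].
    intros q Hq. apply Vpos. lra. }
  set (b := u (s + 1)).
  assert (Hb : 1 < b) by (unfold b; pose proof (Uinc s (s + 1)); lra).
  assert (Ub : forall t, s + 1 <= t -> b <= u t).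
  { intros t Ht. unfold b. destruct (Req_dec t (s + 1)) as [->|]; [lra|].
    apply Rlt_le, Uinc. lra. }
  set (k := b ^ 3 - b).
  assert (Hk : 0 < k).
  { unfold k. replace (b ^ 3 - b) with (b * ((b - 1) * (b + 1))) by ring.
    repeat apply Rmult_lt_0_compat; lra. }
  assert (Uk : forall t, s + 1 <= t -> k <= u t ^ 3 - u t).
  { intros t Ht. specialize (Ub t Ht). unfold k.
    assert (0 <= (u t - b) * (u t ^ 2 + u t * b + b ^ 2 - 1)) by (apply Rmult_le_pos; nra). lra. }
  (* Where v < m the damping is at most g m <= k, hence dominated by the force, so v cannot sink
     below [m]. The denominator g + 1 also covers g = 0. *)
  set (m := Rmin (v (s + 1)) (k / (g + 1))).
  assert (Hm : 0 < m).
  { apply Rmin_glb_lt; [apply Vpos; lra|]. apply Rdiv_lt_0_compat; lra. }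
  assert (Hmk : g * m <= k).
  { assert (Hm2 : m <= k / (g + 1)) by apply Rmin_r.
    apply (Rmult_le_compat_r (g + 1)) in Hm2; [|lra].
    replace (k / (g + 1) * (g + 1)) with k in Hm2 by (field; lra). nra. }
  assert (Vm : forall t, s + 1 <= t -> m <= v t).
  { intros t Ht. cut (0 <= v t - m); [lra|].
    apply (barrier (fun t => v t - m) (fun t => u t ^ 3 - u t - g * v t) (s + 1) t Ht).
    - intros r Hr. pose proof (Dv r ltac:(lra)). derive_atoms. ring.
    - intros r Hr. apply (continuous_minus v (fun _ => m)); [apply C; lra|apply continuous_const].
    - assert (m <= v (s + 1)) by apply Rmin_l. lra.
    - intros r Hr Hneg. specialize (Uk r ltac:(lra)). nra. }
  set (t2 := s + 1 + (g + 2) / m).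
  assert (Ht2 : s + 1 < t2) by (unfold t2; assert (0 < (g + 2) / m) by (apply Rdiv_lt_0_compat; lra); lra).
  assert (U2 : g + 2 <= u t2).
  { assert (H : u (s + 1) - m * (s + 1) <= u t2 - m * t2).
    { apply (derive_nonneg_le (fun t => u t - m * t) (fun t => v t - m)); [lra| | |].
      - intros r Hr. pose proof (Du r ltac:(lra)). derive_atoms. ring.
      - intros r Hr. apply (continuous_minus u (fun t => m * t)); [apply C; lra|].
        apply (ex_derive_continuous (fun t => m * t)). auto_derive. exact I.
      - intros r Hr. specialize (Vm r ltac:(lra)). lra. }
    assert (E : m * t2 = m * (s + 1) + (g + 2)) by (unfold t2; field; lra).
    fold b in H. lra. }
  assert (Ut : forall t, t2 <= t -> g + 2 <= u t).
  { intros t Ht. destruct (Req_dec t t2) as [->|]; [lra|]. pose proof (Uinc t2 t ltac:(lra)). lra. }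
  (* The second bound makes v >= c u^2 true at [t2]; the first gives 2 c u v <= u^3 / 2, half of the
     cubic force, wherever v <= c u^2. *)
  set (c := Rmin (1 / 2) (v t2 / u t2 ^ 2)).
  assert (Hc : 0 < c).
  { apply Rmin_glb_lt; [lra|]. apply Rdiv_lt_0_compat; [apply Vpos; lra|apply pow_lt; lra]. }
  assert (Hc2 : c <= 1 / 2) by apply Rmin_l.
  apply (riccati_blowup c u v t2 Hc); [lra|intros t Ht; apply Du; lra|].
  intros t Ht. cut (0 <= v t - c * u t ^ 2); [lra|].
  apply (barrier (fun t => v t - c * u t ^ 2)
    (fun t => u t ^ 3 - u t - g * v t - 2 * c * u t * v t) t2 t Ht).
  - intros r Hr. pose proof (Du r ltac:(lra)). pose proof (Dv r ltac:(lra)). derive_atoms. ring.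
  - intros r Hr. pose proof (Du r ltac:(lra)). pose proof (Dv r ltac:(lra)).
    apply (ex_derive_continuous (fun t => v t - c * u t ^ 2)). auto_derive.
    repeat split; eexists; eassumption.
  - assert (Hc3 : c <= v t2 / u t2 ^ 2) by apply Rmin_r.
    assert (Hsq : 0 < u t2 ^ 2) by (apply pow_lt; lra).
    apply (Rmult_le_compat_r (u t2 ^ 2)) in Hc3; [|lra].
    replace (v t2 / u t2 ^ 2 * u t2 ^ 2) with (v t2) in Hc3 by (field; lra). lra.
  - intros r Hr Hneg. specialize (Ut r ltac:(lra)). specialize (Vpos r ltac:(lra)).
    set (x := u r) in *. set (y := v r) in *.
    assert (Hy : y <= c * x ^ 2) by lra.
    assert (0 <= x ^ 2) by apply pow2_ge_0.
    assert (Hy2 : y <= 1 / 2 * x ^ 2) by nra.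
    assert (g * y <= g * (1 / 2 * x ^ 2)) by (apply Rmult_le_compat_l; assumption).
    assert (2 * c * x * y <= x * (1 / 2 * x ^ 2)).
    { apply Rle_trans with (x * y); [|apply Rmult_le_compat_l; lra].
      apply Rmult_le_compat_r; [lra|]. nra. }
    (* After the estimates above, the derivative is at least x (x (x - g) - 2) / 2, and x >= g + 2
       gives the sign. *)
    assert (0 <= x * (x * (x - g) - 2)) by (apply Rmult_le_pos; nra). nra.
Qed.

Lemma duffing_flow_opp (g : R) (T : Rbar) (u v : R -> R) :
  duffing_flow g T u v -> duffing_flow g T (fun t => - u t) (fun t => - v t).
Proof.
  intros F t H0 Ht. destruct (F t H0 Ht) as [Du Dv]. split; derive_atoms; ring.
Qed.

(** The velocity may vanish at [s]; the force u^3 - u < 0 makes it strictly negative shortly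
    afterwards, and the reflected motion is then covered by [outward_blowup]. *)
Lemma left_rest_blowup (g : R) (u v : R -> R) (s : R) :
  duffing_flow g p_infty u v -> 0 <= g -> 0 <= s -> u s < -1 -> v s <= 0 -> False.
Proof.
  intros F Hg Hs Hu Hv.
  assert (C : forall t, 0 <= t -> continuous u t /\ continuous v t).
  { intros t Ht. apply (duffing_flow_continuous g p_infty u v t F I). lra. }
  destruct (continuous_eps u s (- 1 - u s)) as [d [Hd Hd']]; [apply C; lra|lra|].
  assert (Hu' : forall t, s <= t <= s + d / 2 -> u t < -1).
  { intros t Ht. specialize (Hd' t ltac:(apply Rabs_def1; lra)). apply Rabs_def2 in Hd'. lra. }
  assert (D : forall r, s <= r ->
    is_derive (fun r => - (v r * exp (g * r))) r (- (u r ^ 3 - u r) * exp (g * r))).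
  { intros r Hr. destruct (F r) as [Du Dv]; [lra|exact I|]. derive_atoms. ring. }
  assert (H : - (v s * exp (g * s)) < - (v (s + d / 2) * exp (g * (s + d / 2)))).
  { apply (derive_pos_lt (fun r => - (v r * exp (g * r))) (fun r => - (u r ^ 3 - u r) * exp (g * r)));
      [lra| | |].
    - intros r Hr. apply D. lra.
    - intros r Hr. eapply is_derive_continuous, D. lra.
    - intros r Hr. specialize (Hu' r ltac:(lra)). apply Rmult_lt_0_compat; [|apply exp_pos].
      replace (- (u r ^ 3 - u r)) with (- u r * ((- u r - 1) * (- u r + 1))) by ring.
      repeat apply Rmult_lt_0_compat; lra. }
  pose proof (exp_pos (g * s)). pose proof (exp_pos (g * (s + d / 2))).
  specialize (Hu' (s + d / 2) ltac:(lra)).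
  apply (outward_blowup g (fun t => - u t) (fun t => - v t) (s + d / 2)); try lra.
  - now apply duffing_flow_opp.
  - nra.
Qed.

(** With energy below 1/4 the motion cannot touch u = -1, so it stays to the left. There the force
    is at most some - k < 0, v cannot remain positive, and [left_rest_blowup] applies once v <=
    0. *)
Lemma Kminus_left_blowup (g : R) (u v : R -> R) (s : R) :
  duffing_flow g p_infty u v -> 0 <= g -> 0 <= s -> u s < -1 ->
  energy (u s) (v s) < 1 / 4 -> False.
Proof.
  intros F Hg Hs Hu HE.
  assert (C : forall t, 0 <= t -> continuous u t /\ continuous v t).
  { intros t Ht. apply (duffing_flow_continuous g p_infty u v t F I). lra. }
  assert (E : forall t, s <= t -> energy (u t) (v t) <= energy (u s) (v s)).
  { intros t Ht. apply (energy_nonincreasing g p_infty); try assumption; [lra|exact I]. }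
  assert (Ul : forall t, s <= t -> u t < -1).
  { intros t Ht. destruct (Rlt_dec (u t) (-1)) as [L|L]; [exact L|exfalso].
    destruct (ivt_le u s t (-1)) as [r [Hr Er]]; [exact Ht| |lra|].
    { intros r Hr. apply C. lra. }
    specialize (E r ltac:(lra)). rewrite Er, (energy_equilibrium (-1)) in E by ring.
    pose proof (pow2_ge_0 (v r)). lra. }
  destruct (classic (exists t, s <= t /\ v t <= 0)) as [[t [Ht Hv]]|Hn].
  { apply (left_rest_blowup g u v t); try assumption; [lra|now apply Ul]. }
  assert (Vpos : forall t, s <= t -> 0 < v t).
  { intros t Ht. destruct (Rlt_dec 0 (v t)) as [L|L]; [exact L|].
    contradiction Hn. exists t. lra. }
  (* [energy_square] gives (u^2 - 1)^2 >= 1 - 4 E >= k. The cap at 1 turns this into u^2 - 1 >= k,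
     and u < -1 then gives u^3 - u <= - k. *)
  set (k := Rmin 1 (1 - 4 * energy (u s) (v s))).
  assert (Hk : 0 < k) by (apply Rmin_glb_lt; lra).
  assert (Uk : forall t, s <= t -> u t ^ 3 - u t <= - k).
  { intros t Ht. specialize (E t Ht). specialize (Ul t Ht). rewrite (energy_square (u t)) in E.
    assert (k <= 1) by apply Rmin_l.
    assert (Hk2 : k <= 1 - 4 * energy (u s) (v s)) by apply Rmin_r.
    pose proof (pow2_ge_0 (v t)).
    assert (Hz : k <= (u t ^ 2 - 1) ^ 2) by lra.
    assert (0 < u t ^ 2 - 1) by nra.
    assert (k <= u t ^ 2 - 1) by nra. nra. }
  set (t := s + v s / k).
  assert (Ht : s < t).
  { unfold t. assert (0 < v s / k) by (apply Rdiv_lt_0_compat; [apply Vpos; lra|exact Hk]). lra. }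
  assert (H : - v s - k * s <= - v t - k * t).
  { apply (derive_nonneg_le (fun t => - v t - k * t) (fun t => - (u t ^ 3 - u t - g * v t) - k));
      [lra| | |].
    - intros r Hr. destruct (F r) as [Du Dv]; [lra|exact I|]. derive_atoms. ring.
    - intros r Hr. destruct (F r) as [Du Dv]; [lra|exact I|].
      apply (ex_derive_continuous (fun t => - v t - k * t)). auto_derive.
      repeat split; eexists; eassumption.
    - intros r Hr. specialize (Uk r ltac:(lra)). specialize (Vpos r ltac:(lra)). nra. }
  assert (Et : k * t = k * s + v s) by (unfold t; field; lra).
  specialize (Vpos t ltac:(lra)). lra.
Qed.

(** If the energy stayed at or above 1/4, then v >= (u^2 - 1) / 2, the dissipation would grow like
    u^3, and the finite energy budget would bound u. The solution would then be global, against
    [outward_blowup]. *)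
Lemma outward_enters_Kminus (g u0 u1 : R) (T : Rbar) (u v : R -> R) :
  complete_flow g u0 u1 T u v -> 0 < g -> 1 <= u0 -> 0 < u1 ->
  exists t, 0 <= t /\ Rbar_lt t T /\ 1 < u t /\ energy (u t) (v t) < 1 / 4.
Proof.
  intros [HT [I0 [I1 [F Ext]]]] Hg Hu Hv.
  destruct (classic (exists t, 0 <= t /\ Rbar_lt t T /\ 1 < u t /\ energy (u t) (v t) < 1 / 4))
    as [H|Hn]; [exact H|exfalso].
  assert (Vpos : forall t : R, 0 <= t -> Rbar_lt t T -> 0 < v t).
  { intros t H0 Ht. apply (outward_invariant g T u v 0 t); try assumption; lra. }
  assert (Ug : forall t : R, 0 < t -> Rbar_lt t T -> u0 < u t).
  { intros t H0 Ht. rewrite <- I0.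
    apply (duffing_flow_increasing g T u v); [exact F|lra|exact Ht|].
    intros r Hr. apply Vpos; [lra|]. apply Rbar_lt_le_trans_R with t; [lra|exact Ht]. }
  assert (HE : forall t : R, 0 < t -> Rbar_lt t T -> 1 / 4 <= energy (u t) (v t)).
  { intros t H0 Ht. destruct (Rle_dec (1 / 4) (energy (u t) (v t))) as [L|L]; [exact L|].
    contradiction Hn. exists t. specialize (Ug t H0 Ht). repeat split; try assumption; lra. }
  (* The energy budget leaves (u^3 / 3 - u) / 2 <= c. For u > 3 + u0 + |c| one has u^3 >= 9 u, so
     the left side would be at least u > c. *)
  set (e := energy u0 u1). set (c := (e - 1 / 4) / g - (u0 - u0 ^ 3 / 3) / 2).
  assert (Ub : forall t : R, 0 <= t -> Rbar_lt t T -> Rabs (u t) <= 3 + u0 + Rabs c).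
  { intros t H0 Ht. pose proof (Rabs_pos c). pose proof (Rle_abs c).
    destruct (Req_dec t 0) as [->|Hnz]; [rewrite I0; apply Rabs_le; lra|].
    assert (Hlt : 0 < t) by lra.
    specialize (HE t Hlt Ht). specialize (Ug t Hlt Ht).
    assert (D := energy_dissipation g (-1) T u v 0 t F (Rlt_le _ _ Hg) (or_intror eq_refl)
      ltac:(lra) Ht).
    assert (D' : energy (u t) (v t) + g * -1 * (u t - u t ^ 3 / 3) / 2
      <= energy (u 0) (v 0) + g * -1 * (u 0 - u 0 ^ 3 / 3) / 2).
    { apply D; [|exact HE]. intros r Hr. apply Rlt_le, Vpos; [lra|].
      apply Rbar_lt_le_trans_R with t; [lra|exact Ht]. }
    clear D. rewrite I0, I1 in D'. fold e in D'.
    assert (Hgc : g * ((u t ^ 3 / 3 - u t) / 2) <= g * c).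
    { unfold c. replace (g * ((e - 1 / 4) / g - (u0 - u0 ^ 3 / 3) / 2))
        with (e - 1 / 4 - g * ((u0 - u0 ^ 3 / 3) / 2)) by (field; lra). lra. }
    apply Rmult_le_reg_l in Hgc; [|exact Hg].
    apply Rabs_le. split; [lra|]. apply Rnot_lt_le. intros L.
    assert (9 <= u t ^ 2) by nra. assert (9 * u t <= u t ^ 3) by nra. lra. }
  assert (ET : T = p_infty).
  { apply (Ext (3 + u0 + Rabs c + (2 * Rabs e + (3 + u0 + Rabs c) ^ 4 + 1))).
    intros t H0 Ht. pose proof (Ub t H0 Ht) as B.
    assert (B' : Rabs (v t) <= 2 * Rabs e + (3 + u0 + Rabs c) ^ 4 + 1).
    { apply (energy_velocity_bound (u t)); [|exact B]. unfold e. rewrite <- I0, <- I1.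
      apply (energy_nonincreasing g T); try assumption; lra. }
    pose proof (Rabs_pos (v t)). pose proof (Rabs_pos (u t)). lra. }
  subst T. apply (outward_blowup g u v 0 F); lra.
Qed.

(** * Exponential convergence to the equilibria *)

Lemma exponential_convergence (g a b t0 C c : R) (u v : R -> R) :
  duffing_flow g p_infty u v -> 0 <= t0 -> 0 <= C -> 0 < c ->
  (forall t, t0 <= t -> (u t - a) ^ 2 + (v t - b) ^ 2 <= C * exp (- c * t)) ->
  converges_exponentially a b p_infty u v.
Proof.
  intros F Ht0 HC Hc H.
  assert (Cont : forall t, 0 <= t <= t0 -> continuous (fun t => (u t - a) ^ 2 + (v t - b) ^ 2) t).
  { intros t Ht. destruct (F t) as [Du Dv]; [lra|exact I|].
    apply (ex_derive_continuous (fun t => (u t - a) ^ 2 + (v t - b) ^ 2)). auto_derive.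
    repeat split; eexists; eassumption. }
  destruct (continuous_bounded _ 0 t0 Ht0 Cont) as [M [HM B]].
  (* M exp(c t0) covers the times before [t0]; the summand 1 gives C1 <= C1^2, so that [C1] still
     serves after the square root, which halves the rate. *)
  set (C1 := C + M * exp (c * t0) + 1).
  assert (HMe : 0 < M * exp (c * t0)) by (apply Rmult_lt_0_compat; [exact HM|apply exp_pos]).
  assert (Main : forall t, t >= 0 ->
    sqrt ((u t - a) ^ 2 + (v t - b) ^ 2) <= C1 * exp (- (c / 2) * t)).
  { intros t Ht. pose proof (exp_pos (- (c / 2) * t)) as P.
    rewrite <- (sqrt_pow2 (C1 * exp (- (c / 2) * t))) by (apply Rmult_le_pos; unfold C1; lra).
    apply sqrt_le_1_alt. rewrite Rpow_mult_distr.
    replace (exp (- (c / 2) * t) ^ 2) with (exp (- c * t))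
      by (simpl; rewrite Rmult_1_r, <- exp_plus; f_equal; field).
    pose proof (exp_pos (- c * t)) as P'.
    assert (HC1 : C1 <= C1 ^ 2) by (unfold C1; nra).
    apply Rle_trans with (C1 * exp (- c * t)); [|apply Rmult_le_compat_r; lra].
    destruct (Rle_dec t0 t) as [L|L].
    - eapply Rle_trans; [apply H, L|]. apply Rmult_le_compat_r; unfold C1; lra.
    - specialize (B t ltac:(lra)). simpl in B. pose proof (Rle_abs ((u t - a) ^ 2 + (v t - b) ^ 2)) as A.
      simpl in A. apply Rle_trans with M; [simpl; lra|].
      apply Rle_trans with (M * exp (c * t0) * exp (- c * t)); [|apply Rmult_le_compat_r; unfold C1; lra].
      rewrite Rmult_assoc, <- exp_plus.
      pose proof (exp_ineq1_le (c * t0 + - c * t)). assert (0 <= c * t0 + - c * t) by nra.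
      rewrite <- (Rmult_1_r M) at 1. apply Rmult_le_compat_l; lra. }
  assert (Lim : forall (w : R -> R) (l : R),
    (forall t, (w t - l) ^ 2 <= (u t - a) ^ 2 + (v t - b) ^ 2) -> is_lim w p_infty l).
  { intros w l Hw. apply is_lim_spec. intros eps.
    (* Beyond this time exp(c t / 2) >= 1 + c t / 2 exceeds C1 / eps. *)
    exists (C1 / (c / 2 * eps)). intros t Ht.
    assert (Heps := cond_pos eps).
    assert (HC1 : 0 < C1) by (unfold C1; lra).
    assert (Hce : 0 < c / 2 * eps) by (apply Rmult_lt_0_compat; lra).
    assert (Htp : 0 < t) by (eapply Rlt_trans; [|exact Ht]; now apply Rdiv_lt_0_compat).
    specialize (Main t ltac:(lra)).
    assert (A : Rabs (w t - l) <= C1 * exp (- (c / 2) * t)).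
    { eapply Rle_trans; [|exact Main]. rewrite <- sqrt_Rsqr_abs. apply sqrt_le_1_alt.
      rewrite Rsqr_pow2. apply Hw. }
    eapply Rle_lt_trans; [exact A|].
    pose proof (exp_ineq1_le (c / 2 * t)) as X.
    assert (X2 : exp (- (c / 2) * t) * exp (c / 2 * t) = 1).
    { rewrite <- exp_plus. replace (- (c / 2) * t + c / 2 * t) with 0 by ring. apply exp_0. }
    apply (Rmult_lt_compat_r (c / 2 * eps)) in Ht; [|exact Hce].
    replace (C1 / (c / 2 * eps) * (c / 2 * eps)) with C1 in Ht by (field; lra).
    pose proof (exp_pos (- (c / 2) * t)) as X3.
    assert (C1 < eps * exp (c / 2 * t)) by nra.
    apply Rlt_le_trans with (eps * exp (c / 2 * t) * exp (- (c / 2) * t)); [nra|].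
    rewrite Rmult_assoc, (Rmult_comm (exp (c / 2 * t))), X2. lra. }
  split; [reflexivity|]. split; [|split].
  - apply Lim. intros t. pose proof (pow2_ge_0 (v t - b)). lra.
  - apply Lim. intros t. pose proof (pow2_ge_0 (u t - a)). lra.
  - exists C1, (c / 2). split; [unfold C1; lra|]. split; [lra|exact Main].
Qed.

(* The Lyapunov function is [E + eps u v]. *)
Lemma well_convergence (g u0 u1 : R) (T : Rbar) (u v : R -> R) (s : R) :
  complete_flow g u0 u1 T u v -> 0 < g -> 0 <= s -> Rbar_lt s T -> -1 < u s < 1 ->
  energy (u s) (v s) < 1 / 4 -> converges_exponentially 0 0 T u v.
Proof.
  intros [HT [I0 [I1 [F Ext]]]] Hg Hs HsT Hu HE.
  set (e := energy (u s) (v s)).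
  assert (C : forall t : R, 0 <= t -> Rbar_lt t T -> continuous u t /\ continuous v t).
  { intros t Ht HtT. apply (duffing_flow_continuous g T u v t F HtT). lra. }
  assert (E : forall t : R, s <= t -> Rbar_lt t T -> energy (u t) (v t) <= e).
  { intros t Ht HtT. apply (energy_nonincreasing g T); try assumption; lra. }
  assert (Uin : forall t : R, s <= t -> Rbar_lt t T -> -1 < u t < 1).
  { intros t Ht HtT.
    assert (Hr : forall r, s <= r <= t -> Rbar_lt r T).
    { intros r Hr. apply Rbar_lt_le_trans_R with t; [lra|exact HtT]. }
    assert (Hno : forall r a, s <= r <= t -> a ^ 2 = 1 -> u r <> a).
    { intros r a Hr' Ha Er. specialize (E r ltac:(lra) (Hr r Hr')).
      rewrite Er, (energy_equilibrium a) in E by exact Ha.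
      pose proof (pow2_ge_0 (v r)). unfold e in E. lra. }
    split; apply Rnot_le_lt; intros L.
    - destruct (ivt_le (fun t => - u t) s t 1) as [r [Hr' Er]]; [exact Ht| |lra|].
      + intros r Hr'. apply (continuous_opp u), C; [lra|now apply Hr].
      + apply (Hno r (-1)); [exact Hr'|ring|lra].
    - destruct (ivt_le u s t 1) as [r [Hr' Er]]; [exact Ht| |lra|].
      + intros r Hr'. apply C; [lra|now apply Hr].
      + apply (Hno r 1); [exact Hr'|ring|exact Er]. }
  assert (ET : T = p_infty).
  { destruct (duffing_flow_bounded _ _ _ _ s F Hs HsT) as [M [HM B]].
    pose proof (Rabs_pos e).
    apply (Ext (M + (2 * Rabs e + 1 ^ 4 + 1))). intros t Ht HtT.
    destruct (Rle_dec t s) as [L|L].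
    - destruct (B t ltac:(lra)). lra.
    - specialize (Uin t ltac:(lra) HtT).
      assert (A : Rabs (u t) <= 1) by (apply Rabs_le; lra).
      pose proof (energy_velocity_bound (u t) (v t) e 1 (E t ltac:(lra) HtT) A). lra. }
  subst T.
  (* As 0 < 1 - u^2 <= 1, the energy bound gives 1 - u^2 >= (1 - u^2)^2 >= k: the position keeps a
     uniform distance from the saddles. *)
  set (k := 1 - 4 * e). assert (Hk : 0 < k) by (unfold k, e; lra).
  assert (Uk : forall t, s <= t -> k <= 1 - u t ^ 2 <= 1).
  { intros t Ht. specialize (E t Ht I). specialize (Uin t Ht I).
    rewrite energy_square in E. pose proof (pow2_ge_0 (v t)). pose proof (pow2_ge_0 (u t)).
    split; [|lra]. assert (k <= (1 - u t ^ 2) ^ 2) by (unfold k; lra).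
    assert (0 < 1 - u t ^ 2 <= 1) by nra. nra. }
  (* Young's inequality pays for the cross term - g u v with half of k u^2, and [q] is the resulting
     coefficient of v^2. Below, ep q <= g / 2 spends only half of the damping, and ep <= 1/4 keeps
     the Lyapunov function between (u^2 + v^2) / 8 and u^2 + v^2. *)
  set (q := 1 + g ^ 2 / (2 * k)).
  assert (Hq : 0 < q).
  { unfold q. assert (0 <= g ^ 2 / (2 * k)) by (apply Rdiv_le_0_compat; [apply pow2_ge_0|lra]). lra. }
  set (ep := Rmin (1 / 4) (g / (2 * q))).
  assert (Hep : 0 < ep) by (apply Rmin_glb_lt; [lra|apply Rdiv_lt_0_compat; lra]).
  assert (Hep1 : ep <= 1 / 4) by apply Rmin_l.
  assert (Hep2 : ep * q <= g / 2).
  { assert (L : ep <= g / (2 * q)) by apply Rmin_r.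
    apply (Rmult_le_compat_r q) in L; [|lra].
    replace (g / (2 * q) * q) with (g / 2) in L by (field; lra). exact L. }
  set (c := Rmin (g / 2) (ep * k / 2)).
  assert (Hc : 0 < c) by (apply Rmin_glb_lt; [lra|]; nra).
  set (L := fun t => energy (u t) (v t) + ep * u t * v t).
  set (dL := fun t => - g * v t ^ 2 + ep * (v t ^ 2 + u t * (u t ^ 3 - u t - g * v t))).
  assert (DL : forall t, s <= t -> is_derive L t (dL t)).
  { intros t Ht. destruct (F t) as [Du Dv]; [lra|exact I|].
    unfold L, dL, energy. derive_atoms. field. }
  assert (BL : forall t, s <= t -> (u t ^ 2 + v t ^ 2) / 8 <= L t <= u t ^ 2 + v t ^ 2).
  { intros t Ht. specialize (Uk t Ht). unfold L, energy.
    set (x := u t) in *. set (y := v t) in *.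
    assert (A : - (x ^ 2 + y ^ 2) / 8 <= ep * x * y <= (x ^ 2 + y ^ 2) / 8).
    { pose proof (pow2_ge_0 (x - y)). pose proof (pow2_ge_0 (x + y)).
      assert (- (x ^ 2 + y ^ 2) / 2 <= x * y <= (x ^ 2 + y ^ 2) / 2) by lra.
      pose proof (pow2_ge_0 x). pose proof (pow2_ge_0 y). rewrite Rmult_assoc. nra. }
    assert (0 <= x ^ 4 <= x ^ 2).
    { replace (x ^ 4) with (x ^ 2 * x ^ 2) by ring. pose proof (pow2_ge_0 x). nra. }
    pose proof (pow2_ge_0 x). pose proof (pow2_ge_0 y). lra. }
  assert (HdL : forall t, s <= t -> dL t <= - c * (u t ^ 2 + v t ^ 2)).
  { intros t Ht. specialize (Uk t Ht). unfold dL.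
    set (x := u t) in *. set (y := v t) in *.
    assert (Hc1 : c <= g / 2) by apply Rmin_l.
    assert (Hc2 : c <= ep * k / 2) by apply Rmin_r.
    assert (Y : - (g * (x * y)) <= k / 2 * x ^ 2 + g ^ 2 / (2 * k) * y ^ 2).
    { assert (Sq : 0 <= (k * x + g * y) ^ 2 / (2 * k)) by (apply Rdiv_le_0_compat; [apply pow2_ge_0|lra]).
      replace ((k * x + g * y) ^ 2 / (2 * k))
        with (k / 2 * x ^ 2 + g * (x * y) + g ^ 2 / (2 * k) * y ^ 2) in Sq by (field; lra). lra. }
    assert (X : k * x ^ 2 <= x ^ 2 * (1 - x ^ 2)) by (pose proof (pow2_ge_0 x); nra).
    assert (Z : y ^ 2 + x * (x ^ 3 - x - g * y) <= q * y ^ 2 - k / 2 * x ^ 2) by (unfold q; nra).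
    apply (Rmult_le_compat_l ep) in Z; [|lra].
    pose proof (pow2_ge_0 x). pose proof (pow2_ge_0 y).
    assert (ep * q * y ^ 2 <= g / 2 * y ^ 2) by (apply Rmult_le_compat_r; lra).
    assert (c * y ^ 2 <= g / 2 * y ^ 2) by (apply Rmult_le_compat_r; lra).
    assert (c * x ^ 2 <= ep * k / 2 * x ^ 2) by (apply Rmult_le_compat_r; lra).
    lra. }
  assert (Decay : forall t, s <= t -> L t * exp (c * t) <= L s * exp (c * s)).
  { intros t Ht. apply Ropp_le_cancel.
    assert (D : forall r, s <= r -> is_derive (fun t => - (L t * exp (c * t))) r
      (- (dL r + c * L r) * exp (c * r))).
    { intros r Hr. pose proof (DL r Hr). derive_atoms. ring. }
    apply (derive_nonneg_le (fun t => - (L t * exp (c * t)))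
      (fun r => - (dL r + c * L r) * exp (c * r))); [lra| | |].
    - intros r Hr. apply D. lra.
    - intros r Hr. eapply is_derive_continuous, D. lra.
    - intros r Hr. specialize (HdL r ltac:(lra)). specialize (BL r ltac:(lra)).
      apply Rmult_le_pos; [nra|apply Rlt_le, exp_pos]. }
  apply (exponential_convergence g 0 0 s (8 * (L s * exp (c * s))) c u v); try assumption.
  - specialize (BL s (Rle_refl s)). pose proof (exp_pos (c * s)).
    pose proof (pow2_ge_0 (u s)). pose proof (pow2_ge_0 (v s)).
    assert (0 <= L s) by lra. nra.
  - intros t Ht. rewrite !Rminus_0_r. specialize (Decay t Ht). specialize (BL t Ht).
    apply Rle_trans with (8 * L t); [lra|]. rewrite Rmult_assoc.
    apply Rmult_le_compat_l; [lra|].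
    assert (X : exp (c * t) * exp (- c * t) = 1).
    { rewrite <- exp_plus. replace (c * t + - c * t) with 0 by ring. apply exp_0. }
    pose proof (exp_pos (- c * t)).
    replace (L t) with (L t * exp (c * t) * exp (- c * t)) by (rewrite Rmult_assoc, X; ring).
    apply Rmult_le_compat_r; lra.
Qed.

(* Since [v] decreases, [v t <= u t - u (t - 1) <= a - u (t - 1)]. *)
Lemma saddle_convergence (g a t0 : R) (u v : R -> R) :
  duffing_flow g p_infty u v -> 0 <= g -> 0 <= t0 ->
  (forall t, t0 <= t -> 0 < v t /\ u t < a /\ u t ^ 3 - u t <= 0 /\ (a - u t) / 2 <= v t) ->
  converges_exponentially a 0 p_infty u v.
Proof.
  intros F Hg Ht0 H.
  set (W := (a - u t0) * exp (1 / 2 * t0)).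
  assert (HW : 0 < W).
  { destruct (H t0 (Rle_refl t0)) as [_ [Hu _]]. apply Rmult_lt_0_compat; [lra|apply exp_pos]. }
  assert (Decay : forall t, t0 <= t -> 0 < a - u t <= W * exp (- (1 / 2) * t)).
  { intros t Ht. split; [destruct (H t Ht); lra|].
    assert (D : forall r, t0 <= r -> is_derive (fun t => - ((a - u t) * exp (1 / 2 * t))) r
      ((v r - (a - u r) / 2) * exp (1 / 2 * r))).
    { intros r Hr. destruct (F r) as [Du Dv]; [lra|exact I|]. derive_atoms. field. }
    assert (L : - ((a - u t0) * exp (1 / 2 * t0)) <= - ((a - u t) * exp (1 / 2 * t))).
    { apply (derive_nonneg_le (fun t => - ((a - u t) * exp (1 / 2 * t)))
        (fun r => (v r - (a - u r) / 2) * exp (1 / 2 * r))); [lra| | |].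
      - intros r Hr. apply D. lra.
      - intros r Hr. eapply is_derive_continuous, D. lra.
      - intros r Hr. destruct (H r ltac:(lra)) as [_ [_ [_ Hr']]].
        apply Rmult_le_pos; [lra|apply Rlt_le, exp_pos]. }
    fold W in L.
    assert (X : exp (1 / 2 * t) * exp (- (1 / 2) * t) = 1).
    { rewrite <- exp_plus. replace (1 / 2 * t + - (1 / 2) * t) with 0 by ring. apply exp_0. }
    replace (a - u t) with ((a - u t) * exp (1 / 2 * t) * exp (- (1 / 2) * t))
      by (rewrite Rmult_assoc, X; ring).
    apply Rmult_le_compat_r; [apply Rlt_le, exp_pos|lra]. }
  assert (Vb : forall t, t0 + 1 <= t -> v t <= a - u (t - 1)).
  { intros t Ht. destruct (mvt_open u v (t - 1) t) as [c [Hc E]]; [lra| | |].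
    - intros r Hr. apply F; [lra|exact I].
    - intros r Hr. apply (duffing_flow_continuous g p_infty u v t F I). lra.
    - destruct (H t ltac:(lra)) as [_ [Hu _]].
      assert (L : - v c <= - v t).
      { apply (derive_nonneg_le (fun t => - v t) (fun t => - (u t ^ 3 - u t - g * v t))); [lra| | |].
        - intros r Hr. destruct (F r) as [Du Dv]; [lra|exact I|]. derive_atoms. ring.
        - intros r Hr. apply (continuous_opp v).
          apply (duffing_flow_continuous g p_infty u v t F I). lra.
        - intros r Hr. destruct (H r ltac:(lra)) as [Hv [_ [Hcub _]]]. nra. }
      lra. }
  (* The velocity at t is bounded through the position at t - 1, hence the start at t0 + 1; the
     shift by one unit of time costs the factor exp 1. *)
  apply (exponential_convergence g a 0 (t0 + 1) (W ^ 2 * (1 + exp 1)) 1 u v); try assumption; try lra.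
  - pose proof (exp_pos 1). pose proof (pow2_ge_0 W). nra.
  - intros t Ht. rewrite Rminus_0_r.
    destruct (Decay t ltac:(lra)) as [D1 D2]. destruct (Decay (t - 1) ltac:(lra)) as [D3 D4].
    specialize (Vb t Ht). destruct (H t ltac:(lra)) as [Hv _].
    assert (S1 : (u t - a) ^ 2 <= W ^ 2 * exp (- (1) * t)).
    { replace (exp (- (1) * t)) with (exp (- (1 / 2) * t) ^ 2)
        by (simpl; rewrite Rmult_1_r, <- exp_plus; f_equal; field).
      rewrite <- Rpow_mult_distr. replace ((u t - a) ^ 2) with ((a - u t) ^ 2) by ring.
      apply pow_incr. lra. }
    assert (S2 : v t ^ 2 <= W ^ 2 * (exp 1 * exp (- (1) * t))).
    { rewrite <- exp_plus.
      replace (exp (1 + - (1) * t)) with (exp (- (1 / 2) * (t - 1)) ^ 2)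
        by (simpl; rewrite Rmult_1_r, <- exp_plus; f_equal; field).
      rewrite <- Rpow_mult_distr. apply pow_incr. lra. }
    lra.
Qed.

(** * Rightward motion in the phase plane *)

Definition moving (T : Rbar) (v : R -> R) (s : R) : Prop :=
  0 <= s /\ Rbar_lt s T /\ forall t, 0 <= t <= s -> 0 < v t.

(** The position is reached during the first rightward run and with positive velocity; this
    strictness makes the condition stable under small changes of damping. *)
Definition passes (T : Rbar) (u v : R -> R) (y : R) : Prop :=
  exists s, moving T v s /\ u s = y.

(* [x] is the abscissa where the rightward motion ends, attained in finite time or not. *)
Definition stalls (T : Rbar) (u v : R -> R) (x : R) : Prop :=
  (exists s, 0 <= s /\ Rbar_lt s T /\ (forall t, 0 <= t < s -> 0 < v t) /\ v s = 0 /\ u s = x)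
  \/ (T = p_infty /\ (forall t, 0 <= t -> 0 < v t) /\
      is_lim u p_infty x /\ is_lim v p_infty 0).

Lemma is_lim_p_infty_eps (f : R -> R) (l eps : R) :
  is_lim f p_infty l -> 0 < eps -> exists N, 0 <= N /\ forall t, N < t -> Rabs (f t - l) < eps.
Proof.
  intros H He. apply is_lim_spec in H. destruct (H (mkposreal eps He)) as [N HN].
  exists (Rmax 0 N). split; [apply Rmax_l|]. intros t Ht. apply (HN t).
  eapply Rle_lt_trans; [apply Rmax_r|exact Ht].
Qed.

Lemma moving_sub (T : Rbar) (v : R -> R) (s t : R) : moving T v s -> 0 <= t <= s -> moving T v t.
Proof.
  intros [H0 [Hs Hv]] Ht. split; [lra|]. split.
  - apply Rbar_lt_le_trans_R with s; [lra|exact Hs].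
  - intros r Hr. apply Hv. lra.
Qed.

Lemma moving_increasing (g : R) (T : Rbar) (u v : R -> R) (s t : R) :
  duffing_flow g T u v -> moving T v t -> 0 <= s < t -> u s < u t.
Proof.
  intros F [H0 [Ht Hv]] Hst. apply (duffing_flow_increasing g T u v); try assumption.
  intros r Hr. apply Hv. lra.
Qed.

Lemma moving_order (g : R) (T : Rbar) (u v : R -> R) (s t : R) :
  duffing_flow g T u v -> moving T v s -> moving T v t -> u s < u t -> s < t.
Proof.
  intros F Hs Ht H. destruct (Rlt_dec s t) as [L|L]; [exact L|exfalso].
  destruct (Req_dec s t) as [->|N]; [lra|].
  assert (H0 : 0 <= t) by apply Ht.
  pose proof (moving_increasing g T u v t s F Hs ltac:(lra)). lra.
Qed.

Lemma moving_passes (g : R) (T : Rbar) (u v : R -> R) (s y : R) :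
  duffing_flow g T u v -> moving T v s -> u 0 <= y <= u s ->
  exists r, 0 <= r <= s /\ moving T v r /\ u r = y.
Proof.
  intros F Hs Hy. assert (Hs' := Hs). destruct Hs' as [H0 [HsT _]].
  destruct (ivt_le u 0 s y H0) as [r [Hr Er]]; [|exact Hy|].
  - intros t Ht. now apply (duffing_flow_continuous g T u v s F HsT).
  - exists r. split; [exact Hr|]. split; [now apply moving_sub with s|exact Er].
Qed.

Lemma energy_near (x y eps : R) : 0 < eps -> exists d, 0 < d /\
  forall x' y', Rabs (x' - x) < d -> Rabs (y' - y) < d ->
    Rabs (energy x' y' - energy x y) < eps.
Proof.
  intros He.
  destruct (continuous_eps (fun x => energy x 0) x (eps / 2)) as [d1 [Hd1 H1]]; [|lra|].
  { apply (ex_derive_continuous (fun x => energy x 0)). unfold energy. auto_derive. exact I. }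
  destruct (continuous_eps (fun y => y ^ 2 / 2) y (eps / 2)) as [d2 [Hd2 H2]]; [|lra|].
  { apply (ex_derive_continuous (fun y => y ^ 2 / 2)). auto_derive. exact I. }
  exists (Rmin d1 d2). split; [now apply Rmin_glb_lt|]. intros x' y' Hx Hy.
  specialize (H1 x' (Rlt_le_trans _ _ _ Hx (Rmin_l _ _))).
  specialize (H2 y' (Rlt_le_trans _ _ _ Hy (Rmin_r _ _))). simpl in H1, H2.
  replace (energy x' y' - energy x y)
    with ((energy x' 0 - energy x 0) + (y' ^ 2 / 2 - y ^ 2 / 2)) by (unfold energy; field).
  eapply Rle_lt_trans; [apply Rabs_triang|]. simpl. lra.
Qed.

(** Treats attained and asymptotic stalls alike: in both, the velocity becomes small while the
    position is still strictly left of [x]. Most later arguments use a stall only through such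
    moments. *)
Lemma stalls_approach (g u0 u1 : R) (T : Rbar) (u v : R -> R) (x eps : R) :
  complete_flow g u0 u1 T u v -> 0 < u1 -> stalls T u v x -> 0 < eps ->
  exists s, moving T v s /\ x - eps < u s < x /\ v s < eps.
Proof.
  intros [HT [I0 [I1 [F _]]]] Hu1 [[s [H0 [Hs [Hv [Ev Eu]]]]]|[-> [Hv [Lu Lv]]]] He.
  - assert (Hs0 : 0 < s).
    { destruct (Req_dec s 0) as [E|]; [subst s; lra|lra]. }
    destruct (duffing_flow_continuous g T u v s F Hs s ltac:(lra)) as [Cu Cv].
    destruct (continuous_eps u s eps Cu He) as [d1 [Hd1 H1]].
    destruct (continuous_eps v s eps Cv He) as [d2 [Hd2 H2]].
    set (t := Rmax (s / 2) (Rmax (s - d1 / 2) (s - d2 / 2))).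
    assert (T1 : s / 2 <= t) by apply Rmax_l.
    assert (T2 : s - d1 / 2 <= t) by (eapply Rle_trans; [apply Rmax_l|apply Rmax_r]).
    assert (T3 : s - d2 / 2 <= t) by (eapply Rle_trans; [apply Rmax_r|apply Rmax_r]).
    assert (T4 : t < s) by (repeat apply Rmax_lub_lt; lra).
    specialize (H1 t ltac:(apply Rabs_def1; lra)). specialize (H2 t ltac:(apply Rabs_def1; lra)).
    apply Rabs_def2 in H1. apply Rabs_def2 in H2.
    assert (u t < u s).
    { apply (duffing_flow_increasing g T u v); [exact F|lra|exact Hs|]. intros r Hr. apply Hv. lra. }
    exists t. split; [|lra]. split; [lra|]. split.
    + apply Rbar_lt_le_trans_R with s; [lra|exact Hs].
    + intros r Hr. apply Hv. lra.
  - destruct (is_lim_p_infty_eps u x eps Lu He) as [N1 [P1 H1]].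
    destruct (is_lim_p_infty_eps v 0 eps Lv He) as [N2 [P2 H2]].
    set (t := N1 + N2 + 1).
    specialize (H1 t ltac:(unfold t; lra)). specialize (H2 t ltac:(unfold t; lra)).
    apply Rabs_def2 in H1. apply Rabs_def2 in H2.
    assert (M : forall r, 0 <= r -> moving p_infty v r).
    { intros r Hr. split; [exact Hr|]. split; [exact I|]. intros q Hq. apply Hv. lra. }
    exists t. split; [apply M; unfold t; lra|].
    split; [|lra]. split; [lra|]. apply Rnot_le_lt. intros L.
    assert (Inc := moving_increasing g p_infty u v t (t + 1) F (M (t + 1) ltac:(unfold t; lra))
      ltac:(unfold t; lra)).
    destruct (is_lim_p_infty_eps u x (u (t + 1) - x) Lu ltac:(lra)) as [N [PN HN]].
    set (r := t + 2 + N).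
    specialize (HN r ltac:(unfold r, t; lra)). apply Rabs_def2 in HN.
    pose proof (moving_increasing g p_infty u v (t + 1) r F (M r ltac:(unfold r, t; lra))
      ltac:(unfold r, t; lra)). lra.
Qed.

(** A position at or beyond [x] would be strictly exceeded by continuing the run, and since u only
    increases until the stall, it could then neither end at [x] nor tend to it. *)
Lemma stalls_bound (g u0 u1 : R) (T : Rbar) (u v : R -> R) (x s : R) :
  complete_flow g u0 u1 T u v -> 0 < u1 -> stalls T u v x -> moving T v s -> u s < x.
Proof.
  intros CF Hu1 St Hs. assert (F : duffing_flow g T u v) by apply CF.
  apply Rnot_le_lt. intros L.
  assert (Hlt : exists r, moving T v r /\ x < u r).
  { destruct St as [[r [H0 [Hr [Hv [Ev Eu]]]]]|[-> [Hv _]]].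
    - assert (s < r).
      { destruct (Rlt_dec s r) as [|N]; [assumption|]. destruct Hs as [_ [_ Hs]].
        specialize (Hs r ltac:(lra)). lra. }
      assert (0 <= s) by apply Hs.
      assert (u s < u r).
      { apply (duffing_flow_increasing g T u v); [exact F|lra|exact Hr|]. intros q Hq. apply Hv. lra. }
      lra.
    - assert (0 <= s) by apply Hs.
      assert (M : moving p_infty v (s + 1)).
      { split; [lra|]. split; [exact I|]. intros q Hq. apply Hv. lra. }
      exists (s + 1). split; [exact M|].
      pose proof (moving_increasing g p_infty u v s (s + 1) F M ltac:(lra)). lra. }
  destruct Hlt as [r [Hr Hlt]].
  destruct St as [[q [H0 [Hq [Hv [Ev Eu]]]]]|[-> [Hv [Lu _]]]].
  - assert (r < q).
    { destruct (Rlt_dec r q) as [|N]; [assumption|]. destruct Hr as [_ [_ Hr]].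
      specialize (Hr q ltac:(lra)). lra. }
    assert (0 <= r) by apply Hr.
    assert (u r < u q).
    { apply (duffing_flow_increasing g T u v); [exact F|lra|exact Hq|]. intros p Hp. apply Hv. lra. }
    lra.
  - assert (0 <= r) by apply Hr.
    destruct (is_lim_p_infty_eps u x (u r - x) Lu ltac:(lra)) as [N [PN HN]].
    set (q := r + 1 + N).
    specialize (HN q ltac:(unfold q; lra)). apply Rabs_def2 in HN.
    assert (M : moving p_infty v q).
    { split; [unfold q; lra|]. split; [exact I|]. intros p Hp. apply Hv. lra. }
    pose proof (moving_increasing g p_infty u v r q F M ltac:(unfold q; lra)). lra.
Qed.

Lemma stalls_passes (g u0 u1 : R) (T : Rbar) (u v : R -> R) (x y : R) :
  complete_flow g u0 u1 T u v -> 0 < u1 -> stalls T u v x -> u0 <= y < x -> passes T u v y.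
Proof.
  intros CF Hu1 St Hy.
  destruct (stalls_approach g u0 u1 T u v x (x - y) CF Hu1 St ltac:(lra)) as [s [Hs [Hu _]]].
  destruct CF as [_ [I0 [_ [F _]]]].
  destruct (moving_passes g T u v s y F Hs) as [r [_ H]]; [lra|]. now exists r.
Qed.

Lemma passes_passes (g u0 u1 : R) (T : Rbar) (u v : R -> R) (y z : R) :
  complete_flow g u0 u1 T u v -> passes T u v y -> u0 <= z <= y -> passes T u v z.
Proof.
  intros [_ [I0 [_ [F _]]]] [s [Hs Es]] Hz.
  destruct (moving_passes g T u v s z F Hs) as [r [_ H]]; [lra|]. now exists r.
Qed.

Lemma stalls_not_passes (g u0 u1 : R) (T : Rbar) (u v : R -> R) (x y : R) :
  complete_flow g u0 u1 T u v -> 0 < u1 -> stalls T u v x -> passes T u v y -> y < x.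
Proof.
  intros CF Hu1 St [s [Hs <-]]. now apply (stalls_bound g u0 u1 T u v).
Qed.

Lemma stalls_energy (g u0 u1 : R) (T : Rbar) (u v : R -> R) (x eps : R) :
  complete_flow g u0 u1 T u v -> 0 < u1 -> stalls T u v x -> 0 < eps ->
  exists s, moving T v s /\ x - eps < u s < x /\
    Rabs (energy (u s) (v s) - energy x 0) < eps.
Proof.
  intros CF Hu1 St He.
  destruct (energy_near x 0 eps He) as [d [Hd H]].
  destruct (stalls_approach g u0 u1 T u v x (Rmin d eps) CF Hu1 St) as [s [Hs [Hu Hv]]].
  { now apply Rmin_glb_lt. }
  pose proof (Rmin_l d eps). pose proof (Rmin_r d eps).
  assert (0 < v s) by (apply Hs; split; [apply Hs|lra]).
  exists s. split; [exact Hs|]. split; [lra|]. apply H; apply Rabs_def1; lra.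
Qed.

(** The energy does not increase and comes arbitrarily close to [energy x 0] near the stall. For a
    saddle this means E >= 1/4 during the whole run. *)
Lemma stalls_energy_ge (g u0 u1 : R) (T : Rbar) (u v : R -> R) (x s : R) :
  complete_flow g u0 u1 T u v -> 0 < u1 -> 0 <= g -> stalls T u v x -> moving T v s ->
  energy x 0 <= energy (u s) (v s).
Proof.
  intros CF Hu1 Hg St Hs. apply Rnot_lt_le. intros L.
  assert (F : duffing_flow g T u v) by apply CF.
  pose proof (stalls_bound g u0 u1 T u v x s CF Hu1 St Hs) as Hlt.
  set (eps := Rmin (x - u s) (energy x 0 - energy (u s) (v s))).
  destruct (stalls_energy g u0 u1 T u v x eps CF Hu1 St) as [r [Hr [Hu HE]]].
  { apply Rmin_glb_lt; lra. }
  assert (eps <= x - u s) by apply Rmin_l.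
  assert (eps <= energy x 0 - energy (u s) (v s)) by apply Rmin_r.
  assert (Hsr : s < r) by (apply (moving_order g T u v s r F Hs Hr); lra).
  assert (E : energy (u r) (v r) <= energy (u s) (v s)).
  { apply (energy_nonincreasing g T); try assumption; [|apply Hr].
    assert (0 <= s) by apply Hs. lra. }
  apply Rabs_def2 in HE. lra.
Qed.

(* Barbalat's lemma. *)
Lemma derivative_tends_to_zero (u v dv : R -> R) (l K : R) :
  0 < K -> (forall t, 0 <= t -> is_derive u t (v t)) ->
  (forall t, 0 <= t -> is_derive v t (dv t)) -> (forall t, 0 <= t -> Rabs (dv t) <= K) ->
  (forall t, 0 <= t -> 0 < v t) -> is_lim u p_infty l -> is_lim v p_infty 0.
Proof.
  intros HK Du Dv Bd Vp Lu. apply is_lim_spec. intros eps. assert (He := cond_pos eps).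
  (* If v t >= eps, the bound [K] keeps v >= eps / 2 for a time [h], and u gains at least h eps / 2;
     two values within h eps / 4 of the limit differ by less. *)
  set (h := eps / (2 * K)).
  assert (Hh : 0 < h) by (apply Rdiv_lt_0_compat; lra).
  destruct (is_lim_p_infty_eps u l (h * eps / 4) Lu) as [N [HN H]]; [nra|].
  exists N. intros t Ht. rewrite Rminus_0_r, Rabs_pos_eq by (apply Rlt_le, Vp; lra).
  apply Rnot_le_lt. intros L.
  assert (Vh : forall r, t <= r <= t + h -> eps / 2 <= v r).
  { intros r Hr. destruct (Req_dec r t) as [->|Hne]; [lra|].
    destruct (mvt_open v dv t r) as [c [Hc E]]; [lra|intros; apply Dv; lra| |].
    - intros q Hq. eapply is_derive_continuous, Dv. lra.
    - specialize (Bd c ltac:(lra)). apply Rabs_le_between in Bd.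
      assert (K * h = eps / 2) by (unfold h; field; lra). nra. }
  destruct (mvt_open u v t (t + h)) as [c [Hc E]]; [lra|intros; apply Du; lra| |].
  - intros q Hq. eapply is_derive_continuous, Du. lra.
  - specialize (Vh c ltac:(lra)). pose proof (H t Ht) as A. pose proof (H (t + h) ltac:(lra)) as B.
    apply Rabs_def2 in A. apply Rabs_def2 in B. nra.
Qed.

Lemma increasing_bounded_lim (u : R -> R) (b : R) :
  (forall s t, 0 <= s < t -> u s < u t) -> (forall t, 0 <= t -> u t <= b) ->
  exists l : R, is_lim u p_infty l /\ l <= b /\ forall t, 0 <= t -> u t <= l.
Proof.
  intros Hi Hb.
  destruct (completeness (fun y => exists t, 0 <= t /\ u t = y)) as [l [Hub Hlub]].
  - exists b. intros y [t [Ht <-]]. now apply Hb.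
  - exists (u 0), 0. split; [lra|reflexivity].
  - exists l. assert (Hl : forall t, 0 <= t -> u t <= l).
    { intros t Ht. apply Hub. now exists t. }
    split; [|split; [|exact Hl]].
    + apply is_lim_spec. intros eps. assert (He := cond_pos eps).
      destruct (classic (exists t, 0 <= t /\ l - eps < u t)) as [[t0 [Ht0 H0]]|Hn].
      * exists t0. intros t Ht. specialize (Hi t0 t ltac:(lra)). specialize (Hl t ltac:(lra)).
        apply Rabs_def1; lra.
      * exfalso. assert (l <= l - eps); [|lra]. apply Hlub. intros y [t [Ht <-]].
        apply Rnot_lt_le. intros L. apply Hn. now exists t.
    + apply Hlub. intros y [t [Ht <-]]. now apply Hb.
Qed.

(** If the run never reaches 1, either v has a first zero, which is an attained stall, or v > 0
    throughout. In the latter case u and v stay bounded, the solution is global, u converges by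
    monotonicity and v tends to 0 by Barbalat's lemma. *)
Lemma passes_or_stalls (g u0 u1 : R) (T : Rbar) (u v : R -> R) :
  complete_flow g u0 u1 T u v -> 0 <= g -> u0 < 1 -> 0 < u1 ->
  passes T u v 1 \/ exists x, u0 < x <= 1 /\ stalls T u v x.
Proof.
  intros CF Hg Hu0 Hu1. assert (CF' := CF). destruct CF' as [HT [I0 [I1 [F Ext]]]].
  assert (M0 : moving T v 0).
  { split; [lra|]. split; [exact HT|]. intros t Ht. replace t with 0 by lra. lra. }
  destruct (classic (exists s, moving T v s /\ 1 <= u s)) as [[s [Hs Hu]]|Hn].
  { left. destruct (moving_passes g T u v s 1 F Hs) as [r [_ Hr]]; [lra|]. now exists r. }
  right.
  assert (Below : forall s, moving T v s -> u s < 1).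
  { intros s Hs. apply Rnot_le_lt. intros L. apply Hn. now exists s. }
  destruct (classic (exists s : R, 0 <= s /\ Rbar_lt s T /\ v s <= 0)) as [[b [Hb [HbT Hv]]]|Hpos].
  - destruct (first_zero v 0 b) as [s [Hs [Es Hlt]]]; try lra.
    { intros t Ht. now apply (duffing_flow_continuous g T u v b F HbT). }
    assert (HsT : Rbar_lt s T) by (apply Rbar_lt_le_trans_R with b; [lra|exact HbT]).
    exists (u s). split; [split|].
    + rewrite <- I0. apply (duffing_flow_increasing g T u v); [exact F|lra|exact HsT|].
      intros r Hr. apply Hlt. lra.
    + apply Rnot_lt_le. intros L.
      destruct (continuous_eps u s (u s - 1)) as [d [Hd H]]; [|lra|].
      { now apply (duffing_flow_continuous g T u v s F HsT); try lra. }
      set (t := Rmax (s / 2) (s - d / 2)).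
      assert (T1 : s / 2 <= t) by apply Rmax_l.
      assert (T2 : s - d / 2 <= t) by apply Rmax_r.
      assert (T3 : t < s) by (apply Rmax_lub_lt; lra).
      specialize (H t ltac:(apply Rabs_def1; lra)). apply Rabs_def2 in H.
      assert (u t < 1); [|lra]. apply Below. split; [lra|]. split.
      * apply Rbar_lt_le_trans_R with s; [lra|exact HsT].
      * intros r Hr. apply Hlt. lra.
    + left. exists s. repeat split; try assumption; lra.
  - assert (Vp : forall t : R, 0 <= t -> Rbar_lt t T -> 0 < v t).
    { intros t Ht HtT. apply Rnot_le_lt. intros L. apply Hpos. now exists t. }
    assert (Mv : forall t : R, 0 <= t -> Rbar_lt t T -> moving T v t).
    { intros t Ht HtT. split; [exact Ht|]. split; [exact HtT|]. intros r Hr.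
      apply Vp; [lra|]. apply Rbar_lt_le_trans_R with t; [lra|exact HtT]. }
    set (e := energy u0 u1). set (r0 := 1 + Rabs u0).
    assert (Ub : forall t : R, 0 <= t -> Rbar_lt t T -> Rabs (u t) <= r0).
    { intros t Ht HtT. specialize (Below t (Mv t Ht HtT)).
      pose proof (Rle_abs (- u0)) as A. rewrite Rabs_Ropp in A.
      assert (u0 <= u t).
      { destruct (Req_dec t 0) as [->|]; [lra|]. rewrite <- I0.
        apply Rlt_le, (moving_increasing g T u v 0 t F (Mv t Ht HtT)). lra. }
      pose proof (Rabs_pos u0). apply Rabs_le. unfold r0. lra. }
    set (r1 := 2 * Rabs e + r0 ^ 4 + 1).
    assert (Vb : forall t : R, 0 <= t -> Rbar_lt t T -> Rabs (v t) <= r1).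
    { intros t Ht HtT. apply (energy_velocity_bound (u t)); [|now apply Ub].
      unfold e. rewrite <- I0, <- I1. apply (energy_nonincreasing g T); try assumption; lra. }
    assert (Hr0 : 1 <= r0) by (unfold r0; pose proof (Rabs_pos u0); lra).
    assert (Hr1 : 0 <= r1).
    { eapply Rle_trans; [apply Rabs_pos|apply (Vb 0); [lra|exact HT]]. }
    assert (ET : T = p_infty).
    { apply (Ext (r0 + r1)). intros t Ht HtT. specialize (Ub t Ht HtT). specialize (Vb t Ht HtT). lra. }
    subst T.
    assert (Inc : forall s t, 0 <= s < t -> u s < u t).
    { intros s t Hst. apply (moving_increasing g p_infty u v s t F); [|exact Hst].
      apply Mv; [lra|exact I]. }
    destruct (increasing_bounded_lim u 1 Inc) as [x [Lx [Hx Hle]]].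
    { intros t Ht. apply Rlt_le, Below, Mv; [exact Ht|exact I]. }
    exists x. split; [split; [|exact Hx]|].
    + pose proof (Inc 0 1 ltac:(lra)). specialize (Hle 1 ltac:(lra)). lra.
    + right. split; [reflexivity|]. split; [intros t Ht; now apply Vp|]. split; [exact Lx|].
      apply (derivative_tends_to_zero u v (fun t => u t ^ 3 - u t - g * v t) x
        (r0 ^ 3 + r0 + g * r1 + 1)).
      * assert (0 <= r0 ^ 3) by (apply pow_le; lra). assert (0 <= g * r1) by nra. lra.
      * intros t Ht. now apply F.
      * intros t Ht. now apply F.
      * intros t Ht. specialize (Ub t Ht I). specialize (Vb t Ht I).
        replace (u t ^ 3 - u t - g * v t) with (u t ^ 3 + - (u t + g * v t)) by ring.
        eapply Rle_trans; [apply Rabs_triang|]. rewrite Rabs_Ropp, <- RPow_abs.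
        pose proof (Rabs_triang (u t) (g * v t)) as Tr. rewrite Rabs_mult in Tr.
        rewrite (Rabs_pos_eq g Hg) in Tr.
        assert (Rabs (u t) ^ 3 <= r0 ^ 3) by (apply pow_incr; split; [apply Rabs_pos|exact Ub]).
        assert (g * Rabs (v t) <= g * r1) by (apply Rmult_le_compat_l; assumption). lra.
      * intros t Ht. now apply Vp.
      * exact Lx.
Qed.

(** * Comparison of two dampings at equal positions *)

Lemma increasing_inverse (u v : R -> R) (b : R) :
  0 <= b -> (forall t, 0 <= t <= b -> is_derive u t (v t) /\ continuous v t /\ 0 < v t) ->
  exists tau : R -> R,
    (forall x, u 0 <= x <= u b -> 0 <= tau x <= b /\ u (tau x) = x) /\
    (forall x, continuous tau x) /\
    (forall x, u 0 < x < u b -> is_derive tau x (/ v (tau x))).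
Proof.
  intros Hb H.
  assert (Cu : forall t, 0 <= t <= b -> continuous u t).
  { intros t Ht. eapply is_derive_continuous, (H t Ht). }
  destruct (continuous_pos_min v 0 b Hb) as [m [Hm Vm]]; [intros; now apply H|intros; now apply H|].
  assert (mv : forall s t, 0 <= s <= b -> 0 <= t <= b -> s <> t ->
    exists c, 0 <= c <= b /\ Rabs (c - s) <= Rabs (t - s) /\ u t - u s = v c * (t - s)).
  { intros s t Hs Ht Hne. destruct (Rlt_dec s t) as [L|L].
    - destruct (mvt_open u v s t L) as [c [Hc E]].
      + intros r Hr. apply H. lra.
      + intros r Hr. apply Cu. lra.
      + exists c. split; [lra|]. split; [rewrite !Rabs_pos_eq; lra|exact E].
    - destruct (mvt_open u v t s) as [c [Hc E]]; [lra| | |].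
      + intros r Hr. apply H. lra.
      + intros r Hr. apply Cu. lra.
      + exists c. split; [lra|]. split; [|lra].
        rewrite (Rabs_minus_sym c), (Rabs_minus_sym t), !Rabs_pos_eq; lra. }
  assert (Hub : u 0 <= u b).
  { destruct (Req_dec 0 b) as [<-|Hne]; [lra|].
    destruct (mv 0 b) as [c [Hc [_ E]]]; try lra. specialize (Vm c Hc). nra. }
  (* Clamping positions to the range of [u] defines the inverse on the whole line, Lipschitz with
     constant 1 / m, hence continuous at the end points of the range too. *)
  set (cl := fun x => Rmax (u 0) (Rmin (u b) x)).
  assert (Hcl : forall x, u 0 <= cl x <= u b).
  { intros x. unfold cl. split; [apply Rmax_l|]. apply Rmax_lub; [exact Hub|apply Rmin_l]. }
  assert (Lcl : forall x y, Rabs (cl x - cl y) <= Rabs (x - y)).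
  { intros x y. unfold cl, Rmax, Rmin, Rabs.
    repeat destruct Rle_dec; repeat destruct Rcase_abs; lra. }
  assert (Icl : forall x, u 0 <= x <= u b -> cl x = x).
  { intros x Hx. unfold cl, Rmax, Rmin. repeat destruct Rle_dec; lra. }
  set (tau := fun x => epsilon (inhabits 0) (fun s => 0 <= s <= b /\ u s = cl x)).
  assert (Ht : forall x, 0 <= tau x <= b /\ u (tau x) = cl x).
  { intros x. apply (epsilon_spec (inhabits 0) (fun s => 0 <= s <= b /\ u s = cl x)).
    now apply (ivt_le u 0 b). }
  assert (Ltau : forall x y, m * Rabs (tau x - tau y) <= Rabs (x - y)).
  { intros x y. destruct (Ht x) as [Hx Ex]. destruct (Ht y) as [Hy Ey].
    eapply Rle_trans; [|apply Lcl]. rewrite <- Ex, <- Ey.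
    destruct (Req_dec (tau y) (tau x)) as [E|Hne].
    - rewrite E, !Rminus_diag, Rabs_R0. lra.
    - destruct (mv (tau y) (tau x) Hy Hx Hne) as [c [Hc [_ E]]]. rewrite E, Rabs_mult.
      specialize (Vm c Hc). rewrite (Rabs_pos_eq (v c)) by lra.
      apply Rmult_le_compat_r; [apply Rabs_pos|exact Vm]. }
  exists tau. split; [|split].
  - intros x Hx. destruct (Ht x) as [H1 H2]. now rewrite (Icl x Hx) in H2.
  - intros x. apply (lipschitz_continuous (/ m)). intros y z. specialize (Ltau y z).
    apply (Rmult_le_compat_l (/ m)) in Ltau; [|apply Rlt_le, Rinv_0_lt_compat, Hm].
    rewrite <- Rmult_assoc, Rinv_l, Rmult_1_l in Ltau by lra. exact Ltau.
  - intros x Hx. apply is_derive_Reals. intros eps He.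
    destruct (Ht x) as [Hs Es]. set (s := tau x) in *.
    destruct (H s Hs) as [_ [Cv Vs]].
    assert (Ci : continuous (fun r => / v r) s).
    { apply (continuous_comp v Rinv); [exact Cv|]. apply continuous_Rinv. lra. }
    destruct (continuous_eps _ s eps Ci He) as [d [Hd Hd']].
    assert (Hp : 0 < Rmin (m * d) (Rmin (x - u 0) (u b - x))).
    { repeat apply Rmin_glb_lt; nra. }
    exists (mkposreal _ Hp). intros h Hh Hlt. simpl in Hlt.
    assert (L1 : Rabs h < m * d) by (eapply Rlt_le_trans; [exact Hlt|apply Rmin_l]).
    assert (L2 : Rabs h < x - u 0).
    { eapply Rlt_le_trans; [exact Hlt|eapply Rle_trans; [apply Rmin_r|apply Rmin_l]]. }
    assert (L3 : Rabs h < u b - x).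
    { eapply Rlt_le_trans; [exact Hlt|eapply Rle_trans; [apply Rmin_r|apply Rmin_r]]. }
    apply Rabs_def2 in L2. apply Rabs_def2 in L3.
    destruct (Ht (x + h)) as [Hr Er]. rewrite Icl in Er by lra. rewrite Icl in Es by lra.
    set (r := tau (x + h)) in *.
    assert (Hne : s <> r) by (intros E; rewrite E in Es; lra).
    destruct (mv s r Hs Hr Hne) as [c [Hc [Hcs E]]].
    assert (Hrs : m * Rabs (r - s) <= Rabs h).
    { unfold r, s. eapply Rle_trans; [apply Ltau|]. right. f_equal. ring. }
    assert (Hcd : Rabs (c - s) < d).
    { apply Rmult_lt_reg_l with m; [exact Hm|]. nra. }
    specialize (Hd' c Hcd). simpl in Hd'.
    specialize (Vm c Hc).
    replace ((r - s) / h) with (/ v c); [exact Hd'|].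
    assert (Eh : h = v c * (r - s)) by lra. rewrite Eh. field. lra.
Qed.

(* Comparison in the phase plane.  Viewing the velocities as functions [V], [Q] of the position,
   [(V - Q)' = (g' - g) + (x - x^3) / (V Q) * (V - Q)]; the time of the second flow is used as
   the parameter. *)
Lemma velocity_comparison (g g' u0 u1 : R) (T T' : Rbar) (u v p q : R -> R) (s1 t1 : R) :
  complete_flow g u0 u1 T u v -> complete_flow g' u0 u1 T' p q -> g < g' ->
  moving T v s1 -> moving T' q t1 -> u s1 = p t1 ->
  (0 < t1 -> q t1 < v s1) /\
  (forall s0 t0, 0 <= s0 <= s1 -> 0 <= t0 <= t1 -> u s0 = p t0 ->
     (forall t, t0 <= t <= t1 -> 0 <= p t - p t ^ 3) -> v s0 - q t0 <= v s1 - q t1).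
Proof.
  intros [_ [I0 [I1 [F _]]]] [_ [J0 [J1 [F' _]]]] Hg Ms Mt E1.
  assert (Ms' := Ms). destruct Ms' as [Hs1 [Hs1T Vp]].
  assert (Mt' := Mt). destruct Mt' as [Ht1 [Ht1T Qp]].
  assert (Lt : forall r, 0 <= r <= s1 -> Rbar_lt r T).
  { intros r Hr. apply Rbar_lt_le_trans_R with s1; [lra|exact Hs1T]. }
  assert (Lt' : forall r, 0 <= r <= t1 -> Rbar_lt r T').
  { intros r Hr. apply Rbar_lt_le_trans_R with t1; [lra|exact Ht1T]. }
  pose proof (duffing_flow_continuous g T u v s1 F Hs1T) as C.
  pose proof (duffing_flow_continuous g' T' p q t1 F' Ht1T) as C'.
  assert (Inj : forall r s, 0 <= r <= s1 -> 0 <= s <= s1 -> u r = u s -> r = s).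
  { intros r s Hr Hs E. destruct (Rtotal_order r s) as [L|[L|L]]; [|exact L|].
    - pose proof (moving_increasing g T u v r s F (moving_sub _ _ _ _ Ms Hs) ltac:(lra)). lra.
    - pose proof (moving_increasing g T u v s r F (moving_sub _ _ _ _ Ms Hr) ltac:(lra)). lra. }
  assert (Pinc : forall r t, 0 <= r < t -> t <= t1 -> p r < p t).
  { intros r t Hr Ht. apply (moving_increasing g' T' p q r t F'); [|exact Hr].
    apply moving_sub with t1; [exact Mt|lra]. }
  assert (Pin : forall t, 0 <= t <= t1 -> u 0 <= p t <= u s1).
  { intros t Ht. split.
    - destruct (Req_dec t 0) as [->|]; [lra|]. pose proof (Pinc 0 t ltac:(lra) ltac:(lra)). lra.
    - destruct (Req_dec t t1) as [->|]; [lra|]. pose proof (Pinc t t1 ltac:(lra) ltac:(lra)). lra. }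
  destruct (increasing_inverse u v s1 Hs1) as [tau [Htau [Ctau Dtau]]].
  { intros t Ht. destruct (F t ltac:(lra) (Lt t Ht)) as [Du _].
    destruct (C t Ht) as [_ Cv]. split; [exact Du|]. split; [exact Cv|now apply Vp]. }
  (* [sg t] is the time at which the first flow is where the second one is at time t, so [w] below
     is the velocity gap at a common position. *)
  set (sg := fun t => tau (p t)).
  assert (Hsg : forall t, 0 <= t <= t1 -> 0 <= sg t <= s1 /\ u (sg t) = p t).
  { intros t Ht. apply Htau, Pin, Ht. }
  assert (Sg : forall s t, 0 <= s <= s1 -> 0 <= t <= t1 -> u s = p t -> sg t = s).
  { intros s t Hs Ht E. destruct (Hsg t Ht) as [H1 H2]. apply Inj; [exact H1|exact Hs|lra]. }
  set (w := fun t => v (sg t) - q t).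
  set (h := fun t => (p t - p t ^ 3) / v (sg t)).
  set (dw := fun t => h t * w t + (g' - g) * q t).
  assert (Cw : forall t, 0 <= t <= t1 -> continuous w t).
  { intros t Ht. destruct (Hsg t Ht) as [H1 H2]. destruct (C' t Ht) as [Cp Cq].
    apply (continuous_minus (fun t => v (sg t)) q); [|exact Cq].
    apply (continuous_comp sg v); [|now apply C].
    apply (continuous_comp p tau); [exact Cp|apply Ctau]. }
  assert (Dw : forall t, 0 < t < t1 -> is_derive w t (dw t)).
  { intros t Ht. destruct (Hsg t ltac:(lra)) as [H1 H2].
    destruct (F' t ltac:(lra) (Lt' t ltac:(lra))) as [Dp Dq].
    destruct (F (sg t) ltac:(lra) (Lt _ H1)) as [_ Dv].
    assert (Dt : is_derive tau (p t) (/ v (sg t))).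
    { apply Dtau. pose proof (Pinc 0 t ltac:(lra) ltac:(lra)).
      pose proof (Pinc t t1 ltac:(lra) ltac:(lra)). lra. }
    assert (Dsg : is_derive sg t (q t * / v (sg t))).
    { apply (is_derive_comp tau p t (/ v (sg t)) (q t)); assumption. }
    assert (Dvs : is_derive (fun t => v (sg t)) t
      (q t * / v (sg t) * (u (sg t) ^ 3 - u (sg t) - g * v (sg t)))).
    { apply (is_derive_comp v sg t _ (q t * / v (sg t))); assumption. }
    replace (dw t) with (q t * / v (sg t) * (u (sg t) ^ 3 - u (sg t) - g * v (sg t))
      - (p t ^ 3 - p t - g' * q t)).
    - apply (is_derive_minus (fun t => v (sg t)) q); assumption.
    - unfold dw, h, w. rewrite H2. field. apply Rgt_not_eq, Vp, H1. }
  assert (W0 : w 0 = 0).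
  { unfold w. rewrite (Sg 0 0) by lra. lra. }
  assert (W1 : w t1 = v s1 - q t1).
  { unfold w. rewrite (Sg s1 t1) by lra. reflexivity. }
  destruct (continuous_pos_min v 0 s1 Hs1) as [m [Hm Vm]]; [intros; now apply C|exact Vp|].
  destruct (continuous_bounded (fun t => p t - p t ^ 3) 0 t1 Ht1) as [P [HP BP]].
  { intros t Ht. destruct (F' t ltac:(lra) (Lt' t Ht)) as [Dp _].
    apply (ex_derive_continuous (fun t => p t - p t ^ 3)). auto_derive.
    repeat split; eexists; eassumption. }
  set (H := P / m). assert (HH : 0 < H) by (apply Rdiv_lt_0_compat; lra).
  assert (Bh : forall t, 0 <= t <= t1 -> - H <= h t <= H).
  { intros t Ht. destruct (Hsg t Ht) as [H1 _]. specialize (Vm _ H1). specialize (BP t Ht).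
    simpl in BP. apply Rabs_le_between. unfold h, Rdiv. rewrite Rabs_mult, Rabs_inv.
    rewrite (Rabs_pos_eq (v (sg t))) by lra. unfold H, Rdiv.
    apply Rmult_le_compat; [apply Rabs_pos| |exact BP|].
    - apply Rlt_le, Rinv_0_lt_compat. lra.
    - apply Rinv_le_contravar; [exact Hm|exact Vm]. }
  assert (Cexp : forall k t, continuous (fun t => exp (k * t)) t).
  { intros k t. apply (ex_derive_continuous (fun t => exp (k * t))). auto_derive. exact I. }
  assert (Dexp : forall k t, 0 < t < t1 -> is_derive (fun t => w t * exp (k * t)) t
    ((dw t + k * w t) * exp (k * t))).
  { intros k t Ht. pose proof (Dw t Ht). derive_atoms. ring. }
  (* With |h| <= H, the weight exp(- H t) makes the linear term push a negative w upwards, so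
     [barrier] applies. Once w >= 0 is known, the opposite weight exp(H t) lets the positive source
     (g' - g) q give strictness. *)
  assert (Wnn : forall t, 0 <= t <= t1 -> 0 <= w t).
  { intros t Ht. cut (0 <= w t * exp (- H * t)).
    { intros A. pose proof (exp_pos (- H * t)). nra. }
    apply (barrier (fun t => w t * exp (- H * t)) (fun t => (dw t + - H * w t) * exp (- H * t)) 0 t);
      [lra| | | |].
    - intros r Hr. apply Dexp. lra.
    - intros r Hr. apply (continuous_mult w (fun t => exp (- H * t))); [apply Cw; lra|apply Cexp].
    - rewrite W0. lra.
    - intros r Hr Hneg. pose proof (exp_pos (- H * r)).
      apply Rmult_le_pos; [|lra]. assert (w r < 0) by nra.
      specialize (Bh r ltac:(lra)). specialize (Qp r ltac:(lra)). unfold dw.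
      assert (0 <= (h r - H) * w r) by nra. nra. }
  split.
  - intros Hpos.
    assert (A : w 0 * exp (H * 0) < w t1 * exp (H * t1)).
    { apply (derive_pos_lt (fun t => w t * exp (H * t)) (fun t => (dw t + H * w t) * exp (H * t)));
        [exact Hpos| | |].
      - intros r Hr. now apply Dexp.
      - intros r Hr. apply (continuous_mult w (fun t => exp (H * t))); [now apply Cw|apply Cexp].
      - intros r Hr. apply Rmult_lt_0_compat; [|apply exp_pos].
        specialize (Bh r ltac:(lra)). specialize (Qp r ltac:(lra)). specialize (Wnn r ltac:(lra)).
        unfold dw. assert (0 <= (h r + H) * w r) by nra. nra. }
    rewrite W0, W1, Rmult_0_l in A. pose proof (exp_pos (H * t1)). nra.
  (* Here h >= 0 as well, so w' >= 0 without any weight and the gap itself is monotone. *)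
  - intros s0 t0 Hs0 Ht0 E0 Hsgn. rewrite <- W1.
    replace (v s0 - q t0) with (w t0) by (unfold w; rewrite (Sg s0 t0) by assumption; reflexivity).
    apply (derive_nonneg_le w dw); [lra| | |].
    + intros r Hr. apply Dw. lra.
    + intros r Hr. apply Cw. lra.
    + intros r Hr. specialize (Hsgn r ltac:(lra)). specialize (Wnn r ltac:(lra)).
      specialize (Qp r ltac:(lra)). destruct (Hsg r ltac:(lra)) as [H1 _].
      assert (0 <= h r) by (apply Rdiv_le_0_compat; [exact Hsgn|now apply Vp]).
      unfold dw. assert (0 <= h r * w r) by nra. nra.
Qed.

(** After the start, the less damped motion is strictly faster at every common position. The more
    damped one would reach [x] with velocity at least some m > 0, whereas the less damped one drops
    below m just before [x]. *)
Lemma stall_order (g g' u0 u1 : R) (T T' : Rbar) (u v p q : R -> R) (x : R) :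
  complete_flow g u0 u1 T u v -> complete_flow g' u0 u1 T' p q -> g < g' -> 0 < u1 -> u0 < x ->
  stalls T u v x -> passes T' p q x -> False.
Proof.
  intros CF CF' Hg Hu1 Hx St [t1 [Mt Et]].
  assert (F' : duffing_flow g' T' p q) by apply CF'.
  assert (J0 : p 0 = u0) by apply CF'.
  assert (Mt' := Mt). destruct Mt' as [Ht1 [Ht1T Qp]].
  destruct (continuous_pos_min q 0 t1 Ht1) as [m [Hm Qm]]; [|exact Qp|].
  { intros t Ht. now apply (duffing_flow_continuous g' T' p q t1 F' Ht1T). }
  destruct (stalls_approach g u0 u1 T u v x (Rmin m (x - u0)) CF Hu1 St) as [s [Ms [Hu Hv]]].
  { apply Rmin_glb_lt; lra. }
  pose proof (Rmin_l m (x - u0)). pose proof (Rmin_r m (x - u0)).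
  destruct (moving_passes g' T' p q t1 (u s) F' Mt) as [t [Ht [Mt' Es]]]; [lra|].
  assert (0 < t) by (destruct (Req_dec t 0) as [E|]; [subst t; lra|lra]).
  destruct (velocity_comparison g g' u0 u1 T T' u v p q s t CF CF' Hg Ms Mt') as [A _]; [lra|].
  specialize (A ltac:(assumption)). specialize (Qm t Ht). lra.
Qed.

(** Just left of a saddle u - u^3 >= 0, so the velocity gap, positive by comparison, does not shrink
    on the way to [a]. But it is smaller than the velocity of the less damped motion, which becomes
    arbitrarily small there. *)
Lemma stall_order_saddle (g g' u0 u1 a : R) (T T' : Rbar) (u v p q : R -> R) :
  complete_flow g u0 u1 T u v -> complete_flow g' u0 u1 T' p q -> g < g' -> 0 < u1 -> u0 < a ->
  a = 1 \/ a = -1 -> stalls T u v a -> stalls T' p q a -> False.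
Proof.
  intros CF CF' Hg Hu1 Hx Ha St St'.
  assert (F : duffing_flow g T u v) by apply CF.
  assert (F' : duffing_flow g' T' p q) by apply CF'.
  assert (J0 : p 0 = u0) by apply CF'.
  (* Left of -1 the sign holds everywhere; left of 1 the abscissa must be nonnegative, hence the
     maximum of [u0] and 0. *)
  assert (exists y, u0 < y < a /\ forall z, y <= z <= a -> 0 <= z - z ^ 3) as [y [Hy Sgn]].
  { destruct Ha as [->| ->].
    - exists ((Rmax u0 0 + 1) / 2). pose proof (Rmax_l u0 0). pose proof (Rmax_r u0 0).
      assert (Rmax u0 0 < 1) by (apply Rmax_lub_lt; lra). split; [lra|]. intros z Hz.
      replace (z - z ^ 3) with (z * ((1 - z) * (1 + z))) by ring.
      repeat apply Rmult_le_pos; lra.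
    - exists ((u0 - 1) / 2). split; [lra|]. intros z Hz.
      replace (z - z ^ 3) with (- z * ((- z - 1) * (- z + 1))) by ring.
      repeat apply Rmult_le_pos; lra. }
  destruct (stalls_passes g u0 u1 T u v a y CF Hu1 St) as [s0 [Ms0 Es0]]; [lra|].
  destruct (stalls_passes g' u0 u1 T' p q a y CF' Hu1 St') as [t0 [Mt0 Et0]]; [lra|].
  assert (H0 : 0 <= t0) by apply Mt0. assert (H0' : 0 <= s0) by apply Ms0.
  assert (Ht0 : 0 < t0) by (destruct (Req_dec t0 0) as [E|]; [subst t0; lra|lra]).
  destruct (velocity_comparison g g' u0 u1 T T' u v p q s0 t0 CF CF' Hg Ms0 Mt0) as [A _]; [lra|].
  specialize (A Ht0).
  set (d := v s0 - q t0) in *. assert (Hd : 0 < d) by (unfold d; lra).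
  destruct (stalls_approach g u0 u1 T u v a (Rmin d (a - y)) CF Hu1 St) as [s1 [Ms1 [Hu Hv]]].
  { apply Rmin_glb_lt; lra. }
  pose proof (Rmin_l d (a - y)). pose proof (Rmin_r d (a - y)).
  destruct (stalls_passes g' u0 u1 T' p q a (u s1) CF' Hu1 St') as [t1 [Mt1 Et1]]; [lra|].
  assert (Hs01 : s0 < s1) by (apply (moving_order g T u v s0 s1 F Ms0 Ms1); lra).
  assert (Ht01 : t0 < t1) by (apply (moving_order g' T' p q t0 t1 F' Mt0 Mt1); lra).
  destruct (velocity_comparison g g' u0 u1 T T' u v p q s1 t1 CF CF' Hg Ms1 Mt1) as [_ B]; [lra|].
  specialize (B s0 t0 ltac:(lra) ltac:(lra) ltac:(lra)).
  assert (0 < q t1) by (apply Mt1; lra).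
  assert (v s0 - q t0 <= v s1 - q t1); [|unfold d in *; lra].
  apply B. intros t Ht. apply Sgn. split.
  - destruct (Req_dec t t0) as [->|]; [lra|].
    pose proof (moving_increasing g' T' p q t0 t F' (moving_sub T' q t1 t Mt1 ltac:(lra))
      ltac:(lra)). lra.
  - destruct (Req_dec t t1) as [->|]; [lra|].
    pose proof (moving_increasing g' T' p q t t1 F' Mt1 ltac:(lra)). lra.
Qed.

(** * Stability of the behaviours under a change of damping *)

Lemma passes_open (g u0 u1 : R) (T : Rbar) (u v : R -> R) (y : R) :
  complete_flow g u0 u1 T u v -> passes T u v y ->
  exists d, 0 < d /\ forall g' T' u' v', Rabs (g' - g) < d -> complete_flow g' u0 u1 T' u' v' ->
    passes T' u' v' y.
Proof.
  intros CF [s [Ms Es]]. assert (F : duffing_flow g T u v) by apply CF.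
  assert (I0 : u 0 = u0) by apply CF.
  assert (Ms' := Ms). destruct Ms' as [Hs [HsT Vp]].
  (* Running slightly past [y] replaces equality by y < u s', which survives a small change of
     damping together with v >= m > 0. *)
  assert (exists s', s < s' /\ moving T v s') as [s' [Hs' Ms']].
  { destruct (duffing_flow_continuous g T u v s F HsT s ltac:(lra)) as [_ Cv].
    destruct (continuous_eps v s (v s) Cv (Vp s ltac:(lra))) as [d [Hd H]].
    destruct (Rbar_lt_open s T HsT) as [r [Hr HrT]].
    set (s' := s + Rmin d r / 2). pose proof (Rmin_l d r). pose proof (Rmin_r d r).
    assert (0 < Rmin d r) by (apply Rmin_glb_lt; lra).
    exists s'. unfold s'. split; [lra|]. split; [lra|]. split; [apply HrT; lra|].
    intros t Ht. destruct (Rle_dec t s) as [L|L]; [apply Vp; lra|].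
    specialize (H t ltac:(apply Rabs_def1; lra)). apply Rabs_def2 in H. lra. }
  assert (Huy : y < u s') by (rewrite <- Es; apply (moving_increasing g T u v s s' F Ms'); lra).
  assert (Hy0 : u0 <= y).
  { destruct (Req_dec s 0) as [->|]; [lra|].
    pose proof (moving_increasing g T u v 0 s F Ms ltac:(lra)). lra. }
  assert (Ms'' := Ms'). destruct Ms'' as [H0 [HsT' Vp']].
  destruct (continuous_pos_min v 0 s' H0) as [m [Hm Vm]]; [|exact Vp'|].
  { intros t Ht. now apply (duffing_flow_continuous g T u v s' F HsT'). }
  destruct (complete_flow_near g u0 u1 T u v s' (Rmin m (u s' - y)) CF H0 HsT') as [d [Hd H]].
  { apply Rmin_glb_lt; lra. }
  pose proof (Rmin_l m (u s' - y)). pose proof (Rmin_r m (u s' - y)).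
  exists d. split; [exact Hd|]. intros g' T' u' v' Hg CF'.
  destruct (H g' T' u' v' Hg CF') as [L N].
  assert (M' : moving T' v' s').
  { split; [exact H0|]. split; [exact L|]. intros t Ht. destruct (N t Ht) as [_ N2].
    apply Rabs_def2 in N2. specialize (Vm t Ht). lra. }
  destruct (N s' ltac:(lra)) as [N1 _]. apply Rabs_def2 in N1.
  destruct CF' as [_ [I0' [_ [F' _]]]].
  destruct (moving_passes g' T' u' v' s' y F' M') as [r [_ Hr]]; [lra|]. now exists r.
Qed.

(** Where a neighbouring damping stalls is not controlled. What survives is one moment, with the
    position still left of [x], at which little energy is left above that of the stall. *)
Lemma stalls_near (g u0 u1 : R) (T : Rbar) (u v : R -> R) (x eps : R) :
  complete_flow g u0 u1 T u v -> 0 < u1 -> stalls T u v x -> 0 < eps ->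
  exists d, 0 < d /\ forall g' T' u' v', Rabs (g' - g) < d -> complete_flow g' u0 u1 T' u' v' ->
    exists s, moving T' v' s /\ u' s < x /\ energy (u' s) (v' s) < energy x 0 + eps.
Proof.
  intros CF Hu1 St He. assert (F : duffing_flow g T u v) by apply CF.
  destruct (stalls_energy g u0 u1 T u v x (eps / 2) CF Hu1 St ltac:(lra)) as [s [Ms [Hu HE]]].
  assert (Ms' := Ms). destruct Ms' as [H0 [HsT Vp]].
  destruct (continuous_pos_min v 0 s H0) as [m [Hm Vm]]; [|exact Vp|].
  { intros t Ht. now apply (duffing_flow_continuous g T u v s F HsT). }
  destruct (energy_near (u s) (v s) (eps / 2) ltac:(lra)) as [k [Hk Kn]].
  set (e := Rmin k (Rmin m (x - u s))).
  assert (E1 : e <= k) by apply Rmin_l.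
  assert (E2 : e <= m) by (eapply Rle_trans; [apply Rmin_r|apply Rmin_l]).
  assert (E3 : e <= x - u s) by (eapply Rle_trans; [apply Rmin_r|apply Rmin_r]).
  destruct (complete_flow_near g u0 u1 T u v s e CF H0 HsT) as [d [Hd H]].
  { repeat apply Rmin_glb_lt; lra. }
  exists d. split; [exact Hd|]. intros g' T' u' v' Hg CF'.
  destruct (H g' T' u' v' Hg CF') as [L N].
  exists s. destruct (N s ltac:(lra)) as [N1 N2].
  specialize (Kn (u' s) (v' s) ltac:(lra) ltac:(lra)).
  apply Rabs_def2 in Kn. apply Rabs_def2 in HE. apply Rabs_def2 in N1.
  split; [|lra]. split; [exact H0|]. split; [exact L|]. intros t Ht. destruct (N t Ht) as [_ N3].
  apply Rabs_def2 in N3. specialize (Vm t Ht). lra.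
Qed.

(** Off the saddles the stall has energy below 1/4, so neighbouring motions fall below 1/4 while
    still left of [x], and any moment with E >= 1/4 comes earlier. In this form stalling off the
    saddles is an open condition. *)
Lemma stalls_low_near (g u0 u1 : R) (T : Rbar) (u v : R -> R) (x : R) :
  complete_flow g u0 u1 T u v -> 0 < u1 -> stalls T u v x -> x <> 1 -> x <> -1 ->
  exists d, 0 < d /\ forall g' T' u' v', 0 <= g' -> Rabs (g' - g) < d ->
    complete_flow g' u0 u1 T' u' v' ->
    forall s, moving T' v' s -> 1 / 4 <= energy (u' s) (v' s) -> u' s < x.
Proof.
  intros CF Hu1 St N1 N2. pose proof (energy_zero_lt x N1 N2) as Ex.
  destruct (stalls_near g u0 u1 T u v x (1 / 4 - energy x 0) CF Hu1 St ltac:(lra)) as [d [Hd H]].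
  exists d. split; [exact Hd|]. intros g' T' u' v' Hg' Hg CF' s Ms HE.
  destruct (H g' T' u' v' Hg CF') as [r [Mr [Hr Er]]].
  assert (F' : duffing_flow g' T' u' v') by apply CF'.
  assert (0 <= r) by apply Mr. assert (0 <= s) by apply Ms.
  destruct (Rle_dec r s) as [L|L].
  - assert (energy (u' s) (v' s) <= energy (u' r) (v' r)); [|lra].
    apply (energy_nonincreasing g' T'); try assumption; [lra|apply Ms].
  - pose proof (moving_increasing g' T' u' v' s r F' Mr ltac:(lra)). lra.
Qed.

(** * The thresholds *)

Lemma saddle_energy (a : R) : a = 1 \/ a = -1 -> energy a 0 = 1 / 4.
Proof. intros [-> | ->]; unfold energy; field. Qed.

(** Arrival in finite time is excluded by [equilibrium_backward]. In the asymptotic case E >= 1/4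
    throughout, and factoring 1 - u^2 in the resulting velocity bound gives v >= (a - u) / 2. *)
Lemma stalls_saddle_convergence (g u0 u1 a : R) (T : Rbar) (u v : R -> R) :
  complete_flow g u0 u1 T u v -> 0 <= g -> 0 < u1 -> a = 1 \/ a = -1 -> stalls T u v a ->
  converges_exponentially a 0 T u v.
Proof.
  intros CF Hg Hu1 Ha St. assert (CF' := CF). destruct CF' as [HT [I0 [I1 [F _]]]].
  assert (St' := St). destruct St' as [[s [H0 [Hs [_ [Ev Eu]]]]]|[-> [Vp [Lu _]]]].
  { destruct (equilibrium_backward g a T u v s F) as [_ E]; try assumption; [|lra].
    destruct Ha as [-> | ->]; ring. }
  assert (M : forall t, 0 <= t -> moving p_infty v t).
  { intros t Ht. split; [exact Ht|]. split; [exact I|]. intros r Hr. apply Vp. lra. }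
  assert (Ub : forall t, 0 <= t -> u t < a).
  { intros t Ht. apply (stalls_bound g u0 u1 p_infty u v a t CF Hu1 St), M, Ht. }
  assert (V : forall t, 0 <= t -> (1 - u t ^ 2) / 2 <= v t /\ - (1 - u t ^ 2) / 2 <= v t).
  { intros t Ht. apply energy_ge_velocity; [|apply Rlt_le, Vp, Ht].
    rewrite <- (saddle_energy a Ha).
    apply (stalls_energy_ge g u0 u1 p_infty u v a t CF Hu1 Hg St), M, Ht. }
  destruct Ha as [-> | ->].
  (* Waiting until u > 0 makes 1 + u >= 1 and gives the sign of u^3 - u; for the saddle -1 both
     requirements hold from the start. *)
  - destruct (is_lim_p_infty_eps u 1 1 Lu ltac:(lra)) as [N [HN H]].
    apply (saddle_convergence g 1 (N + 1) u v F Hg); [lra|].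
    intros t Ht. specialize (H t ltac:(lra)). apply Rabs_def2 in H.
    specialize (Ub t ltac:(lra)). specialize (V t ltac:(lra)). specialize (Vp t ltac:(lra)).
    split; [exact Vp|]. split; [exact Ub|]. split; nra.
  - apply (saddle_convergence g (-1) 0 u v F Hg); [lra|].
    intros t Ht. specialize (Ub t Ht). specialize (V t Ht). specialize (Vp t Ht).
    split; [exact Vp|]. split; [exact Ub|]. split; [|nra].
    assert (0 < u t ^ 2 - 1) by nra. nra.
Qed.

Lemma stalls_well_convergence (g u0 u1 x : R) (T : Rbar) (u v : R -> R) :
  complete_flow g u0 u1 T u v -> 0 < g -> 0 < u1 -> -1 < x < 1 -> stalls T u v x ->
  converges_exponentially 0 0 T u v.
Proof.
  intros CF Hg Hu1 Hx St. pose proof (energy_zero_lt x ltac:(lra) ltac:(lra)) as Ex.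
  set (eps := Rmin (x + 1) (1 / 4 - energy x 0)).
  assert (E1 : eps <= x + 1) by apply Rmin_l.
  assert (E2 : eps <= 1 / 4 - energy x 0) by apply Rmin_r.
  destruct (stalls_energy g u0 u1 T u v x eps CF Hu1 St) as [s [Ms [Hu HE]]].
  { apply Rmin_glb_lt; lra. }
  apply Rabs_def2 in HE.
  apply (well_convergence g u0 u1 T u v s CF Hg); try lra; apply Ms.
Qed.

Lemma stalls_left_enters (g u0 u1 x : R) (T : Rbar) (u v : R -> R) :
  complete_flow g u0 u1 T u v -> 0 <= g -> 0 < u1 -> x < -1 -> stalls T u v x ->
  enters Kminus_left T u v /\ blows_up T.
Proof.
  intros CF Hg Hu1 Hx St. pose proof (energy_zero_lt x ltac:(lra) ltac:(lra)) as Ex.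
  destruct (stalls_energy g u0 u1 T u v x (1 / 4 - energy x 0) CF Hu1 St ltac:(lra))
    as [s [Ms [Hu HE]]].
  apply Rabs_def2 in HE. destruct Ms as [H0 [HsT _]]. split.
  - exists s. split; [now split|]. repeat split; try lra.
    rewrite Rabs_left; lra.
  - destruct CF as [HT [_ [_ [F _]]]]. destruct T as [T| |]; [exact I| |contradiction HT].
    exfalso. apply (Kminus_left_blowup g u v s F Hg H0); lra.
Qed.

Lemma outward_blows_up (g : R) (T : Rbar) (u v : R -> R) (s : R) :
  duffing_flow g T u v -> 0 <= g -> 0 <= s -> Rbar_lt s T -> 1 <= u s -> 0 < v s -> blows_up T.
Proof.
  intros F Hg Hs HsT Hu Hv. destruct T as [T| |]; [exact I| |contradiction HsT].
  exfalso. now apply (outward_blowup g u v s).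
Qed.

Lemma passes_one_enters (g u0 u1 : R) (T : Rbar) (u v : R -> R) :
  complete_flow g u0 u1 T u v -> 0 <= g -> passes T u v 1 -> enters N1 T u v /\ blows_up T.
Proof.
  intros CF Hg [s [[H0 [HsT Vp]] Es]]. specialize (Vp s ltac:(lra)). split.
  - exists s. split; [now split|]. rewrite Es. unfold N1, Nset.
    rewrite (energy_equilibrium 1) by ring. pose proof (pow2_ge_0 (v s)). lra.
  - apply (outward_blows_up g T u v s); try assumption; [apply CF|lra].
Qed.

(** A stall of the smaller damping is impossible: at x < 1 the larger damping passes x, against
    [stall_order]; at 1 it would pass or stall as well, against [stall_order] or
    [stall_order_saddle]. *)
Lemma passes_one_monotone (g g' u0 u1 : R) (T T' : Rbar) (u v p q : R -> R) :
  complete_flow g u0 u1 T u v -> complete_flow g' u0 u1 T' p q -> 0 <= g < g' ->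
  u0 < 1 -> 0 < u1 -> passes T' p q 1 \/ stalls T' p q 1 -> passes T u v 1.
Proof.
  intros CF CF' Hg Hu0 Hu1 H.
  destruct (passes_or_stalls g u0 u1 T u v CF ltac:(lra) Hu0 Hu1) as [P|[x [Hx St]]]; [exact P|].
  exfalso. destruct (Req_dec x 1) as [->|Hne]; [destruct H as [P|St']|].
  - apply (stall_order g g' u0 u1 T T' u v p q 1); try assumption; lra.
  - apply (stall_order_saddle g g' u0 u1 1 T T' u v p q); try assumption; [lra|now left].
  - apply (stall_order g g' u0 u1 T T' u v p q x); try assumption; try lra.
    destruct H as [P|St'].
    + apply (passes_passes g' u0 u1 T' p q 1); try assumption; lra.
    + apply (stalls_passes g' u0 u1 T' p q 1); try assumption; lra.
Qed.

(** With more damping the motion can neither pass -1, by [stall_order], nor stall there, by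
    [stall_order_saddle]. *)
Lemma stalls_left_monotone (g g' u0 u1 : R) (T T' : Rbar) (u v p q : R -> R) :
  complete_flow g u0 u1 T u v -> complete_flow g' u0 u1 T' p q -> 0 <= g < g' ->
  u0 < -1 -> 0 < u1 -> stalls T u v (-1) -> exists x, x < -1 /\ stalls T' p q x.
Proof.
  intros CF CF' Hg Hu0 Hu1 St.
  assert (N : ~ passes T' p q (-1)).
  { intros P. apply (stall_order g g' u0 u1 T T' u v p q (-1)); try assumption; lra. }
  destruct (passes_or_stalls g' u0 u1 T' p q CF' ltac:(lra) ltac:(lra) Hu1) as [P|[x [Hx St']]].
  - contradiction N. apply (passes_passes g' u0 u1 T' p q 1); try assumption; lra.
  - destruct (Rtotal_order x (-1)) as [L|[->|L]].
    + now exists x.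
    + exfalso. apply (stall_order_saddle g g' u0 u1 (-1) T T' u v p q); try assumption; [lra|now right].
    + contradiction N. apply (stalls_passes g' u0 u1 T' p q x); try assumption; lra.
Qed.

(** (1 - y)^2 (y + 2) / 6 is the integral of (1 - x^2) / 2 from y to 1, a lower bound for the
    dissipation per unit of damping until the crossing, where the energy still exceeds 1/4. For y =
    -1 it equals 2/3. *)
Lemma passes_one_dissipation (g u0 u1 : R) (T : Rbar) (u v : R -> R) (r : R) :
  complete_flow g u0 u1 T u v -> 0 <= g -> passes T u v 1 -> moving T v r -> u r < 1 ->
  g * ((1 - u r) ^ 2 * (u r + 2) / 6) < energy (u r) (v r) - 1 / 4.
Proof.
  intros CF Hg [s [Ms Es]] Mr Hr. assert (F : duffing_flow g T u v) by apply CF.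
  assert (Hrs : r < s) by (apply (moving_order g T u v r s F Mr Ms); lra).
  destruct Ms as [H0 [HsT Vp]]. assert (0 <= r) by apply Mr.
  assert (HE : 1 / 4 < energy (u s) (v s)).
  { rewrite Es, (energy_equilibrium 1) by ring. specialize (Vp s ltac:(lra)). nra. }
  assert (D : energy (u s) (v s) + g * 1 * (u s - u s ^ 3 / 3) / 2
    <= energy (u r) (v r) + g * 1 * (u r - u r ^ 3 / 3) / 2).
  { apply (energy_dissipation g 1 T); try assumption; [now left|lra| |lra].
    intros t Ht. apply Rlt_le, Vp. lra. }
  rewrite Es in *. lra.
Qed.

Lemma stall_threshold (u0 u1 : R) :
  u0 < 1 -> 0 < u1 -> 1 / 4 < energy u0 u1 ->
  exists gamma0, 0 < gamma0 /\
    forall g T u v, 0 <= g -> complete_flow g u0 u1 T u v ->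
      (g < gamma0 -> passes T u v 1) /\
      (g = gamma0 -> stalls T u v 1) /\
      (gamma0 < g -> exists x, u0 < x < 1 /\ stalls T u v x).
Proof.
  intros Hu0 Hu1 HE.
  set (A := fun g => 0 <= g /\ exists T u v, complete_flow g u0 u1 T u v /\ passes T u v 1).
  (* Without damping the energy stays above 1/4, whereas a stall has energy at most 1/4. *)
  assert (A0 : A 0).
  { split; [lra|]. destruct (complete_flow_exists 0 u0 u1) as [T [u [v CF]]].
    exists T, u, v. split; [exact CF|].
    destruct (passes_or_stalls 0 u0 u1 T u v CF ltac:(lra) Hu0 Hu1) as [P|[x [Hx St]]]; [exact P|].
    exfalso. pose proof (energy_zero_le x) as Ex.
    destruct (stalls_energy 0 u0 u1 T u v x (energy u0 u1 - 1 / 4) CF Hu1 St ltac:(lra))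
      as [s [Ms [_ Es]]].
    destruct CF as [_ [I0 [I1 [F _]]]].
    rewrite (energy_conserved T u v s F), I0, I1 in Es by apply Ms.
    apply Rabs_def2 in Es. lra. }
  destruct (completeness A) as [g0 [Hub Hlub]].
  (* Between max(u0, -1) and 1 the dissipation is at least g k with k > 0, and only the excess of
     the energy over 1/4 can be spent, so the crossing dampings are bounded. Starting at -1 or
     further right keeps y + 2 positive. *)
  { set (y := Rmax u0 (-1)).
    assert (Y1 : u0 <= y) by apply Rmax_l. assert (Y2 : -1 <= y) by apply Rmax_r.
    assert (Y3 : y < 1) by (apply Rmax_lub_lt; lra).
    set (k := (1 - y) ^ 2 * (y + 2) / 6).
    assert (Hk : 0 < k).
    { unfold k. apply Rdiv_lt_0_compat; [|lra]. apply Rmult_lt_0_compat; [|lra]. apply pow_lt. lra. }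
    exists ((energy u0 u1 - 1 / 4) / k). intros g [Hg [T [u [v [CF P]]]]].
    destruct (passes_passes g u0 u1 T u v 1 y CF P ltac:(lra)) as [r [Mr Er]].
    pose proof (passes_one_dissipation g u0 u1 T u v r CF Hg P Mr ltac:(lra)) as D.
    rewrite Er in D. fold k in D.
    assert (Er' : energy (u r) (v r) <= energy u0 u1).
    { destruct CF as [HT [I0 [I1 [F _]]]]. rewrite <- I0, <- I1.
      apply (energy_nonincreasing g T); try assumption; [|apply Mr].
      assert (0 <= r) by apply Mr. lra. }
    rewrite Er in Er'. apply Rmult_le_reg_r with k; [exact Hk|].
    replace ((energy u0 u1 - 1 / 4) / k * k) with (energy u0 u1 - 1 / 4) by (field; lra). lra. }
  { now exists 0. }
  (* Crossing is an open condition, so the supremum is not attained. *)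
  assert (Aopen : forall g T u v, 0 <= g -> complete_flow g u0 u1 T u v -> passes T u v 1 -> g < g0).
  { intros g T u v Hg CF P.
    destruct (passes_open g u0 u1 T u v 1 CF P) as [d [Hd H]].
    destruct (complete_flow_exists (g + d / 2) u0 u1) as [T' [u' [v' CF']]].
    assert (g + d / 2 <= g0); [|lra]. apply Hub. split; [lra|]. exists T', u', v'.
    split; [exact CF'|]. apply (H (g + d / 2)); [|exact CF'].
    replace (g + d / 2 - g) with (d / 2) by ring. rewrite Rabs_pos_eq; lra. }
  assert (Hg0 : 0 < g0).
  { destruct A0 as [_ [T [u [v [CF P]]]]]. now apply (Aopen 0 T u v (Rle_refl 0)). }
  assert (Aclose : forall d, 0 < d -> exists g, g0 - d < g <= g0 /\ A g).
  { intros d Hd. destruct (classic (exists g, g0 - d < g <= g0 /\ A g)) as [|Hn]; [assumption|].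
    exfalso. assert (g0 <= g0 - d); [|lra]. apply Hlub. intros g Ag.
    apply Rnot_lt_le. intros L. apply Hn. exists g. specialize (Hub g Ag). split; [lra|exact Ag]. }
  assert (Below : forall g T u v, 0 <= g < g0 -> complete_flow g u0 u1 T u v -> passes T u v 1).
  { intros g T u v Hg CF. destruct (Aclose (g0 - g) ltac:(lra)) as [g' [Hg' [_ [T' [p [q [CF' P]]]]]]].
    apply (passes_one_monotone g g' u0 u1 T T' u v p q); try assumption; [lra|now left]. }
  exists g0. split; [exact Hg0|]. intros g T u v Hg CF. split; [|split].
  - intros L. apply (Below g); [lra|exact CF].
  - intros ->.
    destruct (passes_or_stalls g0 u0 u1 T u v CF Hg Hu0 Hu1) as [P|[x [Hx St]]].
    { pose proof (Aopen g0 T u v Hg CF P). lra. }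
    destruct (Req_dec x 1) as [->|N1]; [exact St|exfalso].
    destruct (Req_dec x (-1)) as [->|N2].
    + (* Crossing [-1, 1] costs energy at least [2/3 g], more than the excess left near [-1]. *)
      destruct (stalls_near g0 u0 u1 T u v (-1) (g0 / 3) CF Hu1 St ltac:(lra)) as [d [Hd H]].
      (* The bound g0 / 2 gives g' > g0 / 2, hence 2 g' / 3 > g0 / 3, the excess granted above. *)
      destruct (Aclose (Rmin d (g0 / 2))) as [g' [Hg' [Hg'' [T' [p [q [CF' P]]]]]]].
      { apply Rmin_glb_lt; lra. }
      pose proof (Rmin_l d (g0 / 2)). pose proof (Rmin_r d (g0 / 2)).
      destruct (H g' T' p q) as [s [Ms [Hs Es]]]; [apply Rabs_def1; lra|exact CF'|].
      rewrite (saddle_energy (-1)) in Es by now right.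
      destruct (passes_passes g' u0 u1 T' p q 1 (-1) CF' P ltac:(lra)) as [r [Mr Er]].
      pose proof (passes_one_dissipation g' u0 u1 T' p q r CF' Hg'' P Mr ltac:(lra)) as D.
      assert (F' : duffing_flow g' T' p q) by apply CF'.
      assert (Hsr : s < r) by (apply (moving_order g' T' p q s r F' Ms Mr); lra).
      assert (energy (p r) (q r) <= energy (p s) (q s)).
      { apply (energy_nonincreasing g' T'); try assumption; [|apply Mr].
        assert (0 <= s) by apply Ms. lra. }
      rewrite Er in *. lra.
    (* Dampings just below [g0] cross 1 with energy at least 1/4, but near a stall at [x] off the
       saddles such an energy is possible only left of x <= 1. *)
    + destruct (stalls_low_near g0 u0 u1 T u v x CF Hu1 St N1 N2) as [d [Hd H]].
      destruct (Aclose d Hd) as [g' [Hg' [Hg'' [T' [p [q [CF' [s [Ms Es]]]]]]]]].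
      assert (p s < x); [|lra].
      apply (H g' T' p q); try assumption; [apply Rabs_def1; lra|].
      rewrite Es, (energy_equilibrium 1) by ring. pose proof (pow2_ge_0 (q s)). lra.
  - intros L.
    destruct (passes_or_stalls g u0 u1 T u v CF Hg Hu0 Hu1) as [P|[x [Hx St]]].
    { pose proof (Aopen g T u v Hg CF P). lra. }
    destruct (Req_dec x 1) as [->|N1]; [exfalso|exists x; split; [lra|exact St]].
    (* A stall at 1 for g > g0 would make every smaller damping cross, in particular the midpoint,
       which lies above the supremum. *)
    destruct (complete_flow_exists ((g0 + g) / 2) u0 u1) as [T' [p [q CF']]].
    assert ((g0 + g) / 2 < g0); [|lra]. apply (Aopen _ T' p q); [lra|exact CF'|].
    apply (passes_one_monotone ((g0 + g) / 2) g u0 u1 T' T p q u v); try assumption; [lra|now right].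
Qed.

Lemma stalls_left_exists (u0 u1 : R) :
  u0 < -1 -> 0 < u1 ->
  exists g T u v x, 0 <= g /\ complete_flow g u0 u1 T u v /\ x < -1 /\ stalls T u v x.
Proof.
  (* With this damping u1 + g u0 = - g - 1, so g u < - g - 1 as long as v > 0 and u <= -1. The
     margin 1 / g left of -1, due to the summand 1, excludes a stall at -1 too. *)
  intros Hu0 Hu1. set (g := (u1 + 1) / (-1 - u0)).
  assert (Hg : 0 < g) by (apply Rdiv_lt_0_compat; lra).
  destruct (complete_flow_exists g u0 u1) as [T [u [v CF]]].
  exists g, T, u, v. assert (CF' := CF). destruct CF' as [_ [I0 [I1 [F _]]]].
  (* [v + g u] decreases on [u <= -1]. *)
  assert (B : forall s, moving T v s -> u s <= -1 -> u s < -1 - / g).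
  { intros s Ms Hs. assert (Ms' := Ms). destruct Ms' as [H0 [HsT Vp]].
    assert (D : forall t, 0 <= t <= s ->
      is_derive (fun t => - (v t + g * u t)) t (- (u t ^ 3 - u t))).
    { intros t Ht. destruct (F t) as [Du Dv];
        [lra|apply Rbar_lt_le_trans_R with s; [lra|exact HsT]|]. derive_atoms. ring. }
    assert (H : - (v 0 + g * u 0) <= - (v s + g * u s)).
    { apply (derive_nonneg_le (fun t => - (v t + g * u t)) (fun t => - (u t ^ 3 - u t))); [lra| | |].
      - intros t Ht. apply D. lra.
      - intros t Ht. eapply is_derive_continuous, D, Ht.
      - intros t Ht. pose proof (moving_increasing g T u v t s F Ms ltac:(lra)).
        assert (1 <= u t ^ 2) by nra. nra. }
    rewrite I0, I1 in H. specialize (Vp s ltac:(lra)).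
    apply Rmult_lt_reg_l with g; [exact Hg|].
    replace (g * (-1 - / g)) with (- g - 1) by (field; lra).
    assert (g * (-1 - u0) = u1 + 1) by (unfold g; field; lra). lra. }
  assert (Hgi : 0 < / g) by now apply Rinv_0_lt_compat.
  assert (N : ~ passes T u v (-1)).
  { intros [s [Ms Es]]. specialize (B s Ms ltac:(lra)). lra. }
  destruct (passes_or_stalls g u0 u1 T u v CF ltac:(lra) ltac:(lra) Hu1) as [P|[x [Hx St]]].
  - contradiction N. apply (passes_passes g u0 u1 T u v 1); try assumption; lra.
  - exists x. split; [lra|]. split; [exact CF|]. split; [|exact St].
    apply Rnot_le_lt. intros L. destruct (Req_dec x (-1)) as [->|Hne].
    + destruct (stalls_approach g u0 u1 T u v (-1) (/ g) CF Hu1 St Hgi) as [s [Ms [Hs _]]].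
      specialize (B s Ms ltac:(lra)). lra.
    + contradiction N. apply (stalls_passes g u0 u1 T u v x); try assumption; lra.
Qed.

Lemma stall_threshold_left (u0 u1 gamma0 : R) :
  u0 < -1 -> 0 < u1 -> 0 < gamma0 ->
  (forall g T u v, 0 <= g -> complete_flow g u0 u1 T u v ->
     (g < gamma0 -> passes T u v 1) /\ (g = gamma0 -> stalls T u v 1)) ->
  exists gamma1, gamma0 < gamma1 /\
    forall g T u v, 0 <= g -> complete_flow g u0 u1 T u v ->
      (g < gamma1 -> forall x, stalls T u v x -> -1 < x) /\
      (g = gamma1 -> stalls T u v (-1)) /\
      (gamma1 < g -> exists x, x < -1 /\ stalls T u v x).
Proof.
  intros Hu0 Hu1 Hg0 H0.
  set (C := fun g => 0 <= g /\ exists T u v x, complete_flow g u0 u1 T u v /\ x < -1 /\ stalls T u v x).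
  assert (Clow : forall g, C g -> gamma0 < g).
  { intros g [Hg [T [u [v [x [CF [Hx St]]]]]]]. destruct (H0 g T u v Hg CF) as [P S].
    apply Rnot_le_lt. intros L. destruct (Rle_lt_or_eq_dec _ _ L) as [L'|L'].
    - pose proof (stalls_not_passes g u0 u1 T u v x 1 CF Hu1 St (P L')). lra.
    - assert (P' : passes T u v (-1)).
      { apply (stalls_passes g u0 u1 T u v 1); try assumption; [now apply S|lra]. }
      pose proof (stalls_not_passes g u0 u1 T u v x (-1) CF Hu1 St P'). lra. }
  (* The infimum of [C] is taken as minus the supremum of the opposite set. *)
  destruct (completeness (fun y => C (- y))) as [l [Hub Hlub]].
  { exists (- gamma0). intros y Hy. apply Clow in Hy. lra. }
  { destruct (stalls_left_exists u0 u1 Hu0 Hu1) as [g [T [u [v [x [Hg [CF [Hx St]]]]]]]].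
    exists (- g). rewrite Ropp_involutive. split; [exact Hg|]. now exists T, u, v, x. }
  set (g1 := - l).
  assert (Clb : forall g, C g -> g1 <= g).
  { intros g Cg. unfold g1. rewrite <- (Ropp_involutive g) in Cg. specialize (Hub _ Cg). lra. }
  assert (Hg01 : gamma0 <= g1).
  { unfold g1. assert (l <= - gamma0); [|lra]. apply Hlub. intros y Hy. apply Clow in Hy. lra. }
  assert (Cclose : forall d, 0 < d -> exists g, g1 <= g < g1 + d /\ C g).
  { intros d Hd. destruct (classic (exists g, g1 <= g < g1 + d /\ C g)) as [|Hn]; [assumption|].
    exfalso. assert (l <= l - d); [|lra]. apply Hlub. intros y Cy.
    apply Rnot_lt_le. intros L. apply Hn. exists (- y). pose proof (Clb _ Cy).
    split; [unfold g1 in *; lra|exact Cy]. }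
  (* Elimination at the infimum: passing -1 would persist for elements of [C] near [g1], and a stall
     left of -1 would persist for dampings slightly below [g1]. *)
  assert (AtG1 : forall T u v, complete_flow g1 u0 u1 T u v -> stalls T u v (-1)).
  { intros T u v CF.
    assert (NP : ~ passes T u v (-1)).
    { intros P. destruct (passes_open g1 u0 u1 T u v (-1) CF P) as [d [Hd H]].
      destruct (Cclose d Hd) as [g [Hg [_ [T' [p [q [x [CF' [Hx St]]]]]]]]].
      assert (P' := H g T' p q ltac:(apply Rabs_def1; lra) CF').
      pose proof (stalls_not_passes g u0 u1 T' p q x (-1) CF' Hu1 St P'). lra. }
    destruct (passes_or_stalls g1 u0 u1 T u v CF ltac:(lra) ltac:(lra) Hu1) as [P|[x [Hx St]]].
    { contradiction NP. apply (passes_passes g1 u0 u1 T u v 1); try assumption; lra. }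
    destruct (Rtotal_order x (-1)) as [L|[->|L]]; [exfalso|exact St|].
    2: { contradiction NP. apply (stalls_passes g1 u0 u1 T u v x); try assumption; lra. }
    destruct (stalls_low_near g1 u0 u1 T u v x CF Hu1 St ltac:(lra) ltac:(lra)) as [d [Hd H]].
    (* Below [g1], within [d] of it, and still positive because g1 >= gamma0 > 0. *)
    set (g := g1 - Rmin d g1 / 2).
    pose proof (Rmin_l d g1). pose proof (Rmin_r d g1).
    assert (0 < Rmin d g1) by (apply Rmin_glb_lt; lra).
    destruct (complete_flow_exists g u0 u1) as [T' [p [q CF']]].
    assert (Low := H g T' p q ltac:(unfold g; lra) ltac:(apply Rabs_def1; unfold g; lra) CF').
    assert (NP' : ~ passes T' p q (-1)).
    { intros [s [Ms Es]]. assert (p s < x); [|lra]. apply Low; [exact Ms|].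
      rewrite Es, (energy_equilibrium (-1)) by ring. pose proof (pow2_ge_0 (q s)). lra. }
    destruct (passes_or_stalls g u0 u1 T' p q CF' ltac:(unfold g; lra) ltac:(lra) Hu1)
      as [P|[x' [Hx' St']]].
    { apply NP'. apply (passes_passes g u0 u1 T' p q 1); try assumption; lra. }
    destruct (Rtotal_order x' (-1)) as [L'|[->|L']].
    - assert (g1 <= g); [|unfold g in *; lra]. apply Clb. split; [unfold g; lra|].
      now exists T', p, q, x'.
    - destruct (stalls_approach g u0 u1 T' p q (-1) (-1 - x) CF' Hu1 St' ltac:(lra))
        as [s [Ms [Hs _]]].
      assert (p s < x); [|lra]. apply Low; [exact Ms|].
      rewrite <- (saddle_energy (-1)) by now right.
      apply (stalls_energy_ge g u0 u1 T' p q (-1) s CF' Hu1); try assumption. unfold g; lra.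
    - apply NP'. apply (stalls_passes g u0 u1 T' p q x'); try assumption; lra. }
  destruct (complete_flow_exists g1 u0 u1) as [T1 [p1 [q1 CF1]]].
  assert (St1 := AtG1 T1 p1 q1 CF1).
  assert (Above : forall g T u v, g1 < g -> complete_flow g u0 u1 T u v ->
    exists x, x < -1 /\ stalls T u v x).
  { intros g T u v Hg CF.
    apply (stalls_left_monotone g1 g u0 u1 T1 T p1 q1 u v); try assumption. lra. }
  exists g1. split.
  (* Equality would make one motion stall both at 1 and at -1. *)
  - destruct (Rle_lt_or_eq_dec _ _ Hg01) as [L|E]; [exact L|exfalso].
    destruct (H0 g1 T1 p1 q1 ltac:(lra) CF1) as [_ S]. specialize (S (eq_sym E)).
    assert (P : passes T1 p1 q1 (-1)).
    { apply (stalls_passes g1 u0 u1 T1 p1 q1 1); try assumption. lra. }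
    pose proof (stalls_not_passes g1 u0 u1 T1 p1 q1 (-1) (-1) CF1 Hu1 St1 P). lra.
  - intros g T u v Hg CF. split; [|split].
    + intros L x St. apply Rnot_le_lt. intros Lx. destruct (Req_dec x (-1)) as [->|Hne].
      (* A stall at -1 for g < g1 would make the midpoint stall left of -1 and so belong to [C],
         although it lies below the infimum. *)
      * destruct (complete_flow_exists ((g + g1) / 2) u0 u1) as [T' [p [q CF']]].
        destruct (stalls_left_monotone g ((g + g1) / 2) u0 u1 T T' u v p q) as [x [Hx St']];
          try assumption; [lra|].
        assert (g1 <= (g + g1) / 2); [|lra]. apply Clb. split; [lra|]. now exists T', p, q, x.
      * assert (g1 <= g); [|lra]. apply Clb. split; [exact Hg|]. exists T, u, v, x.
        split; [exact CF|]. split; [lra|exact St].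
    + intros ->. now apply AtG1.
    + intros L. now apply (Above g).
Qed.

(** Without damping the energy remains 1/4, which only the saddles have among points at rest. With
    damping it is strictly below 1/4 as soon as the motion has begun, whereas a stall at a saddle
    keeps it at least 1/4. *)
Lemma critical_energy_stall (g u0 u1 : R) (T : Rbar) (u v : R -> R) (x : R) :
  complete_flow g u0 u1 T u v -> 0 < u1 -> energy u0 u1 = 1 / 4 -> u0 < x -> stalls T u v x ->
  (g = 0 -> x = 1 \/ x = -1) /\ (0 < g -> x <> 1 /\ x <> -1).
Proof.
  intros CF Hu1 HE Hx St. split.
  - intros ->. destruct (Req_dec x 1) as [E|N1]; [now left|].
    destruct (Req_dec x (-1)) as [E|N2]; [now right|exfalso].
    pose proof (energy_zero_lt x N1 N2) as Ex.
    destruct (stalls_energy 0 u0 u1 T u v x (1 / 4 - energy x 0) CF Hu1 St ltac:(lra))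
      as [s [Ms [_ Es]]].
    destruct CF as [_ [I0 [I1 [F _]]]].
    rewrite (energy_conserved T u v s F), I0, I1 in Es by apply Ms.
    apply Rabs_def2 in Es. lra.
  - intros Hg. cut (energy x 0 <> 1 / 4).
    { intros N. split; intros E; apply N; apply saddle_energy; auto. }
    intros E.
    destruct (stalls_approach g u0 u1 T u v x (x - u0) CF Hu1 St ltac:(lra)) as [s [Ms [Hs _]]].
    pose proof (stalls_energy_ge g u0 u1 T u v x s CF Hu1 ltac:(lra) St Ms).
    destruct CF as [_ [I0 [I1 [F _]]]].
    assert (0 < s) by (destruct Ms as [H0 _]; destruct (Req_dec s 0) as [E0|]; [subst s; lra|lra]).
    assert (energy (u s) (v s) < energy (u 0) (v 0)).
    { apply (energy_decreasing g T); try assumption; [lra|apply Ms|]. intros r Hr. apply Ms. lra. }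
    rewrite I0, I1 in *. lra.
Qed.

(** Being at the abscissa of a saddle with v > 0 takes energy strictly above 1/4. *)
Lemma critical_energy_not_passes (g u0 u1 a : R) (T : Rbar) (u v : R -> R) :
  complete_flow g u0 u1 T u v -> 0 <= g -> energy u0 u1 = 1 / 4 -> a = 1 \/ a = -1 ->
  ~ passes T u v a.
Proof.
  intros [HT [I0 [I1 [F _]]]] Hg HE Ha [s [[H0 [HsT Vp]] Es]].
  assert (E : energy (u s) (v s) <= energy (u 0) (v 0)).
  { apply (energy_nonincreasing g T); try assumption. lra. }
  specialize (Vp s ltac:(lra)).
  rewrite I0, I1, Es, (energy_equilibrium a) in E by (destruct Ha as [-> | ->]; ring). nra.
Qed.

Lemma enters_ext (S : R -> R -> Prop) (T : Rbar) (u v u' v' : R -> R) :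
  (forall t, 0 <= t -> u' t = u t /\ v' t = v t) -> enters S T u' v' -> enters S T u v.
Proof.
  intros E [t [Ht H]]. exists t. destruct (E t (proj1 Ht)) as [<- <-]. now split.
Qed.

Lemma converges_exponentially_ext (a b : R) (T : Rbar) (u v u' v' : R -> R) :
  (forall t, 0 <= t -> u' t = u t /\ v' t = v t) ->
  converges_exponentially a b T u' v' -> converges_exponentially a b T u v.
Proof.
  intros E [HT [Lu [Lv [C [c [HC [Hc H]]]]]]]. split; [exact HT|]. split; [|split].
  - apply is_lim_ext_loc with u'; [|exact Lu]. exists 0. intros t Ht. apply E. lra.
  - apply is_lim_ext_loc with v'; [|exact Lv]. exists 0. intros t Ht. apply E. lra.
  - exists C, c. split; [exact HC|]. split; [exact Hc|]. intros t Ht.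
    destruct (E t ltac:(lra)) as [<- <-]. now apply H.
Qed.

Theorem theorem2 (u0 u1 : R) (hN : Nset u0 u1) (hu1 : u1 > 0) :
  (N1 u0 u1 ->
    forall (gamma : R) (T : Rbar) (u v : R -> R),
      0 <= gamma -> maximal_duffing_solution gamma u0 u1 T u v ->
      blows_up T /\ (gamma > 0 -> enters Kminus_right T u v))
  /\
  (N2 u0 u1 ->
    exists gamma0 : R, gamma0 >= 0 /\
      (forall (gamma : R) (T : Rbar) (u v : R -> R),
        0 <= gamma -> maximal_duffing_solution gamma u0 u1 T u v ->
        (gamma < gamma0 -> enters N1 T u v /\ blows_up T) /\
        (gamma = gamma0 -> converges_exponentially 1 0 T u v) /\
        (gamma > gamma0 -> converges_exponentially 0 0 T u v)) /\
      (energy u0 u1 = 1 / 4 -> gamma0 = 0))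
  /\
  (N3 u0 u1 -> energy u0 u1 > 1 / 4 ->
    exists gamma0 gamma1 : R, gamma1 > gamma0 /\ gamma0 >= 0 /\
      forall (gamma : R) (T : Rbar) (u v : R -> R),
        0 <= gamma -> maximal_duffing_solution gamma u0 u1 T u v ->
        (gamma < gamma0 -> enters N1 T u v /\ blows_up T) /\
        (gamma = gamma0 -> converges_exponentially 1 0 T u v) /\
        (gamma0 < gamma < gamma1 -> converges_exponentially 0 0 T u v) /\
        (gamma = gamma1 -> converges_exponentially (-1) 0 T u v) /\
        (gamma > gamma1 -> enters Kminus_left T u v /\ blows_up T))
  /\
  (N3 u0 u1 -> energy u0 u1 = 1 / 4 ->
    forall (gamma : R) (T : Rbar) (u v : R -> R),
      0 <= gamma -> maximal_duffing_solution gamma u0 u1 T u v ->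
      (gamma = 0 -> converges_exponentially (-1) 0 T u v) /\
      (gamma > 0 -> enters Kminus_left T u v /\ blows_up T)).
Proof.
  assert (Hu1 : 0 < u1) by lra.
  split; [|split; [|split]].
  - intros [_ [_ Hu0]] g T u v Hg Hmax.
    destruct (maximal_complete_flow _ _ _ _ _ _ Hmax) as [u' [v' [CF E]]].
    assert (CF' := CF). destruct CF' as [HT [I0 [I1 [F _]]]]. split.
    + apply (outward_blows_up g T u' v' 0); try assumption; lra.
    + intros Hg'. apply (enters_ext _ T u v u' v' E).
      destruct (outward_enters_Kminus g u0 u1 T u' v' CF) as [t [H0 [Ht [Hu HE]]]]; try lra.
      exists t. split; [now split|]. repeat split; try lra.
      rewrite Rabs_pos_eq; lra.
  - intros [_ [_ Hu0]].
    destruct (Req_dec (energy u0 u1) (1 / 4)) as [HE|HE].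
    (* At the critical energy not even the undamped motion passes 1, so the threshold is 0. *)
    + exists 0. split; [lra|]. split; [|reflexivity]. intros g T u v Hg Hmax.
      destruct (maximal_complete_flow _ _ _ _ _ _ Hmax) as [u' [v' [CF E]]].
      destruct (passes_or_stalls g u0 u1 T u' v' CF Hg ltac:(lra) Hu1) as [P|[x [Hx St]]].
      { contradiction (critical_energy_not_passes g u0 u1 1 T u' v' CF Hg HE (or_introl eq_refl) P). }
      destruct (critical_energy_stall g u0 u1 T u' v' x CF Hu1 HE ltac:(lra) St) as [S1 S2].
      split; [lra|]. split; intros Hg'; apply (converges_exponentially_ext _ _ T u v u' v' E).
      (* The alternative x = -1 is excluded by x > u0 >= -1. *)
      * destruct (S1 Hg') as [->|]; [|lra].
        apply (stalls_saddle_convergence g u0 u1); try assumption. now left.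
      * destruct (S2 ltac:(lra)) as [N1 N2].
        apply (stalls_well_convergence g u0 u1 x); try assumption; lra.
    + assert (HE' : 1 / 4 < energy u0 u1) by (unfold Nset in hN; lra).
      destruct (stall_threshold u0 u1 ltac:(lra) Hu1 HE') as [g0 [Hg0 H]].
      exists g0. split; [lra|]. split; [|lra]. intros g T u v Hg Hmax.
      destruct (maximal_complete_flow _ _ _ _ _ _ Hmax) as [u' [v' [CF E]]].
      destruct (H g T u' v' Hg CF) as [H1 [H2 H3]]. split; [|split]; intros Hg'.
      * destruct (passes_one_enters g u0 u1 T u' v' CF Hg (H1 Hg')) as [En Bl].
        split; [now apply (enters_ext _ T u v u' v' E)|exact Bl].
      * apply (converges_exponentially_ext _ _ T u v u' v' E).
        apply (stalls_saddle_convergence g u0 u1); try assumption; [now left|now apply H2].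
      * destruct (H3 Hg') as [x [Hx St]].
        apply (converges_exponentially_ext _ _ T u v u' v' E).
        apply (stalls_well_convergence g u0 u1 x); try assumption; lra.
  - intros [_ [_ Hu0]] HE.
    destruct (stall_threshold u0 u1 ltac:(lra) Hu1 HE) as [g0 [Hg0 H]].
    destruct (stall_threshold_left u0 u1 g0 Hu0 Hu1 Hg0) as [g1 [Hg1 H']].
    { intros g T u v Hg CF. destruct (H g T u v Hg CF) as [H1 [H2 _]]. now split. }
    exists g0, g1. split; [exact Hg1|]. split; [lra|]. intros g T u v Hg Hmax.
    destruct (maximal_complete_flow _ _ _ _ _ _ Hmax) as [u' [v' [CF E]]].
    destruct (H g T u' v' Hg CF) as [H1 [H2 H3]].
    destruct (H' g T u' v' Hg CF) as [H4 [H5 H6]].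
    repeat match goal with |- _ /\ _ => split; [intros Hg'|] end; [| | | |intros Hg'].
    + destruct (passes_one_enters g u0 u1 T u' v' CF Hg (H1 Hg')) as [En Bl].
      split; [now apply (enters_ext _ T u v u' v' E)|exact Bl].
    + apply (converges_exponentially_ext _ _ T u v u' v' E).
      apply (stalls_saddle_convergence g u0 u1); try assumption; [now left|now apply H2].
    + destruct (H3 (proj1 Hg')) as [x [Hx St]].
      pose proof (H4 (proj2 Hg') x St).
      apply (converges_exponentially_ext _ _ T u v u' v' E).
      apply (stalls_well_convergence g u0 u1 x); try assumption; lra.
    + apply (converges_exponentially_ext _ _ T u v u' v' E).
      apply (stalls_saddle_convergence g u0 u1); try assumption; [now right|now apply H5].
    + destruct (H6 Hg') as [x [Hx St]].
      destruct (stalls_left_enters g u0 u1 x T u' v' CF Hg Hu1 Hx St) as [En Bl].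
      split; [now apply (enters_ext _ T u v u' v' E)|exact Bl].
  - intros [_ [_ Hu0]] HE g T u v Hg Hmax.
    destruct (maximal_complete_flow _ _ _ _ _ _ Hmax) as [u' [v' [CF E]]].
    assert (NP := critical_energy_not_passes g u0 u1 (-1) T u' v' CF Hg HE (or_intror eq_refl)).
    destruct (passes_or_stalls g u0 u1 T u' v' CF Hg ltac:(lra) Hu1) as [P|[x [Hx St]]].
    { contradiction NP. apply (passes_passes g u0 u1 T u' v' 1); try assumption; lra. }
    assert (Hx' : x <= -1).
    { apply Rnot_lt_le. intros L. apply NP.
      apply (stalls_passes g u0 u1 T u' v' x); try assumption; lra. }
    destruct (critical_energy_stall g u0 u1 T u' v' x CF Hu1 HE ltac:(lra) St) as [S1 S2].
    split; intros Hg'.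
    + destruct (S1 Hg') as [| ->]; [lra|]. apply (converges_exponentially_ext _ _ T u v u' v' E).
      apply (stalls_saddle_convergence g u0 u1); try assumption. now right.
    + destruct (S2 ltac:(lra)) as [N1 N2].
      destruct (stalls_left_enters g u0 u1 x T u' v' CF Hg Hu1 ltac:(lra) St) as [En Bl].
      split; [now apply (enters_ext _ T u v u' v' E)|exact Bl].
Qed.
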